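(* Consider the sequence of systems indexed by $r\to\infty$ described in the context (customer arrival rate $\Lambda=\lambda r$; parameters $\alpha,\beta,\mu,\epsilon,\gamma$ fixed), and the centered fluid-scaled processes $(\bar X^r,\bar Y^r,\bar W^r)$. Suppose the initial states are deterministic and $(\bar X^r(0),\bar Y^r(0),\bar W^r(0))\to (x(0),y(0),w(0))$ for some fixed $(x(0),y(0),w(0))\in\mathbb{R}^3$ with $x(0)\ge -\frac{\lambda(1-\alpha)}{\beta}$. Then these processes can be constructed on a common probability space so that the following holds: with probability 1, from any subsequence of $r$ there exists a further subsequence along which $$(\bar X^r,\bar Y^r,\bar W^r)\to (x,y,w)\quad\text{uniformly on compact sets, as } r\to\infty,$$ where $(x,y,w)$ is a locally Lipschitz trajectory such that at any regular point $t\ge 0$ $$x'(t)=\begin{cases}-\gamma y'(t)-\epsilon y(t), & \text{if } x(t)>-\frac{\lambda(1-\alpha)}{\beta},\\ [-\gamma y'(t)-\epsilon y(t)]\vee 0, & \text{if } x(t)=-\frac{\lambda(1-\alpha)}{\beta},\end{cases}$$ $$y'(t)=\beta x(t)+\tfrac12\alpha\mu\,(w(t)-|y(t)|),$$ $$w'(t)=\beta x(t)+\tfrac12(\alpha-2)\mu\,(w(t)-|y(t)|).$$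
   Context: Notation: $a\wedge b=\min\{a,b\}$, $a\vee b=\max\{a,b\}$; $\mathrm{sgn}(x)=1,0,-1$ for $x>0$, $x=0$, $x<0$ respectively. Model. Parameters: $\Lambda>0$ (customer arrival rate), $\beta>0$, $\mu>0$, $\epsilon>0$, $\alpha\in[0,1)$, and $\gamma>0$ an integer. The system state is a continuous-time Markov process $(X(t),Y(t),Z(t))$, where $X(t)\ge 0$ is the number of pending invited agents, $Y(t)=Q_a(t)-Q_c(t)$ is the agent queue length minus the customer queue length (at each time at most one of the two queues is non-empty), and $Z(t)\ge 0$ is the number of customers (equivalently, agents) in service. It is driven by four types of mutually independent (and independent of the past) events. In a small interval $[t,t+dt]$: (i) With probability $\Lambda\,dt+o(dt)$, a customer arrival: $\Delta Z=1$ if $Y(t)>0$ and $\Delta Z=0$ if $Y(t)\le 0$; $\Delta Y=-1$; $\Delta X=\gamma$. (ii) With probability $\beta X(t)\,dt+o(dt)$, an agent acceptance: $\Delta Z=1$ if $Y(t)<0$ and $\Delta Z=0$ if $Y(t)\ge 0$; $\Delta Y=1$; $\Delta X=-(\gamma\wedge X(t))$. (iii) With probability $\epsilon|Y(t)|\,dt+o(dt)$, an additional event: if $X(t)\ge 1$, then $\Delta X=-\mathrm{sgn}(Y(t))$; if $X(t)=0$, then $\Delta X=1$ if $Y(t)<0$ and $\Delta X=0$ if $Y(t)\ge 0$. (iv) With probability $\mu Z(t)\,dt+o(dt)$, a service completion: (a) with probability $\alpha$ (the agent returns), $\Delta Z=0$ if $Y(t)<0$ and $\Delta Z=-1$ if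 $Y(t)\ge 0$; $\Delta Y=1$; $\Delta X=-(\gamma\wedge X(t))$; (b) with probability $1-\alpha$, $\Delta Z=-1$ only. Let $W=|Y|+2Z$ be the total number of customers and agents in the system, so $Z=\frac12(W-|Y|)$; the process $(X,Y,W)$ is an equivalent description of the state. Scaling. In the system with index $r$, the arrival rate is $\Lambda=\lambda r$ with $\lambda>0$ fixed, while $\alpha,\beta,\mu,\epsilon,\gamma$ do not depend on $r$; the process is denoted $(X^r,Y^r,W^r)$. The centered fluid-scaled processes are $$\bar X^r=\tfrac1r\Big(X^r-\tfrac{\lambda r(1-\alpha)}{\beta}\Big),\qquad \bar Y^r=\tfrac1r Y^r,\qquad \bar W^r=\tfrac1r\Big(W^r-\tfrac{2\lambda r}{\mu}\Big).$$ Regular point. For a finite set of scalar functions $f_n(t)$, $t\ge0$, $n\in N$, a point $t$ is called regular if for every subset $N_0\subseteq N$ the derivatives $\frac{d}{dt}\max_{n\in N_0}f_n(t)$ and $\frac{d}{dt}\min_{n\in N_0}f_n(t)$ exist (as proper derivatives: left and right derivatives exist and are equal). Here this is applied to the component functions of the limit trajectory. *)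

(* Defs.v *)
From mathcomp Require Import all_boot all_order all_algebra.
From mathcomp Require Import all_classical all_reals all_analysis.

Set Implicit Arguments.
Unset Strict Implicit.
Unset Printing Implicit Defensive.

Import Order.TTheory GRing.Theory Num.Theory.
Import numFieldNormedType.Exports.

Local Open Scope classical_set_scope.
Local Open Scope ring_scope.

(* (X, Y, Z): pending invited agents, agent queue minus customer queue, and
   customers in service. *)
Definition state : Type := (nat * int * nat)%type.

(* The truncated subtraction [x - gamma] is [x - min gamma x].
   In [additional_event], [x - sgz y] is nonnegative when [0 < x]. *)
Definition customer_arrival (gamma : nat) (s : state) : state :=
  let: (x, y, z) := s in
  ((x + gamma)%N, y - 1, if 0 < y then z.+1 else z).

Definition agent_acceptance (gamma : nat) (s : state) : state :=
  let: (x, y, z) := s in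
  ((x - gamma)%N, y + 1, if y < 0 then z.+1 else z).

Definition additional_event (s : state) : state :=
  let: (x, y, z) := s in
  (if (0 < x)%N then `|(x%:Z - sgz y)%R|%N else if y < 0 then 1%N else 0%N,
   y, z).

(* A service completion occurs at rate [mu * z], so the value at [z = 0] is
   irrelevant. *)
Definition completion_return (gamma : nat) (s : state) : state :=
  let: (x, y, z) := s in
  ((x - gamma)%N, y + 1, if y < 0 then z else z.-1).

Definition completion_leave (s : state) : state :=
  let: (x, y, z) := s in (x, y, z.-1).

(* Pairs (rate of an event in state [s], state right after that event); the
   service completion is split according to whether the agent returns. *)
Definition events (R : realType) (Lambda beta mu eps alpha : R) (gamma : nat)
    (s : state) : seq (R * state) :=
  let: (x, y, z) := s in
  [:: (Lambda, customer_arrival gamma s);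
      (beta * x%:R, agent_acceptance gamma s);
      (eps * `|y%:~R|, additional_event s);
      (mu * z%:R * alpha, completion_return gamma s);
      (mu * z%:R * (1 - alpha), completion_leave s)].

(* Entries of the generator. Events that leave the state unchanged cancel out,
   and the diagonal entry is minus the total rate of leaving [s]. *)
Definition generator (R : realType) (ev : state -> seq (R * state))
    (s s' : state) : R :=
  \sum_(e <- ev s) e.1 * ((e.2 == s')%:R - (s == s')%:R).

(* Only times [t >= 0] are relevant in [S t omega]. *)
Definition rcll_paths (R : realType) (Omega : Type) (S : R -> Omega -> state) :=
  forall omega : Omega,
    (forall t : R, 0 <= t -> \forall u \near t^'+, S u omega = S t omega) /\
    (forall t : R, 0 < t ->
       exists s : state, \forall u \near t^'-, S u omega = s).

(* [S] is a time-homogeneous Markov process, non-explosive with right-continuous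
   piecewise constant paths, started at [s0], whose transition probabilities
   [p h s s'] satisfy
     p h s s' = (s == s')%:R + generator ev s s' * h + o(h)  as h -> 0+.
   The past of [S] before [t] enters through the events that prescribe the values
   of [S] at finitely many times in [0, t]. *)
Definition markov_process (R : realType) (d : measure_display)
    (Omega : measurableType d) (P : probability Omega R)
    (ev : state -> seq (R * state)) (s0 : state) (S : R -> Omega -> state) :=
  [/\ forall (t : R) (A : set state), 0 <= t -> measurable (S t @^-1` A),
      forall omega : Omega, S 0 omega = s0,
      rcll_paths S &
      exists p : R -> state -> state -> R,
        (forall s s' : state,
           ((p h s s' - (s == s')%:R) / h) @[h --> 0^'+]
             --> generator ev s s') /\
        (forall (t h : R) (past : seq (R * state)) (s s' : state),
           0 <= t -> 0 <= h ->
           (forall us : R * state, us \in past -> 0 <= us.1 <= t) ->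
           let H := [set omega | S t omega = s /\
             forall us : R * state, us \in past -> S us.1 omega = us.2] in
           P (H `&` [set omega | S (t + h) omega = s'])
             = (P H * (p h s s')%:E)%E)].

(* The centered and scaled coordinates of a state, with [W = |Y| + 2 Z]. *)
Definition Xbar (R : realType) (lambda beta alpha r : R) (s : state) : R :=
  let: (x, _, _) := s in r^-1 * (x%:R - lambda * r * (1 - alpha) / beta).

Definition Ybar (R : realType) (r : R) (s : state) : R :=
  let: (_, y, _) := s in r^-1 * y%:~R.

Definition Wbar (R : realType) (lambda mu r : R) (s : state) : R :=
  let: (_, y, z) := s in
  r^-1 * ((`|y%:~R| + 2 * z%:R) - 2 * lambda * r / mu).

Definition subsequence (phi : nat -> nat) :=
  {homo phi : m n / (m < n)%N}.

(* The functions [f n] are regarded as functions on [0, +oo), so a point where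
   both one-sided derivatives exist is positive. The default value [f n0 u] of
   the iterated maximum is one of its terms. *)
Definition regular_point (R : realType) (N : finType) (f : N -> R -> R)
    (t : R) :=
  0 < t /\
  forall (N0 : {set N}) (n0 : N), n0 \in N0 ->
    derivable (fun u => \big[Num.max/f n0 u]_(n in N0) f n u) t 1 /\
    derivable (fun u => \big[Num.min/f n0 u]_(n in N0) f n u) t 1.

Definition locally_lipschitz (R : realType) (f : R -> R) :=
  [locally [lipschitz f t | t in [set t : R | 0 <= t]]].

Definition fluid_equations (R : realType)
    (lambda beta mu eps alpha : R) (gamma : nat) (x y w : R -> R) (t : R) :=
  [/\ x t > - (lambda * (1 - alpha) / beta) ->
        derive1 x t = - gamma%:R * derive1 y t - eps * y t,
      x t = - (lambda * (1 - alpha) / beta) ->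
        derive1 x t = Num.max (- gamma%:R * derive1 y t - eps * y t) 0,
      derive1 y t = beta * x t + 2^-1 * alpha * mu * (w t - `|y t|) &
      derive1 w t = beta * x t + 2^-1 * (alpha - 2) * mu * (w t - `|y t|)].

(* The inequality makes the two cases of [fluid_equations] exhaustive. *)
Definition fluid_trajectory (R : realType)
    (lambda beta mu eps alpha : R) (gamma : nat) (x y w : R -> R) :=
  [/\ locally_lipschitz x, locally_lipschitz y, locally_lipschitz w,
      forall t : R, 0 <= t -> x t >= - (lambda * (1 - alpha) / beta) &
      forall t : R, 0 <= t -> regular_point (tnth [tuple x; y; w]) t ->
        fluid_equations lambda beta mu eps alpha gamma x y w t].

(* Uniform convergence on compact subsets of [0, +oo). *)
Definition cvg_uoc (R : realType) (f : nat -> R -> R) (g : R -> R) :=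
  forall K : set R, compact K -> K `<=` [set t | 0 <= t] ->
    {uniform K, f @ \oo --> g}.

(* Main.v *)
Require Import Defs.
From HB Require Import structures.
From mathcomp Require Import all_boot all_order all_algebra.
From mathcomp Require Import all_classical all_reals all_analysis.
From mathcomp Require Import measurable_realfun.
From mathcomp Require Import zify ring lra.

(* The systems are driven by embedded jump chains, coded by the binary digits
   of one uniform number on the probability space [lam]: at each jump a mark
   selects the event and an exponential clock, divided by the total rate,
   gives the holding time.

   The sum of the marks along a path differs from the integral of the drift by
   a martingale-like noise, whose exponential moments are explicit. Hence for
   system [r] the noise is at most [eta * r] over a number of jumps of order
   [r], outside an event of probability O(1 / r), and this number of jumps is
   not exhausted before time [H]. As the probabilities of the bad events merely
   tend to [0] along the given sequence, measure-preserving rearrangements of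
   the uniform number make the bad events of all systems nested; then almost
   surely only finitely many occur.

   On good paths the scaled coordinates are asymptotically Lipschitz, so along
   an ultrafilter they converge uniformly on compact sets to Lipschitz
   functions, and a subsequence follows. For [y] and [w] the drift is continuous
   in the state and passes to the limit. For [x], the quantity [x + gamma y] has
   drift [- eps y] while [gamma] or more invitations are pending, and at least
   that in general, which is exactly the reflected equation at regular points:
   where [x] touches its lower bound, a derivative can only be [0]. *)

Set Implicit Arguments.
Unset Strict Implicit.
Unset Printing Implicit Defensive.

Import Order.TTheory GRing.Theory Num.Theory.
Import numFieldNormedType.Exports.

Local Open Scope classical_set_scope.
Local Open Scope ring_scope.

(** * The uniform law *)

(** The rates grow linearly with the state, so the number of jumps has no Poisson bound. It is
    compared with a pure birth chain whose rate rises by a constant at each jump; the Laplace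
    transform of its jump times is an explicit product, which yields both nonexplosion and a budget
    of order [r] for the jumps before [H]. Within this budget the state, hence every rate, is of
    order [r] deterministically. At each jump the mark and the clock are independent, so exponential
    moments are bounded jump by jump, without filtrations or stopping times. The tails are
    exponential in [r], so a plain union bound over the jumps replaces a maximal inequality. One
    random number per system turns a change of the coupling into a map of the unit interval, applied
    to each system separately, which leaves its law alone. The drift estimates are one-sided on
    purpose: truncation of the pending invitations at zero can only raise [x + gamma y], so near the
    boundary one of the two bounds survives. Along an ultrafilter the limits at all times exist at
    once, and such inequalities pass to the limit before any subsequence is chosen. *)

Lemma measurable_preimage d1 d2 (T1 : measurableType d1)
    (T2 : measurableType d2) (f : T1 -> T2) (A : set T2) :
  measurable_fun setT f -> measurable A -> measurable (f @^-1` A).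
Proof. by move=> mf mA; rewrite -[X in measurable X]setTI; exact: mf. Qed.

Section comparison_sets.
Context d (T : measurableType d) (R : realType) (f g : T -> R).
Hypotheses (mf : measurable_fun setT f) (mg : measurable_fun setT g).

Lemma measurable_le_set : measurable [set z | f z <= g z].
Proof. exact: (measurable_preimage (A := [set true]) (measurable_fun_ler mf mg)). Qed.

Lemma measurable_lt_set : measurable [set z | f z < g z].
Proof. exact: (measurable_preimage (A := [set true]) (measurable_fun_ltr mf mg)). Qed.

End comparison_sets.

Definition image_measure d d' (T1 : measurableType d) (T2 : measurableType d')
    (R : realFieldType) (m : {measure set T1 -> \bar R}) (f : T1 -> T2)
    (mf : measurable_fun setT f) : {measure set T2 -> \bar R} :=
  measure_function_pushforward__canonical__measure_function_Measure m mf.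

Section uniform_law.
Context {R : realType}.
Implicit Types (m : {measure set R -> \bar R}) (a b c x y : R).

(** The rays form a pi-system that generates the Borel sets, and the rays up to an integer exhaust
    the line. Identities between laws are reduced to distribution functions in this way. *)
Lemma eq_measure_rays m1 m2 :
  (forall x, m1 `]-oo, x[%classic = m2 `]-oo, x[%classic) ->
  (forall x, m1 `]-oo, x[%classic < +oo)%E ->
  forall A, measurable A -> m1 A = m2 A.
Proof.
move=> m12 m1fin A mA.
apply: (@measure_unique _ _ R (@RGenInftyO.G R)
  (fun n => `]-oo, n%:R[%classic)) => //.
- exact: RGenInftyO.measurableE.
- move=> _ _ [x ->] [y ->]; exists (Num.min x y).
  by apply/seteqP; split => z /=; rewrite !in_itv/= lt_min => /andP.
- by move=> n; exists n%:R.
- rewrite -subTset => x _; exists (Num.trunc `|x|).+1 => //=.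
  by rewrite in_itv/= (le_lt_trans (ler_norm x))// truncnS_gt.
- by move=> _ [x ->].
Qed.

Let measurable_idfunR : measurable_fun setT (idfun : measurableTypeR R -> R).
Proof. exact: measurable_id. Qed.

Let lam_measure : {measure set R -> \bar R} :=
  image_measure (uniform_prob (@ltr01 R)) measurable_idfunR.

(** The uniform law on the unit interval, carried along the identity to the measurable structure
    that [R] has by default. The lock keeps simplification from unfolding it to an integral. *)
Definition lam : set R -> \bar R := locked (lam_measure : set R -> \bar R).

Let lamE : lam = lam_measure. Proof. by rewrite /lam -lock. Qed.

Let lam_set0 : lam set0 = 0%E. Proof. by rewrite lamE measure0. Qed.

Let lam_ge0 A : (0 <= lam A)%E. Proof. by rewrite lamE measure_ge0. Qed.

Let lam_sigma_additive : semi_sigma_additive lam.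
Proof. by rewrite lamE; exact: measure_semi_sigma_additive. Qed.

HB.instance Definition _ := isMeasure.Build _ _ _ lam lam_set0 lam_ge0
  lam_sigma_additive.

Let lam_setT : lam setT = 1%E.
Proof. by rewrite lamE; exact: (@probability_setT _ _ _ (uniform_prob (@ltr01 R))). Qed.

HB.instance Definition _ := @Measure_isProbability.Build _ _ R lam lam_setT.

(** The distribution function of the uniform law. *)
Definition clip x := Num.min (Num.max x 0) 1.

Lemma clip_le0 x : x <= 0 -> clip x = 0.
Proof. by move=> x0; rewrite /clip max_r// min_l. Qed.

Lemma clip_ge1 x : 1 <= x -> clip x = 1.
Proof. by move=> x1; rewrite /clip max_l ?(le_trans ler01)// min_r. Qed.

Lemma clip_id x : 0 <= x <= 1 -> clip x = x.
Proof. by move=> /andP[x0 x1]; rewrite /clip max_l// min_l. Qed.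

Lemma clip_itv x : 0 <= clip x <= 1.
Proof. by rewrite /clip le_min ler01 andbT le_max lexx orbT/= ge_min lexx orbT. Qed.

Lemma integral_lam (f : R -> \bar R) :
  measurable_fun setT f -> (forall x, 0 <= f x)%E ->
  (\int[lam]_x f x = \int[lebesgue_measure]_(x in `[0%R, 1%R]) f x)%E.
Proof.
move=> mf f0.
transitivity (\int[pushforward (uniform_prob (@ltr01 R))
    (idfun : measurableTypeR R -> R)]_x f x)%E; first by rewrite lamE.
rewrite ge0_integral_pushforward//= integral_uniform//.
by rewrite subr0 invr1 mul1e.
Qed.

Lemma lam_ray x : lam `]-oo, x[%classic = (clip x)%:E.
Proof.
rewrite lamE /= /pushforward preimage_id /uniform_prob integral_uniform_pdf.
rewrite (eq_integral (fun=> 1%:E)); last first.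
  move=> u; rewrite inE => -[_ /=]; rewrite in_itv/= /uniform_pdf => ->.
  by rewrite subr0 invr1.
rewrite integral_cst/=; last exact: measurableI.
rewrite mul1e; have [x0|x0] := leP x 0.
  rewrite clip_le0// (_ : _ `&` _ = set0) ?measure0// -subset0 => u [/=].
  by rewrite !in_itv/= => ux /andP[u0 _]; move: (lt_le_trans ux x0); rewrite ltNge u0.
have [x1|x1] := leP x 1.
  rewrite clip_id ?(ltW x0)// (_ : _ `&` _ = `[0, x[%classic).
    by rewrite lebesgue_measure_itv/= lte_fin x0 sube0.
  apply/seteqP; split => u /=; rewrite !in_itv/=; first by move=> [-> /andP[->]].
  by move=> /andP[-> ux]; split => //; rewrite (ltW (lt_le_trans ux x1)).
rewrite clip_ge1 ?(ltW x1)// (_ : _ `&` _ = `[0, 1]%classic).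
  by rewrite lebesgue_measure_itv/= lte_fin ltr01 sube0.
apply/seteqP; split => u /=; rewrite !in_itv/=; first by move=> [].
by move=> /andP[-> u1]; rewrite u1; split => //; exact: le_lt_trans u1 x1.
Qed.

End uniform_law.

(** * Binary digits *)

Section binary_splitting.
Context {R : realType}.
Implicit Types (u a b x y : R) (n : nat).

Definition first_bit u : R := if 2^-1 <= u then 1 else 0.
Definition doubling u : R := 2 * u - first_bit u.

(** A truncated binary expansion that keeps the digits of [u] at positions 0, 2, 4, and so on: the
    double [doubling] skips the digit in between. *)
Fixpoint digits n u : R :=
  if n is n'.+1 then (first_bit u + digits n' (doubling (doubling u))) / 2 else 0.

Lemma first_bit_itv u : 0 <= first_bit u <= 1.
Proof. by rewrite /first_bit; case: ifP => _; rewrite ?lexx ler01. Qed.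

Lemma digits_itv n u : 0 <= digits n u <= 1.
Proof.
elim: n u => [|n IH] u /=; first by rewrite lexx ler01.
have /andP[b0 b1] := first_bit_itv u; have /andP[d0 d1] := IH (doubling (doubling u)).
by apply/andP; split; lra.
Qed.

Lemma digits_nd u : nondecreasing_seq (digits ^~ u).
Proof.
apply/nondecreasing_seqP => n; elim: n u => [|n IH] u.
  by have /andP[] := digits_itv 1 u.
rewrite [digits n.+2 u]/= [digits n.+1 u]/=.
by rewrite ler_pM2r ?invr_gt0// lerD2l; exact: IH.
Qed.

Lemma digits_cvg u : cvgn (digits ^~ u).
Proof.
apply: nondecreasing_is_cvgn; first exact: digits_nd.
by exists 1 => _ [n _ <-]; have /andP[] := digits_itv n u.
Qed.

Definition even_digits u : R := limn (digits ^~ u).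
Definition odd_digits u : R := even_digits (doubling u).

(** One doubling exchanges the two digit sequences, since [odd_digits (doubling u)] is [even_digits]
    after two doublings. This self-similarity determines the joint law of the two sequences. *)
Lemma even_digitsE u : even_digits u = (first_bit u + odd_digits (doubling u)) / 2.
Proof.
apply: (cvg_lim (@Rhausdorff R)).
rewrite -(cvg_shiftS (digits ^~ u)) /=.
apply: cvgMl; apply: cvgD; first exact: cvg_cst.
exact: digits_cvg.
Qed.

Lemma even_digits_itv u : 0 <= even_digits u <= 1.
Proof.
apply/andP; split.
  apply: limr_ge; first exact: digits_cvg.
  by apply: nearW => n; have /andP[] := digits_itv n u.
apply: limr_le; first exact: digits_cvg.
by apply: nearW => n; have /andP[] := digits_itv n u.
Qed.

Lemma measurable_first_bit : measurable_fun setT (first_bit : R -> R).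
Proof.
apply: measurable_fun_ifT => //.
by apply: measurable_fun_ler.
Qed.

Lemma measurable_doubling : measurable_fun setT (doubling : R -> R).
Proof.
apply: measurable_funB; last exact: measurable_first_bit.
by apply: measurable_funM.
Qed.

Lemma measurable_digits n : measurable_fun setT (digits n : R -> R).
Proof.
elim: n => [|n IH] /=; first exact: measurable_cst.
apply: measurable_funM; last exact: measurable_cst.
apply: measurable_funD; first exact: measurable_first_bit.
apply: measurableT_comp IH _; apply: measurableT_comp; exact: measurable_doubling.
Qed.

Lemma measurable_even_digits : measurable_fun setT (even_digits : R -> R).
Proof.
apply: (@measurable_fun_cvg _ R _ setT (digits : nat -> R -> R)).
  exact: measurable_digits.
by move=> x _; exact: digits_cvg.
Qed.

Lemma measurable_odd_digits : measurable_fun setT (odd_digits : R -> R).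
Proof. exact: measurableT_comp measurable_even_digits measurable_doubling. Qed.

(* The binary digits of a uniform number: the first one is a fair coin, independent of the others. *)
Lemma lam_doubling (A : set R) : measurable A ->
  (lam (doubling @^-1` A `&` `]-oo, 2^-1%R[) = (2^-1)%:E * lam A)%E /\
  (lam (doubling @^-1` A `&` `[2^-1%R, +oo[) = (2^-1)%:E * lam A)%E.
Proof.
have m1 : measurable (`]-oo, 2^-1[%classic : set R) by exact: measurable_itv.
have m2 : measurable (`[2^-1, +oo[%classic : set R) by exact: measurable_itv.
have h0 : 0 <= 2^-1 :> R by rewrite invr_ge0.
(* On each side of [2^-1] the map [doubling] is affine, so there the preimage of a ray is a ray cut
   at [2^-1]. *)
have e1 x : doubling @^-1` `]-oo, x[ `&` `]-oo, 2^-1[ =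
    `]-oo, (Num.min (x / 2) 2^-1)[%classic :> set R.
  apply/seteqP; split => u /=; rewrite !in_itv/= lt_min /doubling /first_bit.
    move=> [+ u2]; rewrite u2 leNgt u2/= subr0 => ?.
    by rewrite andbT ltr_pdivlMr// mulrC.
  move=> /andP[+ u2]; rewrite leNgt u2/= subr0 ltr_pdivlMr// mulrC => ?.
  by split.
have e2 x : doubling @^-1` `]-oo, x[ `&` `[2^-1, +oo[ =
    `]-oo, (Num.max ((x + 1) / 2) 2^-1)[ `\` `]-oo, 2^-1[ :> set R.
  apply/seteqP; split => u /=; rewrite !in_itv/= lt_max /doubling /first_bit andbT.
    move=> [+ u2]; rewrite u2 => ux; split; last by apply/negP; rewrite -leNgt.
    by apply/orP; left; rewrite ltr_pdivlMr//; lra.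
  move=> [+ /negP]; rewrite -leNgt => + u2; rewrite u2.
  case/orP; last by rewrite ltNge u2.
  by rewrite ltr_pdivlMr// => ux; split => //; lra.
have l1 x : lam (doubling @^-1` `]-oo, x[ `&` `]-oo, 2^-1%R[) = ((2^-1)%:E * lam `]-oo, x[%classic)%E.
  rewrite e1 !lam_ray -EFinM; congr EFin.
  have [x0|x0] := leP x 0; first by rewrite min_l; [rewrite 2?clip_le0; lra|lra].
  have [x1|x1] := leP x 1; first by rewrite min_l; [rewrite 2?clip_id; lra|lra].
  rewrite min_r; last lra.
  by rewrite clip_id ?clip_ge1; lra.
have l2 x : lam (doubling @^-1` `]-oo, x[ `&` `[2^-1%R, +oo[) = ((2^-1)%:E * lam `]-oo, x[%classic)%E.
  rewrite e2 measureD//=; last by rewrite lam_ray ltry.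
  rewrite setIidr; last first.
    by move=> u /=; rewrite !in_itv/= lt_max orbC => ->.
  rewrite !lam_ray -EFinM -EFinB; congr EFin.
  have c2 : clip 2^-1 = 2^-1 :> R by rewrite clip_id//; lra.
  have [x0|x0] := leP x 0; first by rewrite max_r ?(clip_le0 x0) ?c2; lra.
  have [x1|x1] := leP x 1; first by rewrite max_l ?c2; [rewrite 2?clip_id; lra|lra].
  rewrite max_l ?c2; last lra.
  by rewrite 2?clip_ge1; lra.
have fin x : (lam `]-oo, x[%classic < +oo)%E by rewrite lam_ray ltry.
have half_ge0 : (0 <= 2^-1 :> R) by [].
pose hm : {measure set R -> \bar R} := mscale (NngNum half_ge0) lam.
split.
- apply: (@eq_measure_rays _ (image_measure (mrestr lam m1) measurable_doubling) hm) => //= x.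
  by rewrite /pushforward/= /mrestr l1 lam_ray -EFinM ltry.
- apply: (@eq_measure_rays _ (image_measure (mrestr lam m2) measurable_doubling) hm) => //= x.
  by rewrite /pushforward/= /mrestr l2 lam_ray -EFinM ltry.
Qed.

End binary_splitting.

(** Iterating the second hypothesis [n] times bounds [f] by [2^-1 ^+ n]. Applied to a difference of
    two bounded solutions, it is the uniqueness principle for the recursions satisfied by
    distribution functions of digits. *)
Lemma contraction_eq0 (R : realType) (T : Type) (f : T -> R) :
  (forall x, `|f x| <= 1) -> (forall x, exists y, `|f x| <= `|f y| / 2) ->
  forall x, f x = 0.
Proof.
move=> f1 fc x.
have H n : forall x, `|f x| <= 2^-1 ^+ n.
  elim: n => [|n IH] z; first by rewrite expr0.
  have [y /le_trans] := fc z; apply; rewrite exprSr ler_pM2r ?invr_gt0//.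
apply/normr0_eq0/le_anti; rewrite normr_ge0 andbT.
have := @cvg_expr R 2^-1; rewrite ger0_norm// invf_lt1// ltr1n => /(_ isT) c.
have <- := cvg_lim (@Rhausdorff R) c.
apply: limr_ge; first by apply/cvg_ex; exists 0.
by apply: nearW => n; exact: H.
Qed.

Section binary_splitting_independence.
Context {R : realType}.
Implicit Types (u a b x y : R) (A B : set R).

Let mpre1 A : measurable A -> measurable (@even_digits R @^-1` A).
Proof. by move=> mA; apply: measurable_preimage => //; exact: measurable_even_digits. Qed.

Let mpre2 A : measurable A -> measurable (@odd_digits R @^-1` A).
Proof. by move=> mA; apply: measurable_preimage => //; exact: measurable_odd_digits. Qed.

Let ray a : set R := `]-oo, a[%classic.

Let mray a : measurable (ray a). Proof. exact: measurable_itv. Qed.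

Let F a b := fine (lam (@even_digits R @^-1` ray a `&` @odd_digits R @^-1` ray b)).

Let FE a b : lam (@even_digits R @^-1` ray a `&` @odd_digits R @^-1` ray b) = (F a b)%:E.
Proof.
by rewrite fineK// fin_num_measure//; apply: measurableI; [exact: mpre1|exact: mpre2].
Qed.

Let mB a b : measurable (@even_digits R @^-1` ray a `&` @odd_digits R @^-1` ray b).
Proof. by apply: measurableI; [exact: mpre1|exact: mpre2]. Qed.

(** [F] is the joint distribution function of the even and the odd digits. The recursion conditions
    on the first digit; the remaining digits swap their roles, hence the exchanged arguments. *)
Let F_rec a b : F a b = (F b (2 * a) + F b (2 * a - 1)) / 2.
Proof.
apply: EFin_inj; rewrite -FE.
have [[_ e0] [e1 _]] := (lam_doubling (mB b (2 * a - 1)), lam_doubling (mB b (2 * a))).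
have -> : even_digits @^-1` ray a `&` odd_digits @^-1` ray b =
  (doubling @^-1` (even_digits @^-1` ray b `&` odd_digits @^-1` ray (2 * a)) `&` ray (2^-1)) `|`
  (doubling @^-1` (even_digits @^-1` ray b `&` odd_digits @^-1` ray (2 * a - 1)) `&` `[2^-1, +oo[%classic).
  apply/seteqP; split => u; rewrite /ray/= !in_itv/= ?andbT.
    move=> [+ ub]; rewrite even_digitsE ltr_pdivrMr// /first_bit.
    by case: ifPn => [h H|]; [right|rewrite -ltNge => h H; left];
      split => //; split => //; lra.
  case=> -[[ub ua] h]; split => //; rewrite even_digitsE /first_bit ltr_pdivrMr//.
    by rewrite leNgt h/= add0r mulrC.
  by rewrite h; lra.
rewrite measureU//; last 3 first.
- by apply: measurableI => //; apply: measurable_preimage => //; exact: measurable_doubling.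
- apply: measurableI => //; apply: measurable_preimage => //; exact: measurable_doubling.
- apply/seteqP; split => u //= -[[_ +] [_]]; rewrite /ray/= !in_itv/= andbT.
  by rewrite ltNge => /negbTE ->.
rewrite [LHS]/= e0 e1 !FE -!EFinM -EFinD; congr (_%:E); lra.
Qed.

Let F_itv a b : 0 <= F a b <= 1.
Proof.
apply/andP; split; first exact: fine_ge0.
by rewrite -lee_fin -FE; exact: probability_le1.
Qed.

Let F_le0l a b : a <= 0 -> F a b = 0.
Proof.
move=> a0; rewrite /F (_ : _ `&` _ = set0) ?measure0// -subset0 => u [].
rewrite /ray/= in_itv/= => + _; have /andP[+ _] := even_digits_itv u.
by move=> h1 /lt_le_trans/(_ a0); rewrite ltNge h1.
Qed.

Let F_le0r a b : b <= 0 -> F a b = 0.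
Proof.
move=> b0; rewrite /F (_ : _ `&` _ = set0) ?measure0// -subset0 => u [_].
rewrite /ray/= in_itv/=; have /andP[+ _] := even_digits_itv (doubling u).
by rewrite -/(odd_digits u) => h1 /lt_le_trans/(_ b0); rewrite ltNge h1.
Qed.

Let F_gt1l a a' b : 1 < a -> 1 < a' -> F a b = F a' b.
Proof.
move=> a1 a1'; rewrite /F; congr (fine (lam (_ `&` _))).
by apply/seteqP; split => u _; rewrite /ray/= in_itv/=;
  have /andP[_ /le_lt_trans] := even_digits_itv u; apply.
Qed.

Let F_gt1r a b b' : 1 < b -> 1 < b' -> F a b = F a b'.
Proof.
move=> b1 b1'; rewrite /F; congr (fine (lam (_ `&` _))).
by apply/seteqP; split => u _; rewrite /ray/= in_itv/=;
  have /andP[_ /le_lt_trans] := even_digits_itv (doubling u); apply.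
Qed.

Let F_gt1 a b : 1 < a -> 1 < b -> F a b = 1.
Proof.
move=> a1 b1; rewrite /F (_ : _ `&` _ = setT) ?probability_setT// -subTset => u _.
by split; rewrite /ray/= in_itv/=; [have /andP[_ /le_lt_trans] := even_digits_itv u|
  have /andP[_ /le_lt_trans] := even_digits_itv (doubling u)]; apply.
Qed.

Let clip_rec a : clip a = (clip (2 * a) + clip (2 * a - 1)) / 2.
Proof.
have [a0|a0] := leP a 0; first by rewrite 3?clip_le0; lra.
have [a1|a1] := ltP 1 a; first by rewrite 3?clip_ge1; lra.
have [a2|a2] := leP (2 * a) 1.
  by rewrite [clip (2 * a - 1)]clip_le0 2?clip_id; lra.
by rewrite [clip (2 * a)]clip_ge1 2?clip_id; lra.
Qed.

(** Any argument above 1 lifts a constraint, and 2 stands for all of them: the even and the odd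
    digits have the same law. *)
Let F2 a : F 2 a = F a 2.
Proof.
rewrite F_rec (_ : F a (2 * 2) = F a 2); last by apply: F_gt1r => //; lra.
rewrite (_ : F a (2 * 2 - 1) = F a 2); last by apply: F_gt1r => //; lra.
lra.
Qed.

(* [clip] is the only bounded solution of the fixed point equation of the marginals. *)
Let F_marginal a : F a 2 = clip a.
Proof.
have two1 : 1 < 2 :> R by rewrite ltr1n.
apply/eqP; rewrite -subr_eq0; apply/eqP; move: a.
apply: contraction_eq0 => x.
  by rewrite ler_norml; have := clip_itv x; have := F_itv x 2; lra.
(* Outside []0, 1]] both functions agree, so the point itself is a witness. Inside, the recursion
   leads to [2 * x] or to [2 * x - 1], according to the first digit of [x]. *)
have [x0|x0] := leP x 0.
  by exists x; rewrite F_le0l// clip_le0// subrr normr0 mul0r.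
have [x1|x1] := ltP 1 x.
  by exists x; rewrite F_gt1// clip_ge1 ?(ltW x1)// subrr normr0 mul0r.
have [x2|x2] := leP x 2^-1.
  exists (2 * x); rewrite F_rec clip_rec !F2.
  rewrite [F (2 * x - 1) _]F_le0l; last lra.
  rewrite [clip (2 * x - 1)]clip_le0; last lra.
  by rewrite !addr0 -mulrBl normrM [`|2^-1|]ger0_norm.
exists (2 * x - 1); rewrite F_rec clip_rec !F2.
rewrite [F (2 * x) _]F_gt1//; last lra.
rewrite [clip (2 * x)]clip_ge1; last lra.
by rewrite -mulrBl opprD addrACA subrr add0r normrM [`|2^-1|]ger0_norm.
Qed.

(** The product of the marginals solves the same recursion as [F]. When the point [(a, b)] is
    replaced by [(b, 2 * a)] or by [(b, 2 * a - 1)], the difference of the two solutions doubles, so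
    that it must vanish. *)
Let F_clip a b : F a b = clip a * clip b.
Proof.
apply/eqP; rewrite -subr_eq0; apply/eqP.
pose d (p : R * R) := F p.1 p.2 - clip p.1 * clip p.2.
suff : forall p, d p = 0 by move=> /(_ (a, b)).
apply: contraction_eq0 => -[{a b}a b]; rewrite /d/=.
  have /andP[a0 a1] := clip_itv a; have /andP[b0 b1] := clip_itv b.
  have : 0 <= clip a * clip b <= 1 by rewrite mulr_ge0// mulr_ile1.
  by have := F_itv a b; rewrite ler_norml; lra.
have eq0 x y : F x y = clip x * clip y -> exists p, `|F x y - clip x * clip y|
    <= `|F p.1 p.2 - clip p.1 * clip p.2| / 2.
  by move=> e; exists (x, y); rewrite /= e subrr normr0 mul0r.
have [a0|a0] := leP a 0; first by apply: eq0; rewrite F_le0l// (clip_le0 a0) mul0r.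
have [b0|b0] := leP b 0; first by apply: eq0; rewrite F_le0r// (clip_le0 b0) mulr0.
have F1 x : 1 < x -> forall y, F x y = clip y.
  by move=> x1 y; rewrite (@F_gt1l x 2)// ?ltr1n// F2 F_marginal.
have F1r x : 1 < x -> forall y, F y x = clip y.
  by move=> x1 y; rewrite (@F_gt1r y x 2)// ?ltr1n// F_marginal.
have [a1|a1] := ltP 1 a.
  by apply: eq0; rewrite F1// (clip_ge1 (ltW a1)) mul1r.
have [b1|b1] := ltP 1 b.
  by apply: eq0; rewrite F1r// (clip_ge1 (ltW b1)) mulr1.
have [a2|a2] := leP a 2^-1.
  exists (b, 2 * a); rewrite /= F_rec [clip a]clip_rec.
  rewrite [F b (2 * a - 1)]F_le0r; last lra.
  rewrite [clip (2 * a - 1)]clip_le0; last lra.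
  rewrite !addr0 [_ / 2 * _]mulrAC -mulrBl normrM [`|2^-1|]ger0_norm//.
  by rewrite [clip b * _]mulrC.
exists (b, 2 * a - 1); rewrite /= F_rec [clip a]clip_rec.
rewrite [F b (2 * a)]F1r; last lra.
rewrite [clip (2 * a)]clip_ge1; last lra.
rewrite [_ / 2 * _]mulrAC -mulrBl normrM [`|2^-1|]ger0_norm//.
rewrite (_ : clip b + _ - _ = F b (2 * a - 1) - clip b * clip (2 * a - 1))//.
by rewrite mulrDl mul1r; ring.
Qed.

(** Rays are replaced by Borel sets in one coordinate at a time, the other constraint being absorbed
    into a restricted measure. *)
Lemma even_odd_digits_indep A B : measurable A -> measurable B ->
  lam (@even_digits R @^-1` A `&` @odd_digits R @^-1` B) = (lam A * lam B)%E.
Proof.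
move=> mA mB'.
have cl x : 0 <= clip x :> R by have /andP[] := clip_itv x.
have H b : lam (@even_digits R @^-1` A `&` @odd_digits R @^-1` ray b) = (lam A * (clip b)%:E)%E.
  have m2 : measurable (@odd_digits R @^-1` ray b) by exact: mpre2.
  rewrite muleC.
  apply: (@eq_measure_rays _ (image_measure (mrestr lam m2) (@measurable_even_digits R))
    (mscale (NngNum (cl b)) lam)) => //= x.
    transitivity (F x b)%:E; first exact: FE.
    by rewrite /mscale/= lam_ray F_clip -EFinM mulrC.
  rewrite (_ : pushforward _ _ _ = (F x b)%:E) ?ltry//; exact: FE.
have m1 : measurable (@even_digits R @^-1` A) by exact: mpre1.
have fA : lam A \is a fin_num by rewrite fin_num_measure.
rewrite setIC -[X in (X * _)%E](fineK fA).
apply: (@eq_measure_rays _ (image_measure (mrestr lam m1) (@measurable_odd_digits R))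
    (mscale (NngNum (fine_ge0 (measure_ge0 lam A))) lam)) => //= x.
- by rewrite /mscale/= fineK// lam_ray -H setIC.
- rewrite /pushforward/= /mrestr setIC H -(fineK fA) -EFinM; exact: ltry.
Qed.

Local Open Scope ereal_scope.

(** By independence the pair of digit sequences has the product law, so that Tonelli applies: one
    uniform number can be spent as two. *)
Lemma integral_digits (f : R * R -> \bar R) :
  measurable_fun setT f -> (forall z, 0 <= f z) ->
  \int[lam]_u f (even_digits u, odd_digits u) = \int[lam]_x \int[lam]_y f (x, y).
Proof.
move=> mf f0.
have mD : measurable_fun setT (fun u : R => (even_digits u, odd_digits u)).
  by apply: measurable_fun_pair; [exact: measurable_even_digits|exact: measurable_odd_digits].
rewrite -[RHS]/(\int[lam]_x fubini_F lam f x) -fubini_tonelli1//.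
transitivity (\int[pushforward lam (fun u : R => (even_digits u, odd_digits u))]_z f z).
  by rewrite ge0_integral_pushforward.
apply: (@eq_measure_integral _ _ _ _ (lam \x lam)%E (image_measure lam mD)) => A mA _.
apply/esym; apply: (@product_measure_unique _ _ _ _ _ lam lam (image_measure lam mD)) => //= A1 B1 mA1 mB1.
exact: even_odd_digits_indep.
Qed.

End binary_splitting_independence.

(** * Exponential times *)

Section exponential_time.
Context {R : realType}.
Implicit Types (u a b c t x : R).

(** Inverse transform sampling of the exponential law of rate 1. The value 1 outside []0, 1[], a
    null set, keeps the time positive for every [u]. *)
Definition exp_time u : R := if 0 < u < 1 then - ln u else 1.

Lemma exp_time_gt0 u : 0 < exp_time u.
Proof.
rewrite /exp_time; case: ifPn => [/andP[u0 u1]|_]; last exact: ltr01.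
by rewrite oppr_gt0 ln_lt0// u0 u1.
Qed.

Lemma measurable_exp_time : measurable_fun setT exp_time.
Proof.
apply: measurable_fun_ifT => //.
  by apply: measurable_and; exact: measurable_fun_ltr.
by apply: measurableT_comp => //; exact: measurable_ln.
Qed.

Lemma lam_oo a b : 0 <= a -> a <= b -> b <= 1 -> lam `]a, b[%classic = (b - a)%:E.
Proof.
move=> a0 ab b1.
have l x : lam `]-oo, x]%classic = (clip x)%:E.
  apply/le_anti/andP; split.
    apply/lee_addgt0Pr => e e0.
    apply: (@le_trans _ _ (lam `]-oo, (x + e)[%classic)).
      apply: le_measure; rewrite ?inE; try exact: measurable_itv.
      by move=> u /=; rewrite !in_itv/= => ux; lra.
    rewrite lam_ray -EFinD lee_fin /clip /Num.min /Num.max.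
    do ?case: ifP => //; lra.
  rewrite -lam_ray; apply: le_measure; rewrite ?inE; try exact: measurable_itv.
  by move=> u /=; rewrite !in_itv/= => /ltW.
have -> : `]a, b[%classic = `]-oo, b[%classic `\` `]-oo, a]%classic.
  by apply/seteqP; split => u /=; rewrite !in_itv/=;
    [move=> /andP[au ->]; split => //; apply/negP; rewrite -ltNge|
     move=> [-> /negP]; rewrite -ltNge => ->].
have [{}ab|ba] := ltP a b; last first.
  have e : a = b by apply/le_anti; rewrite ab.
  rewrite e subrr (_ : _ `\` _ = set0) ?measure0// -subset0 => u [] /=.
  by rewrite !in_itv/= => /ltW.
rewrite measureD//=; last by rewrite lam_ray ltry.
rewrite setIidr; last by move=> u /=; rewrite !in_itv/= => /le_lt_trans; apply.
by rewrite lam_ray l -EFinB !clip_id//; lra.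
Qed.

Lemma lam_eq01 (A B : set R) : measurable A -> measurable B ->
  (forall u, 0 < u < 1 -> A u <-> B u) -> lam A = lam B.
Proof.
move=> mA mB AB.
pose I : set R := `]0, 1[%classic.
have mo : measurable I by exact: measurable_itv.
have oC : lam (~` I) = 0%E.
  by have := probability_setC lam mo; rewrite /= /I lam_oo ?subr0// subee.
have H C : measurable C -> lam C = lam (C `&` I).
  move=> mC; apply/le_anti/andP; split; last first.
    by apply: le_measure; rewrite ?inE//; exact: measurableI.
  rewrite -{1}[C](setUIDK _ I).
  apply: (le_trans (measureU2 _ _ _)); [exact: measurableI|exact: measurableD|].
  rewrite [X in (_ + X)%E](_ : _ = 0%E) ?adde0//.
  apply: (@subset_measure0 _ _ _ lam _ (~` I)) => //.
  - exact: measurableD.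
  - exact: measurableC.
rewrite (H A)// (H B)//; congr (lam _); apply/seteqP.
by split => u [Cu h]; split => //; move: (h) Cu; rewrite /I/= in_itv/= => /AB; tauto.
Qed.

Lemma lam_exp_time_oo t x : 0 <= t ->
  lam [set u | t < exp_time u /\ exp_time u < t + x] =
  (expR (- t) * (1 - expR (- Num.max x 0)))%:E.
Proof.
move=> t0.
have m1 : measurable [set u | t < exp_time u /\ exp_time u < t + x].
  rewrite (_ : mkset _ = exp_time @^-1` `]t, (t + x)[%classic).
    by apply: measurable_preimage => //; exact: measurable_exp_time.
  by apply/seteqP; split => u /=; rewrite in_itv/= => /andP.
have [x0|x0] := leP x 0.
  rewrite oppr0 expR0 subrr mulr0 (_ : mkset _ = set0) ?measure0//.
  rewrite -subset0 => u /= [tu ux]; lra.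
transitivity (lam `]expR (- (t + x)), expR (- t)[%classic).
  apply: lam_eq01 => // u /andP[u0 u1] /=; rewrite /exp_time u0 u1 in_itv/=.
  have uE : u = expR (ln u) by rewrite lnK.
  rewrite [in X in _ <-> X]uE !ltr_expR.
  by split => [[h1 h2]|/andP[h1 h2]]; [apply/andP|]; split; lra.
rewrite lam_oo ?expR_ge0//.
- by rewrite opprD expRD; congr EFin; ring.
- by rewrite ler_expR; lra.
- by rewrite -expR0 ler_expR; lra.
Qed.

Lemma lam_exp_time_gt t : 0 <= t -> lam [set u | t < exp_time u] = (expR (- t))%:E.
Proof.
move=> t0.
have m1 : measurable [set u | t < exp_time u].
  by apply: measurable_lt_set => //; exact: measurable_exp_time.
transitivity (lam `]0, expR (- t)[%classic).
  apply: lam_eq01 => // u /andP[u0 u1] /=; rewrite /exp_time u0 u1 in_itv/=.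
  have uE : u = expR (ln u) by rewrite lnK.
  rewrite u0/= [in X in _ <-> X]uE ltr_expR.
  by split => h; lra.
by rewrite lam_oo ?subr0 ?expR_ge0// -expR0 ler_expR; lra.
Qed.

Lemma lam_exp_time_le t : 0 <= t -> lam [set u | exp_time u <= t] = (1 - expR (- t))%:E.
Proof.
move=> t0.
have -> : [set u | exp_time u <= t] = ~` [set u | t < exp_time u].
  by apply/seteqP; split => u /=; rewrite leNgt => /negP.
rewrite probability_setC//= ?lam_exp_time_gt//.
by apply: measurable_lt_set => //; exact: measurable_exp_time.
Qed.

Local Open Scope ereal_scope.

(* Lack of memory. *)
Lemma integral_exp_time_shift (t : R) (g : R -> \bar R) : (0 <= t)%R ->
  measurable_fun setT g -> (forall x, 0 <= g x) ->
  \int[lam]_(u in [set u | (t < exp_time u)%R]) g (exp_time u - t)%R =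
  (expR (- t))%:E * \int[lam]_u g (exp_time u).
Proof.
move=> t0 mg g0.
have mD : measurable [set u | (t < exp_time u)%R].
  by apply: measurable_lt_set => //; exact: measurable_exp_time.
have mf : measurable_fun setT (fun u : R => exp_time u - t)%R.
  by apply: measurable_funB => //; exact: measurable_exp_time.
have e0 : (0 <= expR (- t))%R := expR_ge0 (- t).
pose m2 := mscale (NngNum e0) (image_measure lam measurable_exp_time).
(* Both sides are measures in [A]; on rays the left one is an increment of the exponential
   distribution function from [t] on, the right one from 0 on. *)
have mE A : measurable A ->
    lam ((fun u : R => exp_time u - t)%R @^-1` A `&` [set u | (t < exp_time u)%R]) = m2 A.
  move=> mA.
  have l1 x : lam ((fun u : R => exp_time u - t)%R @^-1` `]-oo, x[%classic `&`
      [set u | (t < exp_time u)%R]) = (expR (- t) * (1 - expR (- Num.max x 0)))%:E.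
    rewrite -lam_exp_time_oo//; congr (lam _).
    by apply/seteqP; split => u /=; rewrite in_itv/= => -[h1 h2]; split => //; lra.
  have l2 x : lam (exp_time @^-1` `]-oo, x[%classic) = (1 - expR (- Num.max x 0))%:E.
    have := lam_exp_time_oo x (lexx 0%R); rewrite oppr0 expR0 mul1r => <-.
    congr (lam _); apply/seteqP; split => u /=; rewrite in_itv/= add0r.
      by move=> h; split => //; exact: exp_time_gt0.
    by case.
  apply: (@eq_measure_rays _ (image_measure (mrestr lam mD) mf) m2) => //= x.
    by rewrite /pushforward /mrestr l1 /m2 /mscale/= /pushforward l2 EFinM.
  by rewrite /pushforward /mrestr l1 ltry.
have D0 : [set u | (t < exp_time u)%R] = (fun u : R => exp_time u - t)%R @^-1` `]0%R, +oo[%classic.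
  by apply/seteqP; split => u /=; rewrite in_itv/= andbT subr_gt0.
transitivity (\int[pushforward lam (fun u : R => exp_time u - t)%R]_(x in `]0%R, +oo[%classic) g x).
  rewrite ge0_integral_pushforward// -?D0//; last exact: measurable_funS mg.
transitivity (\int[m2]_(x in `]0%R, +oo[%classic) g x).
  apply: (@eq_measure_integral _ _ _ _ m2 (image_measure lam mf)) => A mA AD.
  rewrite -[RHS](mE A mA)/= /pushforward; congr (lam _); rewrite setIidl// D0.
  by apply: preimage_subset.
rewrite ge0_integral_mscale//; last exact: measurable_funS mg.
congr (_ * _).
transitivity (\int[pushforward lam exp_time]_(x in `]0%R, +oo[%classic) g x) => //.
rewrite ge0_integral_pushforward//; [|exact: measurable_exp_time|exact: measurable_funS mg].
congr (integral _ _ _); rewrite -subTset => u _ /=.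
by rewrite in_itv/= andbT exp_time_gt0.
Qed.

(** On []0, 1[] the integrand is the power [u ^ a], with primitive [u ^ (1 + a) / (1 + a)]. For
    negative [a] it is unbounded at 0, so the integral is computed away from 0 and extended by
    monotone convergence. *)
Lemma integral_exp_time_laplace (a : R) : (-1 < a)%R ->
  \int[lam]_u (expR (- (a * exp_time u)))%:E <= ((1 + a)^-1)%:E.
Proof.
move=> a1.
have a0 : (0 < 1 + a)%R by lra.
have mh : measurable_fun setT (fun u : R => (expR (- (a * exp_time u)))%:E).
  apply/measurable_EFinP; apply: measurableT_comp => //.
  apply: measurableT_comp => //; apply: measurable_funM => //.
  exact: measurable_exp_time.
rewrite integral_lam//.
pose F (n : nat) : set R := `[(n.+2%:R^-1)%R, 1%R]%classic.
have UF : \bigcup_n F n = `]0%R, 1%R]%classic.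
  apply/seteqP; split => [u [n _]|u]; rewrite /F /= !in_itv/=.
    by move=> /andP[nu ->]; rewrite andbT (lt_le_trans _ nu)// invr_gt0.
  move=> /andP[u0 u1]; exists (Num.trunc u^-1) => //=; rewrite in_itv/= u1 andbT.
  rewrite -[leRHS]invrK lef_pV2 ?posrE ?invr_gt0//.
  by rewrite (le_trans (ltW (truncnS_gt _)))// ler_nat.
rewrite -integral_itv_obnd_cbnd; last exact: measurable_funS mh.
rewrite -UF.
have c : (\int[lebesgue_measure]_(x in F n) (expR (- (a * exp_time x)))%:E @[n --> \oo]
  --> \int[lebesgue_measure]_(x in \bigcup_n F n) (expR (- (a * exp_time x)))%:E).
  apply: ge0_nondecreasing_set_cvg_integral.
  - move=> n m nm; apply/subsetPset => u; rewrite /F /= !in_itv/= => /andP[nu ->].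
    by rewrite andbT (le_trans _ nu)// lef_pV2 ?posrE// ler_nat.
  - by move=> n; exact: measurable_itv.
  - by move=> n; exact: measurable_funS mh.
  - by [].
rewrite -(cvg_lim _ c)//; apply: lime_le; first by apply/cvg_ex; eexists; exact: c.
apply: nearW => n.
have n1 : (n.+2%:R^-1 < 1 :> R)%R by rewrite invf_lt1// ltr1n.
have n0 : (0 < n.+2%:R^-1 :> R)%R by rewrite invr_gt0.
pose f x : R := expR (a * ln x).
pose G x : R := (expR ((1 + a) * ln x) / (1 + a))%R.
rewrite (_ : integral _ _ _ = \int[lebesgue_measure]_(x in F n) (f x)%:E); last first.
  rewrite /F -!integral_itv_bndo_bndc.
  - apply: eq_integral => u; rewrite inE/= in_itv/= => /andP[nu u1].
    by rewrite /f /exp_time (lt_le_trans n0 nu) u1/= mulrN opprK.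
  - apply: measurable_funTS; apply/measurable_EFinP; apply: measurableT_comp => //.
    by apply: measurable_funM => //; exact: measurable_ln.
  - exact: measurable_funS mh.
have dG x : (0 < x)%R -> is_derive x 1%R G (f x).
  move=> x0.
  have dl := is_derive1_ln x0.
  apply: is_derive_eq; rewrite /f.
  rewrite scaler0 add0r mulrDl mul1r expRD lnK ?posrE// /GRing.scale/=.
  by field; rewrite !gt_eqF.
have cf x : (0 < x)%R -> {for x, continuous f}.
  move=> x0; have dl := is_derive1_ln x0.
  by apply/differentiable_continuous/derivable1_diffP; exact: ex_derive.
have cG x : (0 < x)%R -> {for x, continuous G}.
  move=> x0; apply/differentiable_continuous/derivable1_diffP.
  by have /@ex_derive := dG _ x0.
rewrite (@continuous_FTC2 _ f G)//.
(* The boundary term at the lower end is nonnegative and is dropped, whence an inequality instead of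
   an equality. *)
- rewrite -EFinB lee_fin /G ln1 mulr0 expR0 mul1r.
  by rewrite gerBl// divr_ge0 ?expR_ge0// ltW.
- apply: continuous_in_subspaceT => x; rewrite inE/= in_itv/= => /andP[nx _].
  by apply: cf; exact: lt_le_trans nx.
- split.
  + move=> x; rewrite in_itv/= => /andP[nx _].
    by have /@ex_derive := dG _ (lt_trans n0 nx).
  + by apply: cvg_at_right_filter; exact: cG.
  + by apply: cvg_at_left_filter; exact: cG.
- move=> x; rewrite in_itv/= => /andP[x0 _].
  by rewrite derive1E; have /@derive_val := dG _ (lt_trans n0 x0).
Qed.

End exponential_time.

(** * Rearrangements of the unit interval *)

Section rearrangement.
Context {R : realType}.
Implicit Types (u v a b t x : R) (A B C : set R).

(** Upper rays suit quantiles: the quantile preimage of []x, +oo[] is an interval []F x, p]]. *)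
Lemma eq_measure_upper_rays (m1 m2 : {measure set R -> \bar R}) :
  (forall x, m1 `]x, +oo[%classic = m2 `]x, +oo[%classic) ->
  (forall x, m1 `]x, +oo[%classic < +oo)%E ->
  forall A, measurable A -> m1 A = m2 A.
Proof.
move=> m12 m1fin A mA.
apply: (@measure_unique _ _ R (@RGenOInfty.G R)
  (fun n => `](- n%:R), +oo[%classic)) => //.
- exact: RGenOInfty.measurableE.
- move=> _ _ [x ->] [y ->]; exists (Num.max x y).
  by apply/seteqP; split => z /=; rewrite !in_itv/= !andbT gt_max => /andP.
- by move=> n; exists (- n%:R).
- rewrite -subTset => x _; exists (Num.trunc `|x|).+1 => //=.
  rewrite in_itv/= andbT ltrNl (le_lt_trans (ler_norm _))// normrN.
  exact: truncnS_gt.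
- by move=> _ [x ->].
Qed.

Lemma lam_rayc x : lam `]-oo, x]%classic = (clip x)%:E.
Proof.
apply/le_anti/andP; split.
  apply/lee_addgt0Pr => e e0.
  apply: (@le_trans _ _ (lam `]-oo, (x + e)[%classic)).
    apply: le_measure; rewrite ?inE; try exact: measurable_itv.
    by move=> u /=; rewrite !in_itv/= => ux; lra.
  rewrite lam_ray -EFinD lee_fin /clip /Num.min /Num.max.
  do ?case: ifP => //; lra.
rewrite -lam_ray; apply: le_measure; rewrite ?inE; try exact: measurable_itv.
by move=> u /=; rewrite !in_itv/= => /ltW.
Qed.

Lemma lam_oc a b : 0 <= a -> a <= b -> b <= 1 -> lam `]a, b]%classic = (b - a)%:E.
Proof.
move=> a0 ab b1.
have -> : `]a, b]%classic = `]-oo, b]%classic `\` `]-oo, a]%classic.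
  by apply/seteqP; split => u /=; rewrite !in_itv/=;
    [move=> /andP[au ->]; split => //; apply/negP; rewrite -ltNge|
     move=> [-> /negP]; rewrite -ltNge => ->].
rewrite measureD//=; last by rewrite lam_rayc ltry.
rewrite setIidr; last by move=> u /=; rewrite !in_itv/= => /le_trans; apply.
by rewrite !lam_rayc -EFinB !clip_id//; lra.
Qed.

(** * Quantiles of the uniform law restricted to a set *)

Section quantile.
Variables (C : set R) (mC : measurable C).

Let ray t : set R := `]-oo, t]%classic.

Let mray t : measurable (C `&` ray t).
Proof. by apply: measurableI => //; exact: measurable_itv. Qed.

Let F t := fine (lam (C `&` ray t)).

Let FE t : lam (C `&` ray t) = (F t)%:E.
Proof. by rewrite fineK// fin_num_measure. Qed.

Let p := fine (lam C).

Let pE : lam C = p%:E. Proof. by rewrite fineK// fin_num_measure. Qed.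

(** The generalised inverse of [F], the distribution function of [lam] restricted to [C] without
    normalisation. Hence its natural domain is []0, p]] with [p] the measure of [C]. *)
Definition conditional_quantile v := sup [set t | F t < v].

Local Notation G := conditional_quantile.

(** The uniform law has density at most 1, so [F] is nondecreasing and Lipschitz. The Lipschitz part
    supplies the continuity that inverting [F] requires. *)
Let F_le s t : s <= t -> F s <= F t <= F s + (t - s).
Proof.
move=> st; rewrite -!lee_fin EFinD -!FE; apply/andP; split.
  apply: le_measure; rewrite ?inE//; apply: setIS => u /=.
  by rewrite /ray/= !in_itv/= => /le_trans; apply.
rewrite (_ : C `&` ray t = (C `&` ray s) `|` (C `&` `]s, t]%classic)); last first.
  rewrite -setIUr; congr (C `&` _); apply/seteqP; split => u; rewrite /ray/= !in_itv/=.
    by move=> ut; have [us|us] := leP u s; [left|right; rewrite ut].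
  by case=> [/le_trans|/andP[_ ->]//]; apply.
apply: (le_trans (measureU2 _ _ _)) => //.
  by apply: measurableI => //; exact: measurable_itv.
rewrite leeD2l//; apply: (@le_trans _ _ (lam `]s, t]%classic)).
  apply: le_measure; rewrite ?inE//; first by apply: measurableI => //; exact: measurable_itv.
have -> : `]s, t]%classic = `]-oo, t]%classic `\` `]-oo, s]%classic.
  by apply/seteqP; split => u /=; rewrite !in_itv/=;
    [move=> /andP[au ->]; split => //; apply/negP; rewrite -ltNge|
     move=> [-> /negP]; rewrite -ltNge => ->].
rewrite measureD//=; last by rewrite lam_rayc ltry.
rewrite setIidr; last by move=> u /=; rewrite !in_itv/= => /le_trans; apply.
rewrite !lam_rayc -EFinB lee_fin /clip /Num.min /Num.max.
by do ?case: ifP => //; lra.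
Qed.

Let F0 : F 0 = 0.
Proof.
apply/le_anti; rewrite fine_ge0// andbT -lee_fin -FE.
apply: (@le_trans _ _ (lam (ray 0))).
  by apply: le_measure; rewrite ?inE//; exact: measurable_itv.
by rewrite lam_rayc clip_le0.
Qed.

Let F1 : F 1 = p.
Proof.
apply/le_anti/andP; split.
  rewrite -lee_fin -FE -pE; apply: le_measure; rewrite ?inE//.
rewrite -lee_fin -FE -pE.
have mr : measurable (ray 1) by exact: measurable_itv.
have r1 : lam (ray 1) = 1%E by rewrite lam_rayc clip_ge1.
have e0 : lam (~` ray 1) = 0%E.
  by have := probability_setC lam mr; rewrite /= r1 subee.
rewrite -{1}[C](setUIDK _ (ray 1)).
apply: (le_trans (measureU2 _ _ _)) => //; first by apply: measurableD => //; exact: measurable_itv.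
rewrite [X in (_ + X)%E](_ : _ = 0%E) ?adde0//.
apply: (@subset_measure0 _ _ _ lam _ (~` ray 1)) => //.
- by apply: measurableD => //; exact: measurable_itv.
- by apply: measurableC; exact: measurable_itv.
Qed.

Lemma conditional_quantile_le v x : 0 < v -> v <= p -> (G v <= x) = (v <= F x).
Proof.
move=> v0 vp.
have ne : [set t | F t < v] !=set0 by exists 0; rewrite /= F0.
apply/idP/idP => [Gx|vF]; last first.
  apply: ge_sup => // t /= Fv; rewrite leNgt; apply/negP => xt.
  have /andP[] := F_le (ltW xt); lra.
rewrite leNgt; apply/negP => Fv.
have ub : has_ubound [set t | F t < v].
  exists 1 => t /= Fv'; rewrite leNgt; apply/negP => xt.
  by have /andP[] := F_le (ltW xt); rewrite F1; lra.
(* If [F x < v], the Lipschitz bound keeps [F] below [v] for a further half of the gap, so the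
   supremum lies strictly beyond [x]. *)
have : x + (v - F x) / 2 <= G v.
  apply: ub_le_sup => //=.
  by have /andP[] := @F_le x (x + (v - F x) / 2) ltac:(lra); lra.
lra.
Qed.

Lemma measurable_conditional_quantile :
  measurable_fun `]0, p]%classic G.
Proof.
apply: (measurability _ (RGenOInfty.measurableE R)) => //= _ [_ [x ->] <-].
rewrite (_ : _ `&` _ = `]0, p]%classic `&` `]F x, +oo[%classic).
  by apply: measurableI; exact: measurable_itv.
apply/seteqP; split => v /=; rewrite !in_itv/= !andbT => -[/andP[v0 vp]].
  by rewrite v0 vp 2!ltNge conditional_quantile_le.
by rewrite v0 vp 2!ltNge conditional_quantile_le.
Qed.

Lemma lam_conditional_quantile B : measurable B ->
  lam (`]0, p]%classic `&` G @^-1` B) = lam (C `&` B).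
Proof.
move=> mB.
have mI : measurable (`]0, p]%classic : set R) by exact: measurable_itv.
have p01 : 0 <= p <= 1.
  by rewrite fine_ge0//= -lee_fin -pE probability_le1.
pose G' := G \_ `]0, p]%classic.
have mG' : measurable_fun setT G'.
  by apply/(measurable_restrictT _ mI); exact: measurable_conditional_quantile.
have e B' : `]0, p]%classic `&` G @^-1` B' = G' @^-1` B' `&` `]0, p]%classic.
  apply/seteqP; split => v /= []; rewrite /G' patchE.
    by move=> vI; rewrite mem_set.
  by move=> + vI; rewrite mem_set.
have fin_ x : (lam (`]x, +oo[%classic `&` C) < +oo)%E.
  by rewrite -ge0_fin_numE// fin_num_measure//; apply: measurableI => //; exact: measurable_itv.
have key x : lam (`]0, p]%classic `&` G @^-1` `]x, +oo[%classic) = lam (`]x, +oo[%classic `&` C).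
  transitivity (lam `]F x, p]%classic).
    have /andP[Fx0 Fxp] : 0 <= F x <= p.
      rewrite fine_ge0//= -lee_fin -FE -pE; apply: le_measure; rewrite ?inE//.
    congr (lam _); apply/seteqP; split => v /=; rewrite !in_itv/= ?andbT.
      by move=> [/andP[v0 vp]]; rewrite ltNge conditional_quantile_le// -ltNge vp andbT.
    move=> /andP[Fv vp]; have v0 := le_lt_trans Fx0 Fv; split; first by rewrite v0.
    by rewrite ltNge conditional_quantile_le// -ltNge.
  have /andP[Fx0 Fxp] : 0 <= F x <= p.
    rewrite fine_ge0//= -lee_fin -FE -pE; apply: le_measure; rewrite ?inE//.
  rewrite lam_oc//; last by have /andP[] := p01.
  rewrite EFinB -FE -pE (_ : `]x, +oo[%classic `&` C = C `\` ray x).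
    rewrite measureD//; first by exact: measurable_itv.
    by rewrite /= pE ltry.
  apply/seteqP; split => u /=; rewrite in_itv/= andbT.
    by move=> [h Cu]; split => //; rewrite /ray/= in_itv/= leNgt h.
  by move=> [Cu +]; rewrite /ray/= in_itv/= => /negP; rewrite -ltNge.
rewrite [C `&` B]setIC e.
apply: (@eq_measure_upper_rays (image_measure (mrestr lam mI) mG') (mrestr lam mC)) => //= x.
  by rewrite /pushforward /mrestr -e key.
by rewrite /pushforward /mrestr -e key.
Qed.

End quantile.

(** With [p] the measure of [A], the interval []0, p]] is mapped by the quantile of [A], and []p,
    1]], shifted to start at 0, by the quantile of the complement. Each piece reproduces [lam] on
    its own set, so together they preserve [lam]. *)
Lemma exists_rearrangement A : measurable A ->
  exists th : R -> R, [/\ measurable_fun setT th,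
    forall B, measurable B -> lam (th @^-1` B) = lam B &
    {ae lam, forall v, fine (lam A) < v -> ~ A (th v)}].
Proof.
move=> mA.
have mAC : measurable (~` A) by exact: measurableC.
pose p := fine (lam A); pose p' := fine (lam (~` A)).
have pE : lam A = p%:E by rewrite fineK// fin_num_measure.
have p01 : 0 <= p <= 1.
  by rewrite fine_ge0//= -lee_fin -pE probability_le1.
have p'E : p' = 1 - p by rewrite /p' probability_setC//= pE.
pose I : set R := `]0, p]%classic; pose J : set R := `]p, 1]%classic.
have mI : measurable I by exact: measurable_itv.
have mJ : measurable J by exact: measurable_itv.
pose sh := fun v : R => v - p.
have msh : measurable_fun setT sh by exact: measurable_funB.
pose I' : set R := `]0, p']%classic.
have mI' : measurable I' by exact: measurable_itv.
have JI' : J = sh @^-1` I'.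
  by apply/seteqP; split => v; rewrite /J /I' /sh /= !in_itv/= p'E; lra.
have lam_sh B : measurable B -> lam (sh @^-1` (I' `&` B)) = lam (I' `&` B).
  move=> mB; rewrite setIC; have -> : sh @^-1` (B `&` I') = sh @^-1` B `&` J by rewrite JI'.
  apply: (@eq_measure_upper_rays (image_measure (mrestr lam mJ) msh) (mrestr lam mI')) => //= x.
    rewrite /mrestr /pushforward.
    (* Translation invariance is checked on rays; [y] is the endpoint [x] clamped to [[0, p']], so
       that only intervals inside the unit interval are measured. *)
    pose y := Num.min (Num.max x 0) p'.
    have y0 : 0 <= y <= p' by rewrite /y le_min le_max lexx orbT ge_min lexx orbT p'E; lra.
    transitivity (lam `](y + p), 1%R]%classic).
      congr (lam _); apply/seteqP; split => v; rewrite /sh /J /= !in_itv/= andbT /y /Num.min /Num.max p'E;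
      do ?case: ifP => //; lra.
    have [{}y0 y1] := andP y0.
    rewrite lam_oc; [|lra|lra|lra].
    transitivity (lam `]y, p']%classic); first by rewrite lam_oc//; [rewrite p'E; congr EFin; lra|lra].
    congr (lam _); apply/seteqP; split => v; rewrite /sh /I' /= !in_itv/= andbT /y /Num.min /Num.max p'E;
      do ?case: ifP => //; lra.
  rewrite /mrestr /pushforward; apply: (le_lt_trans (probability_le1 lam _)); last exact: ltry.
  by apply: measurableI => //; apply: measurable_preimage => //; exact: measurable_itv.
pose g1 := conditional_quantile A \_ I.
pose g2 := (conditional_quantile (~` A) \_ I') \o sh.
have m1 : measurable_fun setT g1.
  by apply/(measurable_restrictT _ mI); exact: measurable_conditional_quantile.
have m2 : measurable_fun setT g2.
  apply: measurableT_comp msh.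
  by apply/(measurable_restrictT _ mI'); exact: measurable_conditional_quantile.
pose th v := if v <= p then g1 v else g2 v.
have mth : measurable_fun setT th.
  by apply: measurable_fun_ifT => //; exact: measurable_fun_ler.
have thI v : I v -> th v = conditional_quantile A v.
  move=> Iv; rewrite /th /g1 patchE mem_set//.
  by move: Iv; rewrite /I/= in_itv/= => /andP[_ ->].
have thJ v : J v -> th v = conditional_quantile (~` A) (sh v).
  move=> Jv; rewrite /th /g2/= patchE mem_set; last by move: Jv; rewrite JI'.
  by move: Jv; rewrite /J/= in_itv/= => /andP[pv _]; rewrite leNgt pv.
have th1 B : measurable B -> lam (th @^-1` B `&` I) = lam (A `&` B).
  move=> mB; rewrite -[RHS]lam_conditional_quantile//; congr (lam _).
  by apply/seteqP; split => v /= [h1 h2]; split => //; move: h1 h2;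
    [move=> + Iv|move=> Iv]; rewrite /preimage/= thI.
have th2 B : measurable B -> lam (th @^-1` B `&` J) = lam (~` A `&` B).
  move=> mB; rewrite -[RHS]lam_conditional_quantile//.
  have mq : measurable (I' `&` conditional_quantile (~` A) @^-1` B).
    exact: measurable_conditional_quantile.
  have := lam_sh _ mq; rewrite setIA setIid => <-.
  rewrite preimage_setI -JI' setIC; congr (lam _).
  by apply/seteqP; split => v /= [h1 h2]; split => //; move: h2;
    rewrite /preimage/= thJ.
exists th; split => //.
- move=> B mB.
  have mtB : measurable (th @^-1` B) by exact: measurable_preimage.
  have -> : lam B = (lam (A `&` B) + lam (~` A `&` B))%E.
    rewrite -measureU//; [|exact: measurableI|exact: measurableI|].
      by rewrite -setIUl setUCr setTI.
    by rewrite setIACA setICr set0I.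
  rewrite -th1// -th2// -measureU//; [|exact: measurableI|exact: measurableI|]; last first.
    rewrite setIACA setIid; apply/seteqP; split => v // [_ []].
    by rewrite /I /J/= !in_itv/=; lra.
  apply: lam_eq01 => //.
    by apply: measurableU; exact: measurableI.
  move=> v v01; rewrite /I /J/= !in_itv/=; split.
    by move=> Bv; have [vp|vp] := leP v p; [left|right]; split => //; lra.
  by case=> -[].
(* The quantile of the complement takes its values in the complement only up to a null set, which is
   the exceptional set here. *)
- exists (th @^-1` A `&` `]p, +oo[%classic); split.
  + by apply: measurableI; [exact: measurable_preimage|exact: measurable_itv].
  + transitivity (lam (th @^-1` A `&` J)).
      apply: lam_eq01.
      * by apply: measurableI; [exact: measurable_preimage|exact: measurable_itv].
      * by apply: measurableI; [exact: measurable_preimage|exact: measurable_itv].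
      * move=> v v01; rewrite /J/= !in_itv/= andbT.
        by split=> -[h1 h2]; split => //; lra.
    by rewrite th2// setICl measure0.
  + by move=> v /= /not_implyP[pv /contrapT Av]; rewrite in_itv/= pv.
Qed.

End rearrangement.

(** * Selection of a random index *)

Section random_index.
Context {R : realType}.
Implicit Types (u v a b t x : R).

Lemma lam_co a b : 0 <= a -> a <= b -> b <= 1 -> lam `[a, b[%classic = (b - a)%:E.
Proof.
move=> a0 ab b1.
have -> : `[a, b[%classic = `]-oo, b[%classic `\` `]-oo, a[%classic.
  by apply/seteqP; split => u /=; rewrite !in_itv/=;
    [move=> /andP[au ->]; split => //; apply/negP; rewrite -leNgt|
     move=> [-> /negP]; rewrite -leNgt => ->].
rewrite measureD//=; last by rewrite lam_ray ltry.
rewrite setIidr; last by move=> u /=; rewrite !in_itv/= => /lt_le_trans; apply.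
by rewrite !lam_ray -EFinB !clip_id//; lra.
Qed.

Lemma measurable_fun_select d d' (T : measurableType d) (X : measurableType d')
    (k : T -> nat) (g : nat -> T -> X) :
  (forall i, measurable (k @^-1` [set i])) -> (forall i, measurable_fun setT (g i)) ->
  measurable_fun setT (fun z => g (k z) z).
Proof.
move=> mk mg _ B mB; rewrite setTI.
rewrite (_ : _ @^-1` B = \bigcup_i (k @^-1` [set i] `&` g i @^-1` B)).
  by apply: bigcupT_measurable => i; apply: measurableI => //; exact: measurable_preimage.
by apply/seteqP; split => [z Bz|z [i _ [/= <-]]//]; exists (k z).
Qed.

Variables (n : nat) (w : nat -> R).
Hypothesis w_ge0 : forall i, 0 <= w i.

Definition partial_sum k := \sum_(i < k) w i.
Local Notation q := (partial_sum n).
Hypothesis q_gt0 : 0 < q.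

Let frac v := if 0 <= v < 1 then v else 0.

(** Inverse transform sampling of the discrete law [w i / q]. [frac] sends numbers outside [[0, 1[]
    to 0, so that the search always succeeds. *)
Definition select v := find (fun k => frac v * q < partial_sum k.+1) (iota 0 n).

Let sum_homo : {homo partial_sum : i j / (i <= j)%N >-> i <= j}.
Proof.
apply: homo_leq => // [y x z|i]; first exact: le_trans.
by rewrite /partial_sum big_ord_recr/= lerDl.
Qed.

Let frac_lt v : 0 <= frac v < 1.
Proof. by rewrite /frac; case: ifPn => // _; rewrite lexx ltr01. Qed.

Let has_select v : has (fun k => frac v * q < partial_sum k.+1) (iota 0 n).
Proof.
case: n q_gt0 => [|m] q0; first by move: q0; rewrite /partial_sum big_ord0 ltxx.
apply/hasP; exists m; first by rewrite mem_iota/= add0n.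
by have /andP[_ v1] := frac_lt v; rewrite gtr_pMl.
Qed.

Lemma select_lt v : (select v < n)%N.
Proof. by have := has_select v; rewrite has_find size_iota. Qed.

Lemma selectP v i : (i < n)%N ->
  (select v == i) = (partial_sum i <= frac v * q < partial_sum i.+1).
Proof.
move=> ltin; have h := nth_find 0 (has_select v).
rewrite -/(select v) nth_iota ?select_lt// add0n in h.
have h' j : (j < select v)%N -> partial_sum j.+1 <= frac v * q.
  move=> jv; have := before_find 0 jv.
  rewrite nth_iota ?(ltn_trans jv (select_lt v))// add0n.
  by move=> /negbT; rewrite -leNgt.
apply/eqP/andP => [<-|[h1 h2]].
  split => //; case E : (select v) h' => [|j] h'; last exact: h'.
  rewrite /partial_sum big_ord0 mulr_ge0// ?(ltW q_gt0)//.
  by have /andP[] := frac_lt v.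
apply/eqP; rewrite eqn_leq; apply/andP; split; rewrite leqNgt; apply/negP => lt.
  by have := le_lt_trans (h' _ lt) h2; rewrite ltxx.
by have := lt_le_trans h (le_trans (sum_homo lt) h1); rewrite ltxx.
Qed.

(** The half-open interval of the selected index contains [frac v * q], so it is nonempty. As this
    holds for every [v], events of rate zero, such as a completion with nobody in service, occur on
    no path at all. *)
Lemma select_gt0 v : 0 < w (select v).
Proof.
have := selectP v (select_lt v); rewrite eqxx => /esym/andP[h1 h2].
have := le_lt_trans h1 h2; rewrite {2}/partial_sum big_ord_recr/= -/(partial_sum _).
by rewrite ltrDl.
Qed.

Lemma measurable_select i : measurable (select @^-1` [set i]).
Proof.
have [ltin|nlei] := ltnP i n; last first.
  rewrite (_ : _ @^-1` _ = set0) // -subset0 => v /= vi.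
  by have := select_lt v; rewrite vi ltnNge nlei.
have mf : measurable_fun setT (frac : R -> R).
  apply: measurable_fun_ifT => //; apply: measurable_and.
    exact: measurable_fun_ler.
  exact: measurable_fun_ltr.
rewrite (_ : _ @^-1` _ = (fun v => frac v * q) @^-1` `[partial_sum i, (partial_sum i.+1)[%classic).
  by apply: measurable_preimage => //; exact: measurable_funM.
apply/seteqP; split => v /=; rewrite in_itv/= -selectP//.
  by move=> ->.
by move=> /eqP.
Qed.

Lemma lam_select i : (i < n)%N -> lam (select @^-1` [set i]) = (w i / q)%:E.
Proof.
move=> ltin.
have s0 : 0 <= partial_sum i.
  by have := sum_homo (leq0n i); rewrite {1}/partial_sum big_ord0.
have sE : partial_sum i.+1 = partial_sum i + w i by rewrite /partial_sum big_ord_recr.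
transitivity (lam `[(partial_sum i / q), (partial_sum i.+1 / q)[%classic).
  apply: lam_eq01 => //; first exact: measurable_select.
  move=> v /andP[v0 v1]; rewrite /= in_itv/= ler_pdivrMr// ltr_pdivlMr//.
  have fv : frac v = v by rewrite /frac (ltW v0) v1.
  have := selectP v ltin; rewrite fv => <-; split => [->|/eqP]//.
rewrite lam_co ?divr_ge0 ?(ltW q_gt0)//.
- by rewrite -mulrBl sE addrAC subrr add0r.
- by rewrite ler_pM2r ?invr_gt0// sum_homo.
- by rewrite ler_pdivrMr// mul1r sum_homo.
Qed.

Local Open Scope ereal_scope.

Lemma integral_select (K : nat -> \bar R) : (forall i, 0 <= K i) ->
  \int[lam]_v K (select v) = \sum_(i < n) (w i / q)%:E * K i.
Proof.
move=> K0.
have mI i : measurable_fun setT (fun v : R => (\1_(select @^-1` [set i]) v)%:E : \bar R).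
  by apply/measurable_EFinP/measurable_indic; exact: measurable_select.
transitivity (\int[lam]_v \sum_(i < n) K i * (\1_(select @^-1` [set (i : nat)]) v)%:E).
  apply: eq_integral => v _; rewrite (bigD1 (Ordinal (select_lt v)))//= indicE mem_set//.
  rewrite mule1 big1 ?adde0// => j /eqP jv; rewrite indicE memNset ?mule0//.
  by move=> /= e; apply: jv; exact: val_inj.
rewrite ge0_integral_sum//; last 2 first.
  by move=> i; apply: measurable_funeM.
  by move=> i v _; rewrite mule_ge0// lee_fin.
apply: eq_bigr => i _; rewrite ge0_integralZl//.
rewrite integral_indic ?setIT//; last exact: measurable_select.
by rewrite [X in (_ * X = _)%E](lam_select (ltn_ord i)) muleC.
Qed.

End random_index.

(** * Jump chains *)

Lemma measurable_cst_prop d (T : measurableType d) (Q : Prop) :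
  measurable [set _ : T | Q].
Proof.
have [q|nq] := pselect Q.
  by rewrite (_ : mkset _ = setT)//; apply/seteqP; split.
by rewrite (_ : mkset _ = set0)//; apply/seteqP; split.
Qed.

Section jump_chain.
Context {R : realType} {St : countType}.
Variables (n : nat) (rate : St -> nat -> R) (tgt : St -> nat -> St) (dead : St).
Hypothesis rate_ge0 : forall s i, 0 <= rate s i.

Definition total_rate s := partial_sum (rate s) n.
Hypothesis total_rate_gt0 : forall s, 0 < total_rate s.

Implicit Types (s a b : St) (w t u h : R) (m k i : nat).

(* One uniform number [w] is split into the mark of the first jump, its exponential clock and a fresh uniform number. *)
Definition mark s w := select n (rate s) (even_digits w).
Definition clock w : R := exp_time (even_digits (odd_digits w)).
Definition rest w : R := odd_digits (odd_digits w).

Definition next_state s w := tgt s (mark s w).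
Definition hold s w := clock w / total_rate s.

Fixpoint jump_state m s w :=
  if m is m'.+1 then jump_state m' (next_state s w) (rest w) else s.

Fixpoint jump_time m s w :=
  if m is m'.+1 then hold s w + jump_time m' (next_state s w) (rest w) else 0.

Lemma mark_lt s w : (mark s w < n)%N.
Proof. exact: (select_lt (total_rate_gt0 s)). Qed.

Lemma rate_mark_gt0 s w : 0 < rate s (mark s w).
Proof. exact: (select_gt0 (rate_ge0 s) (total_rate_gt0 s)). Qed.

Lemma clock_gt0 w : 0 < clock w.
Proof. exact: exp_time_gt0. Qed.

Lemma hold_gt0 s w : 0 < hold s w.
Proof. by rewrite divr_gt0// clock_gt0. Qed.

(** The definition peels off the first jump, which suits conditioning; this form peels off the last
    one, which suits sums along a path. [iter m rest w] is the randomness left after [m] jumps. *)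
Lemma jump_stateS m s w :
  jump_state m.+1 s w = next_state (jump_state m s w) (iter m rest w).
Proof.
elim: m s w => [//|m IH] s w.
by rewrite -[LHS]/(jump_state m.+1 (next_state s w) (rest w)) IH iterSr.
Qed.

Lemma jump_timeS m s w :
  jump_time m.+1 s w = jump_time m s w + hold (jump_state m s w) (iter m rest w).
Proof.
elim: m s w => [|m IH] s w; first by rewrite /= addr0 add0r.
by rewrite -[LHS]/(hold s w + jump_time m.+1 (next_state s w) (rest w)) IH addrA iterSr.
Qed.

Lemma jump_time_lt m s w : jump_time m s w < jump_time m.+1 s w.
Proof. by rewrite jump_timeS ltrDl hold_gt0. Qed.

Lemma jump_time_homo s w : {homo jump_time ^~ s ^~ w : m k / (m <= k)%N >-> m <= k}.
Proof.
by apply: homo_leq => // [y x z|i]; [exact: le_trans|exact/ltW/jump_time_lt].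
Qed.

Definition is_njumps s w t m := jump_time m s w <= t < jump_time m.+1 s w.

Lemma is_njumps_inj s w t m k : is_njumps s w t m -> is_njumps s w t k -> m = k.
Proof.
suff H m' k' : is_njumps s w t m' -> is_njumps s w t k' -> (m' <= k')%N.
  by move=> h1 h2; apply/eqP; rewrite eqn_leq !H.
move=> /andP[h1 _] /andP[_ h2]; rewrite leqNgt; apply/negP => km.
by have := lt_le_trans h2 (le_trans (jump_time_homo s w km) h1); rewrite ltxx.
Qed.

Definition njumps s w t := xget 0%N [set m | is_njumps s w t m].

(** The value [dead] is taken at times that lie in no interval between consecutive jumps: beyond an
    explosion, and before time 0. *)
Definition trajectory s w t :=
  if is_njumps s w t (njumps s w t) then jump_state (njumps s w t) s w else dead.

Lemma njumpsE s w t m : is_njumps s w t m -> njumps s w t = m.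
Proof.
move=> h; rewrite /njumps; case: xgetP => [k _ hk|/(_ m)//].
exact: is_njumps_inj hk h.
Qed.

Lemma trajectoryE s w t m : is_njumps s w t m -> trajectory s w t = jump_state m s w.
Proof. by move=> h; rewrite /trajectory (njumpsE h) h. Qed.

Lemma trajectory_dead s w t : (forall m, ~~ is_njumps s w t m) -> trajectory s w t = dead.
Proof. by move=> h; rewrite /trajectory (negbTE (h _)). Qed.

Lemma trajectoryP s w t : (exists2 m, is_njumps s w t m & trajectory s w t = jump_state m s w)
  \/ ((forall m, ~~ is_njumps s w t m) /\ trajectory s w t = dead).
Proof.
have [[m h]|h] := pselect (exists m, is_njumps s w t m).
  by left; exists m => //; exact: trajectoryE.
have h' m : ~~ is_njumps s w t m by apply/negP => hm; apply: h; exists m.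
by right; split => //; exact: trajectory_dead.
Qed.

Lemma is_njumpsS s w t m :
  is_njumps s w t m.+1 = is_njumps (next_state s w) (rest w) (t - hold s w) m.
Proof. by rewrite /is_njumps/= lerBrDl ltrBlDl. Qed.

Lemma is_njumps0 s w t : 0 <= t -> is_njumps s w t 0 = (t < hold s w).
Proof. by move=> t0; rewrite /is_njumps/= t0 addr0. Qed.

Lemma trajectory_before s w t : 0 <= t < hold s w -> trajectory s w t = s.
Proof. by move=> /andP[t0 th]; rewrite (@trajectoryE _ _ _ 0)// is_njumps0. Qed.

Lemma trajectory_after s w t : hold s w <= t ->
  trajectory s w t = trajectory (next_state s w) (rest w) (t - hold s w).
Proof.
move=> ht; have [[m h ->]|[h ->]] := trajectoryP (next_state s w) (rest w) (t - hold s w).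
  by rewrite (@trajectoryE _ _ _ m.+1)// is_njumpsS.
rewrite trajectory_dead// => -[|m]; last by rewrite is_njumpsS.
by rewrite is_njumps0 ?(le_trans (ltW (hold_gt0 s w)))// -leNgt.
Qed.

Lemma measurable_mark s i : measurable (mark s @^-1` [set i]).
Proof.
apply: (measurable_preimage (f := even_digits) (A := select n (rate s) @^-1` [set i])).
  exact: measurable_even_digits.
exact: (measurable_select (rate_ge0 s) (total_rate_gt0 s)).
Qed.

Lemma measurable_clock : measurable_fun setT (clock : R -> R).
Proof.
apply: measurableT_comp; first exact: measurable_exp_time.
by apply: measurableT_comp; [exact: measurable_even_digits|exact: measurable_odd_digits].
Qed.

Lemma measurable_rest : measurable_fun setT (rest : R -> R).
Proof. by apply: measurableT_comp; exact: measurable_odd_digits. Qed.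

Lemma measurable_hold s : measurable_fun setT (hold s : R -> R).
Proof. by apply: measurable_funM => //; exact: measurable_clock. Qed.

Lemma measurable_jump_time m s : measurable_fun setT (jump_time m s : R -> R).
Proof.
elim: m s => [|m IH] s /=; first exact: measurable_cst.
apply: measurable_funD; first exact: measurable_hold.
apply: (measurable_fun_select (k := mark s)
  (g := fun i w => jump_time m (tgt s i) (rest w))) => i.
  exact: measurable_mark.
exact: measurableT_comp measurable_rest.
Qed.

Lemma measurable_jump_state m s a : measurable [set w | jump_state m s w = a].
Proof.
elim: m s => [|m IH] s /=.
  exact: measurable_cst_prop.
rewrite (_ : mkset _ = \bigcup_i (mark s @^-1` [set i] `&`
    rest @^-1` [set w | jump_state m (tgt s i) w = a])).
  apply: bigcupT_measurable => i; apply: measurableI; first exact: measurable_mark.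
  by apply: measurable_preimage => //; exact: measurable_rest.
apply/seteqP; split => [w /= h|w [i _ [/= <-]]//].
by exists (mark s w).
Qed.

Section measurability.
Context d (T : measurableType d) (f g : T -> R).
Hypotheses (mf : measurable_fun setT f) (mg : measurable_fun setT g).

Lemma measurable_is_njumps s m : measurable [set z | is_njumps s (f z) (g z) m].
Proof.
rewrite (_ : mkset _ = (fun z => is_njumps s (f z) (g z) m) @^-1` [set true]).
  apply: measurable_preimage => //; apply: measurable_and.
    apply: measurable_fun_ler => //.
    by apply: measurableT_comp mf; exact: measurable_jump_time.
  apply: measurable_fun_ltr => //.
  by apply: measurableT_comp mf; exact: measurable_jump_time.
by apply/seteqP; split.
Qed.

(** The time depends on [z] as well as the random number, because after the first jump the remaining
    time is itself random. *)
Lemma measurable_trajectory s (A : set St) : measurable [set z | A (trajectory s (f z) (g z))].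
Proof.
have m1 a : measurable [set z | trajectory s (f z) (g z) = a].
  rewrite (_ : mkset _ =
    \bigcup_m ([set z | is_njumps s (f z) (g z) m] `&` f @^-1` [set w | jump_state m s w = a])
    `|` (\bigcap_m ~` [set z | is_njumps s (f z) (g z) m] `&` [set z | dead = a])).
    apply: measurableU.
      apply: bigcupT_measurable => m; apply: measurableI; first exact: measurable_is_njumps.
      apply: measurable_preimage => //; exact: measurable_jump_state.
    apply: measurableI.
      by apply: bigcapT_measurable => m; apply: measurableC; exact: measurable_is_njumps.
    exact: measurable_cst_prop.
  apply/seteqP; split => z /=.
    have [[m h ->]|[h ->]] := trajectoryP s (f z) (g z).
      by move=> e; left; exists m.
    by move=> e; right; split => // m _ /=; exact/negP.
  case=> [[m _ [/= h]]|[h]].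
    by rewrite (trajectoryE h).
  by rewrite trajectory_dead// => m; apply/negP; exact: (h m I).
rewrite (_ : mkset _ = \bigcup_k (if unpickle k is Some a then
    [set z | trajectory s (f z) (g z) = a /\ A a] else set0)).
  apply: bigcupT_measurable => k; case: unpickle => [a|//].
  have [Aa|Aa] := pselect (A a); [rewrite (_ : mkset _ = [set z | trajectory s (f z) (g z) = a])//|
    rewrite (_ : mkset _ = set0)//].
    by apply/seteqP; split => z /= => [[]|].
  by rewrite -subset0 => z /= [].
apply/seteqP; split => z /=.
  by move=> Az; exists (pickle (trajectory s (f z) (g z))) => //; rewrite pickleK.
by case=> k _; case: unpickle => [a /= [->]|].
Qed.

End measurability.

Local Open Scope ereal_scope.

(* The mark, the clock and the fresh uniform number are independent. *)
Lemma integral_first_jump s (F : nat -> R * R -> \bar R) :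
  (forall i, measurable_fun setT (F i)) -> (forall i z, 0 <= F i z) ->
  \int[lam]_w F (mark s w) (clock w, rest w) =
  \sum_(i < n) (rate s i / total_rate s)%:E * \int[lam]_x \int[lam]_w F i (exp_time x, w).
Proof.
move=> mF F0.
have mE : measurable_fun setT (fun z : R * R => (exp_time z.1, z.2)).
  apply: measurable_fun_pair => //.
  by apply: measurableT_comp; [exact: measurable_exp_time|exact: measurable_fst].
pose H i (u : R) := F i (exp_time (even_digits u), odd_digits u).
have mH i : measurable_fun setT (H i).
  apply: measurableT_comp; first exact: mF.
  apply: measurable_fun_pair; last exact: measurable_odd_digits.
  by apply: measurableT_comp; [exact: measurable_exp_time|exact: measurable_even_digits].
transitivity (\int[lam]_v \int[lam]_u H (select n (rate s) v) u).
  rewrite -(@integral_digits R (fun z => H (select n (rate s) z.1) z.2))//;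
    last by move=> z; exact: F0.
  apply: (measurable_fun_select (k := fun z : R * R => select n (rate s) z.1)
     (g := fun i z => H i z.2)) => i.
    apply: (measurable_preimage (f := fst) (A := select n (rate s) @^-1` [set i])) => //.
    exact: (measurable_select (rate_ge0 s) (total_rate_gt0 s)).
  exact: measurableT_comp.
transitivity (\sum_(i < n) (rate s i / total_rate s)%:E * \int[lam]_u H i u).
  apply: (integral_select (rate_ge0 s) (total_rate_gt0 s) (K := fun i => \int[lam]_u H i u)).
  by move=> i; apply: integral_ge0 => u _; exact: F0.
apply: eq_bigr => i _; congr (_ * _).
rewrite -(@integral_digits R (fun z => F i (exp_time z.1, z.2)))//.
exact: measurableT_comp.
Qed.

Lemma lam_first_jump s (C : nat -> set (R * R)) : (forall i, measurable (C i)) ->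
  lam [set w | C (mark s w) (clock w, rest w)] =
  \sum_(i < n) (rate s i / total_rate s)%:E *
    \int[lam]_x lam [set w | C i (exp_time x, w)].
Proof.
move=> mC.
have mD : measurable [set w | C (mark s w) (clock w, rest w)].
  rewrite (_ : mkset _ = \bigcup_i (mark s @^-1` [set i] `&`
    (fun w => (clock w, rest w)) @^-1` C i)).
    apply: bigcupT_measurable => i; apply: measurableI; first exact: measurable_mark.
    apply: measurable_preimage => //.
    by apply: measurable_fun_pair; [exact: measurable_clock|exact: measurable_rest].
  by apply/seteqP; split => [w /= h|w [i _ [/= <-]]//]; exists (mark s w).
rewrite -[X in lam X = _]setIT -integral_indic//.
rewrite (integral_first_jump s (F := fun i z => (\1_(C i) z)%:E)); last 2 first.
- by move=> i; apply/measurable_EFinP/measurable_indic.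
- by move=> i z; rewrite lee_fin.
apply: eq_bigr => i _; congr (_ * _); apply: eq_integral => x _.
rewrite -[X in _ = lam X]setIT -integral_indic//.
have -> : [set w | C i (exp_time x, w)] = xsection (C i) (exp_time x).
  by apply/seteqP; split => w; rewrite /xsection/= inE.
exact: measurable_xsection.
Qed.

End jump_chain.

(** * The Markov property *)

Lemma measurable_forall_in d (T : measurableType d) (X : eqType) (L : seq X)
    (A : X -> set T) :
  (forall x, x \in L -> measurable (A x)) ->
  measurable [set z | forall x, x \in L -> A x z].
Proof.
elim: L => [|x L IH] mA.
  by rewrite (_ : mkset _ = setT)//; apply/seteqP; split.
rewrite (_ : mkset _ = A x `&` [set z | forall y, y \in L -> A y z]).
  apply: measurableI; first by apply: mA; rewrite mem_head.
  by apply: IH => y yL; apply: mA; rewrite inE yL orbT.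
apply/seteqP; split => z /= h.
  by split; [apply: h; rewrite mem_head|move=> y yL; apply: h; rewrite inE yL orbT].
by move=> y; rewrite inE => /predU1P[->|yL]; [exact: h.1|exact: h.2].
Qed.

Section markov.
Context {R : realType} {St : countType}.
Variables (n : nat) (rate : St -> nat -> R) (tgt : St -> nat -> St) (dead : St).
Hypothesis rate_ge0 : forall s i, 0 <= rate s i.
Local Notation q := (total_rate n rate).
Hypothesis q_gt0 : forall s, 0 < q s.
Local Notation mark := (mark n rate).
Local Notation hold := (hold n rate).
Local Notation next_state := (next_state n rate tgt).
Local Notation is_njumps := (is_njumps n rate tgt).
Local Notation traj := (trajectory n rate tgt dead).
Implicit Types (s a b : St) (w t u h : R) (m k i : nat) (L : seq (R * St)).

Let mf1 : measurable_fun setT (@fst R R).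
Proof. exact: measurable_fst. Qed.
Let mf2 : measurable_fun setT (@snd R R).
Proof. exact: measurable_snd. Qed.

(** The trajectory as a function of the first mark and of the pair of clock and fresh number. In
    this form the clock can be replaced by its residual value. *)
Definition one_jump s i (z : R * R) u :=
  if u < z.1 / q s then s else traj (tgt s i) z.2 (u - z.1 / q s).

Lemma trajectory_one_jump s w u : 0 <= u ->
  traj s w u = one_jump s (mark s w) (clock w, rest w) u.
Proof.
move=> u0; rewrite /one_jump /=; case: ifPn => uh.
  by rewrite trajectory_before// u0.
by rewrite trajectory_after// leNgt.
Qed.

Lemma measurable_one_jump s i u b : measurable [set z | one_jump s i z u = b].
Proof.
have md : measurable_fun setT (fun z : R * R => u - z.1 / q s).
  by apply: measurable_funB => //; exact: measurable_funM.
have m1 : measurable [set z : R * R | u < z.1 / q s].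
  by apply: measurable_lt_set => //; exact: measurable_funM.
rewrite (_ : mkset _ = ([set z : R * R | u < z.1 / q s] `&` [set _ | s = b]) `|`
  (~` [set z : R * R | u < z.1 / q s] `&` [set z | traj (tgt s i) z.2 (u - z.1 / q s) = b])).
  apply: measurableU; apply: measurableI => //.
  - exact: measurable_cst_prop.
  - exact: measurableC.
  - exact: (measurable_trajectory tgt dead rate_ge0 q_gt0 mf2 md (tgt s i) [set b]).
apply/seteqP; split => z; rewrite /one_jump /=.
  by case: ifPn => h e; [left|right; split => //; exact/negP].
by case=> [[-> //]|[/negP/negbTE -> //]].
Qed.

Local Open Scope ereal_scope.

(** The clock is exponential and independent of the mark and the rest, so given that no jump
    occurred before [t] its residual value is as good as new. Real time [t] is [q s * t] in clock
    units. *)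
Lemma lam_hold_memoryless s t (C : nat -> set (R * R)) : (0 <= t)%R ->
  (forall i, measurable (C i)) ->
  lam [set w | (t < hold s w)%R /\ C (mark s w) (clock w - q s * t, rest w)%R] =
  (expR (- (q s * t)))%:E * lam [set w | C (mark s w) (clock w, rest w)].
Proof.
move=> t0 mC.
have qt0 : (0 <= q s * t)%R by rewrite mulr_ge0// ltW.
have mg : measurable_fun setT (fun z : R * R => (z.1 - q s * t, z.2)%R).
  by apply: measurable_fun_pair => //; exact: measurable_funB.
pose D i : set (R * R) := [set z | (q s * t < z.1)%R] `&` (fun z : R * R => (z.1 - q s * t, z.2)%R) @^-1` C i.
have mD i : measurable (D i).
  apply: measurableI; last exact: measurable_preimage.
  by apply: measurable_lt_set.
rewrite (_ : [set w | (t < hold s w)%R /\ _] = [set w | D (mark s w) (clock w, rest w)]); last first.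
  apply/seteqP; split => w /=; rewrite /D /hold /= ltr_pdivlMr// [(q s * t)%R]mulrC => //.
rewrite (lam_first_jump rate_ge0 q_gt0)// (lam_first_jump rate_ge0 q_gt0)//.
rewrite ge0_sume_distrr; last first.
  move=> i _; rewrite mule_ge0//; last by apply: integral_ge0.
  by rewrite lee_fin divr_ge0// ltW.
apply: eq_bigr => i _; rewrite muleCA; congr (_ * _).
have mgx : measurable_fun setT (fun e : R => lam (xsection (C i) e)).
  exact: measurable_fun_xsection.
have xE e : [set w | C i (e, w)] = xsection (C i) e.
  by apply/seteqP; split => w; rewrite /xsection/= inE.
under [in RHS]eq_integral do rewrite xE.
rewrite -(integral_exp_time_shift (g := fun e => lam (xsection (C i) e)))//.
rewrite [RHS]integral_mkcond; apply: eq_integral => x _; rewrite patchE.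
case: ifPn => [/set_mem/= h|/negP h].
  rewrite -xE; congr (lam _); apply/seteqP; split => w; rewrite /D/=; tauto.
rewrite (_ : [set w | D i _] = set0) ?measure0// -subset0 => w [/= h' _].
by apply: h; rewrite inE.
Qed.

Lemma lam_hold_gt s t : (0 <= t)%R ->
  lam [set w | (t < hold s w)%R] = (expR (- (q s * t)))%:E.
Proof.
move=> t0; have := @lam_hold_memoryless s t (fun=> setT) t0 (fun=> measurableT).
rewrite [X in lam X = _](_ : _ = [set w | (t < hold s w)%R]); last first.
  by apply/seteqP; split => w /=; tauto.
by rewrite [X in _ * lam X](_ : _ = setT) ?probability_setT ?mule1.
Qed.

Definition transition h a b := fine (lam [set w | traj a w h = b]).

Let mtraj s t A : measurable [set w | A (traj s w t)].
Proof. exact: (measurable_trajectory tgt dead rate_ge0 q_gt0 (@measurable_id _ _ setT) (@measurable_cst _ _ _ _ _ t)). Qed.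

Lemma transitionE h a b : lam [set w | traj a w h = b] = (transition h a b)%:E.
Proof. by rewrite fineK// fin_num_measure//; exact: (mtraj a h (fun x => x = b)). Qed.

Definition history m s t L a : set R :=
  [set w | [/\ is_njumps s w t m, traj s w t = a &
            forall us, us \in L -> traj s w us.1 = us.2]].

Lemma measurable_history m s t L a : measurable (history m s t L a).
Proof.
rewrite (_ : history _ _ _ _ _ = [set w | is_njumps s w t m] `&`
  ([set w | traj s w t = a] `&` [set w | forall us, us \in L -> traj s w us.1 = us.2])).
  apply: measurableI; first by apply: (measurable_is_njumps tgt rate_ge0 q_gt0).
  apply: measurableI; first exact: (mtraj s t (fun x => x = a)).
  by apply: measurable_forall_in => us _; exact: (mtraj s us.1 (fun x => x = us.2)).
by apply/seteqP; split => w [] //= h1 [].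
Qed.

Let shift_past (tau : R) L : seq (R * St) :=
  [seq (us.1 - tau, us.2)%R | us <- L & (tau <= us.1)%R].

Lemma markov_njumps m s t L a h b : (0 <= t)%R -> (0 <= h)%R ->
  (forall us, us \in L -> 0 <= us.1 <= t)%R ->
  lam (history m s t L a `&` [set w | traj s w (t + h) = b]) =
  lam (history m s t L a) * (transition h a b)%:E.
Proof.
elim: m s t L => [|m IH] s t L t0 h0 Lt.
  have hE w : (t < hold s w)%R -> forall u, (0 <= u <= t)%R -> traj s w u = s.
    move=> th u /andP[u0 ut]; apply: (trajectory_before tgt dead q_gt0).
    by rewrite u0 (le_lt_trans ut).
  (* Before its first jump the path sits in [s], so the prescribed past either holds automatically
     or is contradictory. *)
  have [[sa Ls]|nQ] := pselect (s = a /\ forall us, us \in L -> us.2 = s); last first.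
    rewrite (_ : history _ _ _ _ _ = set0) ?set0I ?measure0 ?mul0e// -subset0 => w [].
    rewrite (is_njumps0 n rate tgt)// => th wa Lw; apply: nQ; split.
      by rewrite -wa hE// t0 lexx.
    by move=> us usL; rewrite -(Lw _ usL) hE//; exact: Lt.
  rewrite (_ : history _ _ _ _ _ = [set w | (t < hold s w)%R]); last first.
    apply/seteqP; split => w; first by case; rewrite (is_njumps0 n rate tgt).
    move=> /= th; split; first by rewrite (is_njumps0 n rate tgt).
      by rewrite hE ?t0 ?lexx.
    by move=> us usL; rewrite hE ?Ls//; exact: Lt.
  rewrite lam_hold_gt// -transitionE -sa.
  rewrite [X in _ = _ * lam X](_ : _ = [set w | one_jump s (mark s w) (clock w, rest w) h = b]); last first.
    by apply/seteqP; split => w /=; rewrite trajectory_one_jump.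
  rewrite -(@lam_hold_memoryless s t (fun i => [set z | one_jump s i z h = b]))//; last first.
    by move=> i; exact: measurable_one_jump.
  congr (lam _); apply/seteqP.
  have e w : traj s w (t + h)%R = one_jump s (mark s w) (clock w - q s * t, rest w)%R h.
    rewrite trajectory_one_jump ?addr_ge0// /one_jump/=.
    have -> : ((clock w - q s * t) / q s = clock w / q s - t)%R.
      by rewrite mulrBl mulrAC divff ?mul1r// gt_eqF.
    by rewrite ltrBrDl opprB addrA [(h + t)%R]addrC.
  by split => w /= []; rewrite e.
(* Given the first jump time [z.1 / q s], prescriptions for earlier times can only say [s], and
   those for later times constrain the path started afresh from [tgt s i]. *)
pose C i : set (R * R) := [set z | [/\ (z.1 / q s <= t)%R,
  (forall us, us \in L -> (us.1 < z.1 / q s)%R -> us.2 = s) &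
  history m (tgt s i) (t - z.1 / q s) (shift_past (z.1 / q s) L) a z.2]].
pose F i : set (R * R) := [set z | traj (tgt s i) z.2 (t + h - z.1 / q s)%R = b].
have md u : measurable_fun setT (fun z : R * R => u - z.1 / q s)%R.
  by apply: measurable_funB => //; exact: measurable_funM.
have mF i : measurable (F i).
  exact: (measurable_trajectory tgt dead rate_ge0 q_gt0 mf2 (md _) (tgt s i) [set b]).
have mle u : measurable [set z : R * R | (z.1 / q s <= u)%R].
  by apply: measurable_le_set => //; exact: measurable_funM.
have mC i : measurable (C i).
  rewrite (_ : C i = [set z | (z.1 / q s <= t)%R] `&`
   ([set z | forall us, us \in L -> (us.1 < z.1 / q s)%R -> us.2 = s] `&`
   ([set z | is_njumps (tgt s i) z.2 (t - z.1 / q s)%R m] `&`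
   ([set z | traj (tgt s i) z.2 (t - z.1 / q s)%R = a] `&`
    [set z | forall us, us \in L -> (z.1 / q s <= us.1)%R ->
       traj (tgt s i) z.2 (us.1 - z.1 / q s)%R = us.2])))).
    apply: measurableI; first exact: mle.
    apply: measurableI.
      apply: measurable_forall_in => us _.
      rewrite (_ : (fun z : R * R => _) = [set z : R * R | (z.1 / q s <= us.1)%R] `|` [set _ | us.2 = s]).
        by apply: measurableU; [exact: mle|exact: measurable_cst_prop].
      apply/seteqP; split => z /=.
        by have [zu|zu] := leP (z.1 / q s)%R us.1; [left|right; exact: H].
      by case=> [|//]; rewrite leNgt => /negbTE ->.
    apply: measurableI; first exact: (measurable_is_njumps tgt rate_ge0 q_gt0 mf2 (md _)).
    apply: measurableI.
      exact: (measurable_trajectory tgt dead rate_ge0 q_gt0 mf2 (md _) (tgt s i) [set a]).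
    apply: measurable_forall_in => us _.
    rewrite (_ : (fun z : R * R => _) = ~` [set z : R * R | (z.1 / q s <= us.1)%R] `|`
       [set z : R * R | traj (tgt s i) z.2 (us.1 - z.1 / q s)%R = us.2]).
      apply: measurableU; first by apply: measurableC; exact: mle.
      exact: (measurable_trajectory tgt dead rate_ge0 q_gt0 mf2 (md _) (tgt s i) [set us.2]).
    apply/seteqP; split => z /=.
      by have [zu|zu] := pselect (z.1 / q s <= us.1)%R; [right; exact: H|left].
    by case.
  apply/seteqP; split => z /=.
    move=> [h1 h2 [h3 h4 h5]]; do !split => //.
    move=> us usL zu; apply: (h5 (us.1 - z.1 / q s, us.2)%R).
    by apply/mapP; exists us => //; rewrite mem_filter zu.
  move=> [h1 [h2 [h3 [h4 h5]]]]; split => //; split => // us /mapP[vs].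
  by rewrite mem_filter => /andP[zv vL] ->; exact: h5.
have HE w : history m.+1 s t L a w <-> C (mark s w) (clock w, rest w).
  have nh : (hold s w <= t)%R -> forall u, (hold s w <= u)%R -> traj s w u =
     traj (next_state s w) (rest w) (u - hold s w)%R.
    by move=> _ u; exact: (trajectory_after tgt dead q_gt0).
  rewrite /C /history /=; split.
    move=> [h1 h2 h3].
    have ht : (hold s w <= t)%R.
      have /andP[+ _] := h1; rewrite [jump_time _ _ _ _ _ _]/= => h'.
      apply: le_trans h'; rewrite lerDl.
      by have := jump_time_homo tgt q_gt0 (next_state s w) (rest w) (leq0n m).
    split => //.
      move=> us usL uh; rewrite -(h3 _ usL); apply: (trajectory_before tgt dead q_gt0).
      by rewrite uh andbT; have /andP[] := Lt _ usL.
    split.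
    - by rewrite -(is_njumpsS n rate tgt).
    - by rewrite -(trajectory_after tgt dead q_gt0).
    move=> us /mapP[vs]; rewrite mem_filter => /andP[hv vL] ->/=.
    by rewrite -(h3 _ vL); apply/esym; exact: (trajectory_after tgt dead q_gt0 hv).
  move=> [ht h1 [h2 h3 h4]]; split.
  - by rewrite (is_njumpsS n rate tgt).
  - by rewrite (trajectory_after tgt dead q_gt0).
  move=> us usL; have [hu|uh] := leP (hold s w) us.1.
    rewrite (trajectory_after tgt dead q_gt0)//.
    apply: (h4 (us.1 - hold s w, us.2)%R).
    by apply/mapP; exists us => //; rewrite mem_filter hu.
  rewrite (trajectory_before tgt dead q_gt0) ?(h1 us)//.
  by rewrite uh andbT; have /andP[] := Lt _ usL.
have xE (A : set (R * R)) e : [set w | A (e, w)] = xsection A e.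
  by apply/seteqP; split => w; rewrite /xsection/= inE.
rewrite (_ : history _ _ _ _ _ `&` _ = [set w | (C (mark s w) `&` F (mark s w)) (clock w, rest w)]); last first.
  have ta w : (hold s w <= t)%R -> traj s w (t + h)%R = traj (next_state s w) (rest w) (t + h - hold s w)%R.
    by move=> ht; rewrite (trajectory_after tgt dead q_gt0)// (le_trans ht)// lerDl.
  apply/seteqP; split => w /= -[].
    move=> /HE Cw; rewrite ta => [e|]; last by have [] := Cw.
    by split.
  move=> Cw Fw; split; first exact/HE.
  by rewrite ta//; have [] := Cw.
rewrite (_ : history _ _ _ _ _ = [set w | C (mark s w) (clock w, rest w)]); last first.
  by apply/seteqP; split => w /HE.
rewrite (lam_first_jump rate_ge0 q_gt0 s (C := fun i => C i `&` F i)); last first.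
  by move=> i; exact: measurableI.
rewrite (lam_first_jump rate_ge0 q_gt0)//.
rewrite ge0_sume_distrl; last first.
  move=> i _; rewrite mule_ge0//; last by apply: integral_ge0.
  by rewrite lee_fin divr_ge0// ltW.
apply: eq_bigr => i _; rewrite -muleA; congr (_ * _).
rewrite -ge0_integralZr//; last 2 first.
- under eq_fun do rewrite xE.
  have mx : measurable_fun setT (fun e : R => lam (xsection (C i) e)).
    exact: measurable_fun_xsection.
  exact: (measurableT_comp mx measurable_exp_time).
- by rewrite lee_fin fine_ge0.
apply: eq_integral => x _.
have [[h1 h2]|nQ] := pselect ((exp_time x / q s <= t)%R /\
    forall us, us \in L -> (us.1 < exp_time x / q s)%R -> us.2 = s); last first.
  rewrite [X in lam X = _](_ : _ = set0) ?measure0; last first.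
    by rewrite -subset0 => w [[/= ? ? _] _]; exact: nQ.
  rewrite [X in _ = lam X * _](_ : _ = set0) ?measure0 ?mul0e//.
  by rewrite -subset0 => w [/= ? ? _]; exact: nQ.
rewrite [X in _ = lam X * _](_ : _ = history m (tgt s i) (t - exp_time x / q s)
    (shift_past (exp_time x / q s) L) a); last first.
  by apply/seteqP; split => w => [[]//|]; split.
rewrite -IH//.
- congr (lam _); apply/seteqP; split => w; rewrite /F/= addrAC; first by move=> [[_ _ ?] ?].
  by move=> [? ?]; split => //; split.
- by rewrite subr_ge0.
- move=> us /mapP[vs]; rewrite mem_filter => /andP[hv vL] ->/=.
  by rewrite subr_ge0 hv lerD2r; have /andP[] := Lt _ vL.
Qed.

End markov.

(** * Nonexplosion, the Markov property and the generator *)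

Section markov_limit.
Context {R : realType} {St : countType}.
Variables (n : nat) (rate : St -> nat -> R) (tgt : St -> nat -> St) (dead : St).
Hypothesis rate_ge0 : forall s i, 0 <= rate s i.
Local Notation q := (total_rate n rate).
Hypothesis q_gt0 : forall s, 0 < q s.
Local Notation mark := (mark n rate).
Local Notation hold := (hold n rate).
Local Notation next_state := (next_state n rate tgt).
Local Notation jump_time := (jump_time n rate tgt).
Local Notation jump_state := (jump_state n rate tgt).
Local Notation is_njumps := (is_njumps n rate tgt).
Local Notation traj := (trajectory n rate tgt dead).
Local Notation history := (history n rate tgt dead).
Local Notation transition := (transition n rate tgt dead).
Implicit Types (s a b : St) (w t u h : R) (m k i : nat) (L : seq (R * St)).

Definition nonexplosive s : set R := [set w | forall k, exists m, k%:R < jump_time m s w].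

Lemma measurable_nonexplosive s : measurable (nonexplosive s).
Proof.
rewrite (_ : nonexplosive s = \bigcap_k \bigcup_m (jump_time m s @^-1` `]k%:R, +oo[%classic)).
  apply: bigcapT_measurable => k; apply: bigcupT_measurable => m.
  apply: measurable_preimage; last exact: measurable_itv.
  exact: (measurable_jump_time tgt rate_ge0 q_gt0).
apply/seteqP; split => w h k.
  by move=> _; have [m hm] := h k; exists m => //=; rewrite in_itv/= andbT.
by have [m _] := h k Logic.I; rewrite /= in_itv/= andbT => hm; exists m.
Qed.

Lemma nonexplosive_njumps s w t : nonexplosive s w -> 0 <= t ->
  exists m, is_njumps s w t m.
Proof.
move=> ne t0.
have ex : exists m, t < jump_time m s w.
  have [m hm] := ne (Num.trunc t).+1; exists m; apply: lt_trans hm.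
  exact: truncnS_gt.
case: (ex_minnP ex) => -[|m] tm mmin; first by move: tm; rewrite ltNge t0.
exists m; rewrite /is_njumps tm andbT leNgt; apply/negP => /mmin.
by rewrite ltnn.
Qed.

Lemma nonexplosive_rcll s w : nonexplosive s w ->
  (forall t, 0 <= t -> \forall u \near t^'+, traj s w u = traj s w t) /\
  (forall t, 0 < t -> exists a, \forall u \near t^'-, traj s w u = a).
Proof.
move=> ne; split => t t0.
  have [m hm] := nonexplosive_njumps ne t0.
  have /andP[h1 h2] := hm; near=> u.
  rewrite (trajectoryE dead q_gt0 hm) (@trajectoryE _ _ _ _ _ dead q_gt0 _ _ _ m)//.
  rewrite /is_njumps; apply/andP; split; first by apply: (le_trans h1); near: u; exact: nbhs_right_ge.
  by near: u; exact: nbhs_right_lt.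
have [m hm] := nonexplosive_njumps ne (ltW t0).
have /andP[] := hm; rewrite le_eqVlt => /predU1P[tE|lt1] h2.
  (* Here [t] is itself a jump time, and the left limit is the state before that jump. *)
  case: m hm tE h2 => [|m] hm tE h2; first by move: t0; rewrite -tE ltxx.
  exists (jump_state m s w); near=> u.
  apply: (trajectoryE dead q_gt0); rewrite /is_njumps tE; apply/andP; split.
    near: u; apply: nbhs_left_ge; rewrite -tE.
    exact: (jump_time_lt tgt q_gt0).
  by near: u; exact: nbhs_left_lt.
exists (jump_state m s w); near=> u.
apply: (trajectoryE dead q_gt0); rewrite /is_njumps; apply/andP; split.
  by near: u; exact: nbhs_left_ge.
by apply: lt_trans h2; near: u; exact: nbhs_left_lt.
Unshelve. all: by end_near. Qed.

Hypothesis nonexplosion : forall s, lam (~` nonexplosive s) = 0%E.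

Let mtraj s t (A : set St) : measurable [set w | A (traj s w t)].
Proof. exact: (measurable_trajectory tgt dead rate_ge0 q_gt0 (@measurable_id _ _ setT) (@measurable_cst _ _ _ _ _ t)). Qed.

Local Open Scope ereal_scope.

Lemma lam_eq_nonexplosive s (A B : set R) : measurable A -> measurable B ->
  (forall w, nonexplosive s w -> A w <-> B w) -> lam A = lam B.
Proof.
have mNE : measurable (nonexplosive s) by exact: measurable_nonexplosive.
have restrict C : measurable C -> lam C = lam (C `&` nonexplosive s).
  move=> mC; apply/le_anti/andP; split; last first.
    by apply: le_measure; rewrite ?inE//; exact: measurableI.
  rewrite -{1}[C](setUIDK _ (nonexplosive s)).
  apply: (le_trans (measureU2 _ _ _)); [exact: measurableI|exact: measurableD|].
  rewrite [X in _ + X](_ : _ = 0) ?adde0//.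
  apply: (@subset_measure0 _ _ _ lam _ (~` nonexplosive s)) => //; last exact: nonexplosion.
    exact: measurableD.
  exact: measurableC.
move=> mA mB AB; rewrite (restrict A)// (restrict B)//; congr (lam _); apply/seteqP.
by split => w [h1 h2]; split => //; apply/(AB w h2).
Qed.

(** Almost surely finitely many jumps occur before [t], so the identity for a fixed number of jumps
    is summed over that number. *)
Lemma markov_trajectory s t L a h b : (0 <= t)%R -> (0 <= h)%R ->
  (forall us, us \in L -> 0 <= us.1 <= t)%R ->
  let H := [set w | traj s w t = a /\ forall us, us \in L -> traj s w us.1 = us.2] in
  lam (H `&` [set w | traj s w (t + h)%R = b]) = lam H * (transition h a b)%:E.
Proof.
move=> t0 h0 Lt H; set F := [set w | _].
have mH : measurable H.
  apply: (measurableI [set w | traj s w t = a]); first exact: (mtraj s t (fun x => x = a)).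
  by apply: measurable_forall_in => us _; exact: (mtraj s us.1 (fun x => x = us.2)).
have mF : measurable F by exact: (mtraj s _ (fun x => x = b)).
have mh m : measurable (history m s t L a) by exact: measurable_history.
have mU : measurable (\bigcup_m history m s t L a) by exact: bigcupT_measurable.
have HU w : nonexplosive s w -> H w <-> (\bigcup_m history m s t L a) w.
  move=> ne; split; last by case=> m _ [].
  by case=> h1 h2; have [m hm] := nonexplosive_njumps ne t0; exists m.
rewrite (lam_eq_nonexplosive mH mU HU).
rewrite (@lam_eq_nonexplosive s _ (\bigcup_m history m s t L a `&` F)); last 3 first.
- exact: measurableI.
- exact: measurableI.
- by move=> w ne; split => -[/(HU w ne)].
rewrite setI_bigcupl.
have tr : trivIset setT (fun m => history m s t L a).
  by move=> i j _ _ [w [[hi _ _] [hj _ _]]]; exact: (is_njumps_inj q_gt0 hi hj).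
rewrite !measure_bigcup//=; last 2 first.
- by move=> k _; exact: measurableI.
- exact: trivIset_setIr.
rewrite muleC -nneseriesZl//.
apply: eq_eseriesr => m _; rewrite muleC; exact: markov_njumps.
Qed.

Definition jump_generator a b : R := (\sum_(i < n) rate a i * ((tgt a i == b)%:R - (a == b)%:R))%R.

Let E1 a h : (0 <= h)%R -> lam [set w | (hold a w <= h)%R] = (1 - expR (- (q a * h)))%:E.
Proof.
move=> h0.
have -> : [set w | (hold a w <= h)%R] = ~` [set w | (h < hold a w)%R].
  by apply/seteqP; split => w /=; rewrite leNgt => /negP.
rewrite probability_setC/=; first by rewrite [X in 1 - X](lam_hold_gt tgt dead rate_ge0 q_gt0).
by apply: measurable_lt_set => //; exact: measurable_hold.
Qed.

Let one_expR (x : R) : (0 <= x)%R -> (x - x ^+ 2 <= 1 - expR (- x) <= x)%R.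
Proof.
move=> x0; have h1 := expR_ge1Dx (- x); have h2 := expR_ge1Dx x.
have h3 : (expR (- x) * expR x = 1)%R by rewrite -expRD addNr expR0.
have h4 := expR_gt0 (- x).
by apply/andP; split; nra.
Qed.

(** Two jumps before [h] have probability of order [h ^+ 2]; with at most one, the state at [h]
    depends on the first mark and on whether the first clock has rung. In the constant, [Q * M]
    comes from the second jump and [Q ^+ 2] from replacing [1 - expR (- (Q * h))] by [Q * h]. *)
Lemma transition_derivative a b : exists M : R, forall h, (0 < h)%R ->
  (`|transition h a b - (a == b)%:R - h * jump_generator a b| <= M * h ^+ 2)%R.
Proof.
pose Q := q a; have Q0 : (0 < Q)%R := q_gt0 a.
pose M := (\sum_(i < n) q (tgt a i))%R.
have M0 : (0 <= M)%R by apply: sumr_ge0 => i _; exact: ltW.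
exists (Q * M + Q ^+ 2)%R => h h0.
have h0' := ltW h0.
pose X := [set w | traj a w h = b].
(* [Y] is what [X] would be if at most one jump could occur before [h]; [Z], two short holding times
   in a row, contains every path on which the two differ. *)
pose Y := [set w | if (h < hold a w)%R then a = b else next_state a w = b].
pose Z := [set w | (hold a w <= h)%R /\ (hold (next_state a w) (rest w) <= h)%R].
have mX : measurable X by exact: (mtraj a h (fun x => x = b)).
have m1 : measurable [set w | (h < hold a w)%R].
  by apply: measurable_lt_set => //; exact: measurable_hold.
have mn : measurable [set w | next_state a w = b].
  rewrite (_ : mkset _ = [set w | jump_state 1 a w = b])//.
  exact: (measurable_jump_state tgt rate_ge0 q_gt0).
have mY : measurable Y.
  rewrite (_ : Y = ([set w | (h < hold a w)%R] `&` [set _ | a = b]) `|`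
     (~` [set w | (h < hold a w)%R] `&` [set w | next_state a w = b])).
    apply: measurableU; apply: measurableI => //.
      exact: measurable_cst_prop.
    exact: measurableC.
  apply/seteqP; split => w; rewrite /Y /=.
    by case: ifPn => h' e; [left|right; split => //; exact/negP].
  by case=> [[-> //]|[/negP/negbTE -> //]].
have mle c : measurable [set w | (hold c w <= h)%R].
  by apply: measurable_le_set => //; exact: measurable_hold.
pose C i : set (R * R) := [set z | (z.1 / Q <= h)%R /\ (hold (tgt a i) z.2 <= h)%R].
have mf1 : measurable_fun setT (@fst R R) by exact: measurable_fst.
have mf2 : measurable_fun setT (@snd R R) by exact: measurable_snd.
have mC i : measurable (C i).
  rewrite (_ : C i = (fst @^-1` `]-oo, (h * Q)%R]%classic) `&` (snd @^-1` [set w | (hold (tgt a i) w <= h)%R])).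
    apply: measurableI.
      by apply: (measurable_preimage mf1); exact: measurable_itv.
    by apply: (measurable_preimage mf2); exact: mle.
  by apply/seteqP; split => z [h1 h2]; split => //; move: h1; rewrite /preimage/= in_itv/= ler_pdivrMr.
have mZ : measurable Z.
  rewrite (_ : Z = \bigcup_i (mark a @^-1` [set i] `&`
    (fun w => (clock w, rest w)) @^-1` C i)).
    apply: bigcupT_measurable => i; apply: measurableI; first exact: measurable_mark.
    apply: measurable_preimage => //.
    by apply: measurable_fun_pair; [exact: measurable_clock|exact: measurable_rest].
  by apply/seteqP; split => [w /= hw|w [i _ [/= <-]]//]; exists (mark a w).
have lamZ : lam Z <= (Q * M * h ^+ 2)%:E.
  rewrite [Z](_ : _ = [set w | C (mark a w) (clock w, rest w)])//.
  rewrite (lam_first_jump rate_ge0 q_gt0)//.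
  apply: (@le_trans _ _ (\sum_(i < n) (Q * h * (q (tgt a i) * h))%:E)); last first.
    by rewrite sumEFin lee_fin -mulr_sumr -mulr_suml -/M expr2; rewrite le_eqVlt; apply/orP; left; apply/eqP; ring.
  apply: lee_sum => i _.
  have pi1 : (rate a i / total_rate n rate a <= 1)%R.
    rewrite ler_pdivrMr// mul1r /total_rate /partial_sum (bigD1 i)//= lerDl.
    exact: sumr_ge0.
  have pi0 : (0 <= rate a i / total_rate n rate a)%R by rewrite divr_ge0// ltW.
  have inner x : lam [set w | C i (exp_time x, w)] =
      (\1_[set x | (exp_time x <= h * Q)%R] x)%:E * (1 - expR (- (q (tgt a i) * h)))%:E.
    have [hx|hx] := pselect (exp_time x <= h * Q)%R.
      rewrite indicE mem_set// mul1e -E1//; congr (lam _).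
      apply/seteqP; split => w; first by case.
      by move=> hw; split => //=; rewrite ler_pdivrMr.
    rewrite indicE memNset// mul0e (_ : mkset _ = set0) ?measure0// -subset0 => w [h1 _].
    by apply: hx; move: h1; rewrite /= ler_pdivrMr.
  under eq_integral do rewrite inner.
  have mI : measurable [set x : R | (exp_time x <= h * Q)%R].
    by apply: measurable_le_set => //; exact: measurable_exp_time.
  have e0 y : (0 <= y)%R -> (0 <= 1 - expR (- y))%R.
    by move=> y0; rewrite subr_ge0 -expR0 ler_expR; lra.
  have qh0 c : (0 <= q c * h)%R by rewrite mulr_ge0// ltW.
  rewrite ge0_integralZr//; last 2 first.
  - by apply/measurable_EFinP/measurable_indic.
  - by rewrite lee_fin e0.
  have hQ0 : (0 <= h * Q)%R by rewrite mulr_ge0// ltW.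
  rewrite integral_indic// setIT [X in _ * (X * _)](lam_exp_time_le hQ0) -!EFinM lee_fin.
  rewrite -[leRHS]mul1r; apply: ler_pM => //.
    by rewrite mulr_ge0// e0// mulr_ge0// ltW.
  rewrite [(h * Q)%R]mulrC; apply: ler_pM; rewrite ?e0//; try exact: qh0.
    by have /andP[] := one_expR (qh0 a).
  by have /andP[] := one_expR (qh0 (tgt a i)).
have XYZ : (X `\` Y) `|` (Y `\` X) `<=` Z.
  have XY w : ~ Z w -> X w <-> Y w.
    rewrite /Z /X /Y /= => nZ; case: ifPn => hw.
      by rewrite (trajectory_before tgt dead q_gt0) ?h0'.
    rewrite -leNgt in hw.
    rewrite (trajectory_after tgt dead q_gt0)// (trajectory_before tgt dead q_gt0)//.
    rewrite subr_ge0 hw/= ltNge; apply/negP => hh; apply: nZ; split => //.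
    by apply: (le_trans hh); rewrite gerBl// ltW// hold_gt0.
  move=> w XYw; apply: contrapT => /XY e; move: XYw.
  by rewrite /= e; tauto.
have dist : (`|fine (lam X) - fine (lam Y)| <= Q * M * h ^+ 2)%R.
  have fX : lam X \is a fin_num by rewrite fin_num_measure.
  have fY : lam Y \is a fin_num by rewrite fin_num_measure.
  have half A B : measurable A -> measurable B -> A `\` B `<=` Z ->
      lam A \is a fin_num -> lam B \is a fin_num -> (fine (lam A) <= fine (lam B) + Q * M * h ^+ 2)%R.
    move=> mA mB AB fA fB; rewrite -lee_fin EFinD !fineK//.
    apply: (@le_trans _ _ (lam B + lam Z)); last by rewrite leeD2l.
    apply: (@le_trans _ _ (lam (B `|` Z))); last exact: measureU2.
    apply: le_measure; rewrite ?inE//; first exact: measurableU.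
    by move=> w Aw; have [Bw|Bw] := pselect (B w); [left|right; apply: AB].
  have := half X Y mX mY (fun w hw => XYZ w (or_introl hw)) fX fY.
  have := half Y X mY mX (fun w hw => XYZ w (or_intror hw)) fY fX.
  by rewrite ler_norml; lra.
(* The probability that the first jump leads to [b]. *)
pose G1 := (\sum_(i < n) rate a i / Q * (tgt a i == b)%:R)%R.
have sum_p : (\sum_(i < n) rate a i / Q = 1)%R.
  by rewrite -mulr_suml -/(partial_sum (rate a) n) divff// gt_eqF.
have p0 i : (0 <= rate a i / Q)%R by rewrite divr_ge0// ltW.
have G1_itv : (0 <= G1 <= 1)%R.
  rewrite sumr_ge0/=; last by move=> i _; rewrite mulr_ge0.
  rewrite -sum_p; apply: ler_sum => i _.
  by case: (tgt a i == b); rewrite ?mulr1 ?mulr0.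
have GE : jump_generator a b = (Q * (G1 - (a == b)%:R))%R.
  rewrite mulrBr /G1 mulr_sumr -[X in (_ - X * _)%R]/(\sum_(i < n) rate a i)%R.
  rewrite mulr_suml -sumrB; apply: eq_bigr => i _.
  by rewrite mulrA mulrCA divff ?gt_eqF// mulr1 -mulrBr.
have lamN : lam [set w | next_state a w = b] = G1%:E.
  rewrite (_ : mkset _ = [set w | [set _ : R * R | tgt a (mark a w) = b] (clock w, rest w)])//.
  rewrite (lam_first_jump rate_ge0 q_gt0 a (C := fun i => [set _ | tgt a i = b])); last first.
    by move=> i; exact: measurable_cst_prop.
  rewrite /G1 -sumEFin; apply: eq_bigr => i _; rewrite [RHS]EFinM; congr (_ * _).
  rewrite /mkset; under eq_integral.
    move=> x _.
    rewrite (_ : lam _ = (tgt a i == b)%:R%:E); first over.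
    have [e|/eqP ne] := eqVneq (tgt a i) b.
      by rewrite (_ : (fun _ => _) = setT) ?probability_setT//; apply/seteqP; split.
    by rewrite (_ : (fun _ => _) = set0) ?measure0//; apply/seteqP; split.
  by rewrite /= integral_cst// [X in _ * X](probability_setT lam) mule1.
have lamNH : lam [set w | (h < hold a w)%R /\ next_state a w = b] = (expR (- (Q * h)) * G1)%:E.
  rewrite EFinM -lamN.
  have := lam_hold_memoryless tgt dead rate_ge0 q_gt0 a h0'
    (fun i => measurable_cst_prop _ (tgt a i = b)).
  by move=> <-.
have lamY : fine (lam Y) = (expR (- (Q * h)) * (a == b)%:R + (1 - expR (- (Q * h))) * G1)%R.
  have -> : Y = ([set w | (h < hold a w)%R] `&` [set _ | a = b]) `|`
     ([set w | next_state a w = b] `\` [set w | (h < hold a w)%R]).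
    apply/seteqP; split => w; rewrite /Y /=.
      by case: ifPn => hh e; [left|right; split => //; exact/negP].
    by case=> [[-> //]|[+ /negP/negbTE -> //]].
  rewrite measureU//=; last 3 first.
  - by apply: measurableI => //; exact: measurable_cst_prop.
  - exact: measurableD.
  - by rewrite -subset0 => w [[? _] [_]].
  rewrite measureD//=; last by rewrite lamN ltry.
  rewrite [X in _ + (_ - lam X)](_ : _ = [set w | (h < hold a w)%R /\ next_state a w = b]); last first.
    by apply/seteqP; split => w /= [].
  rewrite lamN lamNH.
  have [e|/eqP ne] := eqVneq a b.
    rewrite (_ : _ `&` _ = [set w | (h < hold a w)%R]); last first.
      by apply/seteqP; split => w /=; [case|split].
    by rewrite (lam_hold_gt tgt dead rate_ge0 q_gt0)//= -/Q; ring.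
  rewrite (_ : _ `&` _ = set0); last by rewrite -subset0 => w [].
  by rewrite measure0/=; ring.
have qh0 : (0 <= Q * h)%R by rewrite mulr_ge0// ltW.
have /andP[h1 h2] := one_expR qh0.
have ab01 : (0 <= ((a == b)%:R : R) <= 1)%R by case: (a == b); rewrite lexx ler01.
rewrite /transition -/X GE.
have : (`|fine (lam Y) - (a == b)%:R - h * (Q * (G1 - (a == b)%:R))| <= Q ^+ 2 * h ^+ 2)%R.
  rewrite lamY -exprMn.
  rewrite [X in `|X|%R](_ : _ = (- ((Q * h - (1 - expR (- (Q * h)))) * (G1 - (a == b)%:R))))%R; last ring.
  rewrite normrN normrM -[leRHS]mulr1; apply: ler_pM => //.
    by rewrite ger0_norm; lra.
  by rewrite ler_norml; lra.
move: dist; rewrite !ler_norml; lra.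
Qed.

End markov_limit.

(** * Exponential bounds *)

Section exponential_bounds.
Context {R : realType} {St : countType}.
Variables (n : nat) (rate : St -> nat -> R) (tgt : St -> nat -> St).
Hypothesis rate_ge0 : forall s i, 0 <= rate s i.
Local Notation q := (total_rate n rate).
Hypothesis q_gt0 : forall s, 0 < q s.
Local Notation mark := (mark n rate).
Local Notation hold := (hold n rate).
Local Notation next_state := (next_state n rate tgt).
Local Notation jump_time := (jump_time n rate tgt).
Local Notation jump_state := (jump_state n rate tgt).
Implicit Types (s a b : St) (w t u h x : R) (m k i : nat).

Lemma exp_markov (X : R -> R) x : measurable_fun setT X ->
  (lam [set w | (x <= X w)%R] <= (expR (- x))%:E * \int[lam]_w (expR (X w))%:E)%E.
Proof.
move=> mX.
have mA : measurable [set w | x <= X w].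
  by apply: measurable_le_set.
have me : measurable_fun setT (fun w => (expR (X w))%:E).
  by apply/measurable_EFinP; exact: measurableT_comp.
rewrite -ge0_integralZl//.
rewrite -[X in lam X]setIT -integral_indic//.
apply: ge0_le_integral => //.
- by apply/measurable_EFinP/measurable_indic.
- exact: measurable_funeM.
- move=> w _; rewrite -EFinM lee_fin indicE -expRD.
  have [h|h] := pselect (x <= X w); last by rewrite memNset// expR_ge0.
  by rewrite mem_set// -[leLHS]expR0 ler_expR addrC subr_ge0.
Qed.

Section product_functional.
Variables (G : St -> nat -> R -> R).
Hypothesis mG : forall s i, measurable_fun setT (G s i).
Hypothesis G_ge0 : forall s i e, 0 <= G s i e.

(** Exponentials of the noise and of the jump times are both of this form. *)
Fixpoint product_functional m s w : R :=
  if m is m'.+1 then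
    G s (mark s w) (clock w) * product_functional m' (next_state s w) (rest w)
  else 1.

Lemma product_functional_ge0 m s w : 0 <= product_functional m s w.
Proof. by elim: m s w => [//|m IH] s w /=; rewrite mulr_ge0. Qed.

Lemma measurable_product_functional m s : measurable_fun setT (product_functional m s).
Proof.
elim: m s => [|m IH] s /=; first exact: measurable_cst.
apply: (measurable_fun_select (k := mark s)
  (g := fun i w => G s i (clock w) * product_functional m (tgt s i) (rest w))) => i.
  exact: measurable_mark.
apply: measurable_funM.
  exact: (measurableT_comp (mG s i) measurable_clock).
exact: (measurableT_comp (IH (tgt s i)) measurable_rest).
Qed.

(** Here [f] is a supersolution of the one-step recursion, so an inequality about a single jump
    bounds the whole product. The clock is independent of what follows, hence its integral factors
    out. *)
Lemma integral_product_functional (f : nat -> St -> R) :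
  (forall s, 1 <= f 0 s) -> (forall m s, 0 <= f m s) ->
  (forall m s, (\sum_(i < n) (rate s i / q s * f m (tgt s i))%:E *
      \int[lam]_x (G s i (exp_time x))%:E <= (f m.+1 s)%:E)%E) ->
  forall m s, (\int[lam]_w (product_functional m s w)%:E <= (f m s)%:E)%E.
Proof.
move=> f1 f0 fS; elim => [|m IH] s /=.
  by rewrite integral_cst// [X in (_ * X)%E](probability_setT lam) mule1 lee_fin.
apply: le_trans (fS m s).
rewrite (integral_first_jump rate_ge0 q_gt0 s
  (F := fun i z => (G s i z.1 * product_functional m (tgt s i) z.2)%:E)); last 2 first.
- move=> i; apply/measurable_EFinP; apply: measurable_funM.
    by apply: (measurableT_comp (mG s i)); exact: measurable_fst.
  by apply: (measurableT_comp (measurable_product_functional m (tgt s i))); exact: measurable_snd.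
- by move=> i z; rewrite lee_fin mulr_ge0// product_functional_ge0.
apply: lee_sum => i _; rewrite [in leRHS]EFinM -muleA; apply: lee_wpmul2l.
  by rewrite lee_fin divr_ge0// ltW.
have mP : measurable_fun setT (fun w => (product_functional m (tgt s i) w)%:E).
  by apply/measurable_EFinP; exact: measurable_product_functional.
have mGx : measurable_fun setT (fun x => (G s i (exp_time x))%:E).
  by apply/measurable_EFinP; apply: (measurableT_comp (mG s i)); exact: measurable_exp_time.
rewrite (eq_integral (fun x => (G s i (exp_time x))%:E *
    \int[lam]_w (product_functional m (tgt s i) w)%:E)%E); last first.
  move=> x _ /=; under eq_integral do rewrite EFinM.
  rewrite ge0_integralZl//.
  by move=> w _; rewrite lee_fin product_functional_ge0.
  by rewrite lee_fin; exact: G_ge0.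
rewrite ge0_integralZr//; last 2 first.
- by move=> x _; rewrite lee_fin.
- by apply: integral_ge0 => w _; rewrite lee_fin product_functional_ge0.
by rewrite muleC; apply: lee_wpmul2r => //; apply: integral_ge0 => x _; rewrite lee_fin.
Qed.

End product_functional.

(** * Exponential moments of the compensated marks *)

Section noise.
Variable c : St -> nat -> R.
Hypothesis c_le1 : forall s i, `|c s i| <= 1.

Definition mean_mark s := \sum_(i < n) rate s i / q s * c s i.

(** The clock has mean 1, so each increment is centred. As the clock is the total rate times the
    holding time, the subtracted terms add up to the integral of the drift between jump times. *)
Fixpoint noise m s w : R :=
  if m is m'.+1 then
    c s (mark s w) - mean_mark s * clock w + noise m' (next_state s w) (rest w)
  else 0.

Lemma noiseS m s w : noise m.+1 s w = noise m s w +
  (c (jump_state m s w) (mark (jump_state m s w) (iter m rest w))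
   - mean_mark (jump_state m s w) * clock (iter m rest w)).
Proof.
elim: m s w => [|m IH] s w; first by rewrite /= addr0 add0r.
rewrite -[LHS]/(c s (mark s w) - mean_mark s * clock w + noise m.+1 (next_state s w) (rest w)).
by rewrite IH addrA iterSr.
Qed.

Lemma sum_probabilities s : \sum_(i < n) rate s i / q s = 1.
Proof. by rewrite -mulr_suml -/(partial_sum (rate s) n) -/(total_rate n rate s) divff// gt_eqF. Qed.

Lemma mean_mark_le1 s : `|mean_mark s| <= 1.
Proof.
apply: (le_trans (ler_norm_sum _ _ _)); rewrite -(sum_probabilities s).
apply: ler_sum => i _; rewrite normrM ger0_norm ?divr_ge0// ?(ltW (q_gt0 s))//.
by rewrite ler_piMr// divr_ge0// ltW.
Qed.

Lemma measurable_noise m s : measurable_fun setT (noise m s).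
Proof.
elim: m s => [|m IH] s /=; first exact: measurable_cst.
apply: measurable_funD; last first.
  apply: (measurable_fun_select (k := mark s)
    (g := fun i w => noise m (tgt s i) (rest w))) => i; first exact: measurable_mark.
  exact: (measurableT_comp (IH (tgt s i)) measurable_rest).
apply: measurable_funB; last by apply: measurable_funM => //; exact: measurable_clock.
by apply: (measurable_fun_select (k := mark s) (g := fun i _ => c s i)) => i //;
  exact: measurable_mark.
Qed.

(** Both sides are compared after multiplication by [1 - x]: [expR (- x) >= 1 - x] bounds the left
    one by 1, and the right one is [1 + x ^+ 2 * (1 - 2 * x)]. *)
Lemma expR_le_quadratic x : x <= 2^-1 -> expR x <= 1 + x + 2 * x ^+ 2.
Proof.
move=> x2; have h1 := expR_ge1Dx (- x).
have h3 : expR (- x) * expR x = 1 by rewrite -expRD addNr expR0.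
have h4 := expR_gt0 x.
have h5 : (1 - x) * expR x <= 1 by nra.
have h6 : 1 <= (1 - x) * (1 + x + 2 * x ^+ 2).
  have -> : (1 - x) * (1 + x + 2 * x ^+ 2) = 1 + x ^+ 2 * (1 - 2 * x) by ring.
  by rewrite lerDl mulr_ge0 ?sqr_ge0//; lra.
rewrite -(@ler_pM2l _ (1 - x)); lra.
Qed.

Lemma invr_le_exp x : - 2^-1 <= x -> (1 + x)^-1 <= expR (- x + 2 * x ^+ 2).
Proof.
move=> x2; apply: (@le_trans _ _ (1 + (- x + 2 * x ^+ 2))); last exact: expR_ge1Dx.
have x1 : 0 < 1 + x by lra.
rewrite -[leLHS]mul1r ler_pdivrMr//.
have -> : (1 + (- x + 2 * x ^+ 2)) * (1 + x) = 1 + x ^+ 2 * (1 + 2 * x) by ring.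
by rewrite lerDl mulr_ge0 ?sqr_ge0//; lra.
Qed.

(** Each jump contributes a factor at most [expR (4 * th ^+ 2)]. With [x = th * mean_mark s] the
    mark gives at most [expR (x + 2 * th ^+ 2)] and the clock at most [expR (- x + 2 * x ^+ 2)]; the
    linear terms cancel and [x ^+ 2 <= th ^+ 2]. *)
Lemma integral_exp_noise (th : R) m s : `|th| <= 2^-1 ->
  (\int[lam]_w (expR (th * noise m s w))%:E <= (expR (4 * th ^+ 2 * m%:R))%:E)%E.
Proof.
move=> th2.
pose G s i e := expR (th * (c s i - mean_mark s * e)).
have mG s' i : measurable_fun setT (G s' i).
  apply: measurableT_comp => //; apply: measurable_funM => //.
  by apply: measurable_funB => //; exact: measurable_funM.
have G0 s' i e : 0 <= G s' i e by exact: expR_ge0.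
have E w : expR (th * noise m s w) = product_functional G m s w.
  elim: m s w => [|m IH] s w /=; first by rewrite mulr0 expR0.
  by rewrite mulrDr expRD IH.
under eq_integral do rewrite E.
apply: (integral_product_functional mG G0 (f := fun m _ => expR (4 * th ^+ 2 * m%:R))).
- by move=> _; rewrite mulr0 expR0.
- by move=> ? ?; exact: expR_ge0.
move=> {m s E} m s.
pose x := th * mean_mark s.
have x2 : `|x| <= 2^-1.
  by rewrite normrM -[leRHS]mulr1; apply: ler_pM => //; exact: mean_mark_le1.
have x_itv : - 2^-1 <= x <= 2^-1 by rewrite -ler_norml.
have int1 i : (\int[lam]_y (G s i (exp_time y))%:E <=
    (expR (th * c s i) * expR (- x + 2 * x ^+ 2))%:E)%E.
  under eq_integral.
    move=> y _; rewrite /G mulrBr expRD EFinM mulrA -/x; over.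
  rewrite /= ge0_integralZl//; last first.
    apply/measurable_EFinP; apply: measurableT_comp => //; apply: measurableT_comp => //.
    by apply: measurable_funM => //; exact: measurable_exp_time.
  rewrite EFinM; apply: lee_wpmul2l; first by rewrite lee_fin expR_ge0.
  apply: (le_trans (integral_exp_time_laplace _)); first by lra.
  by rewrite lee_fin invr_le_exp//; lra.
apply: (@le_trans _ _ (\sum_(i < n) (rate s i / q s * expR (4 * th ^+ 2 * m%:R))%:E *
    (expR (th * c s i) * expR (- x + 2 * x ^+ 2))%:E)%E).
  apply: lee_sum => i _; apply: lee_wpmul2l => //.
  by rewrite lee_fin mulr_ge0 ?expR_ge0// divr_ge0// ltW.
under eq_bigr do rewrite -EFinM.
rewrite sumEFin lee_fin.
have -> : \sum_(i < n) rate s i / q s * expR (4 * th ^+ 2 * m%:R) *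
    (expR (th * c s i) * expR (- x + 2 * x ^+ 2)) =
    (\sum_(i < n) rate s i / q s * expR (th * c s i)) *
    (expR (4 * th ^+ 2 * m%:R) * expR (- x + 2 * x ^+ 2)).
  by rewrite mulr_suml; apply: eq_bigr => i _; ring.
have h1 : \sum_(i < n) rate s i / q s * expR (th * c s i) <= expR (x + 2 * th ^+ 2).
  apply: (@le_trans _ _ (1 + (x + 2 * th ^+ 2))); last exact: expR_ge1Dx.
  rewrite -{1}(sum_probabilities s) /x /mean_mark mulr_sumr.
  rewrite -[X in _ + (_ + X)]mul1r -{1}(sum_probabilities s) mulr_suml -!big_split/=.
  apply: ler_sum => i _.
  have pi0 : 0 <= rate s i / q s by rewrite divr_ge0// ltW.
  have c1 : -1 <= c s i <= 1 by rewrite -ler_norml.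
  have tc : `|th * c s i| <= 2^-1.
    by rewrite normrM -[leRHS]mulr1; apply: ler_pM.
  have tc2 : (th * c s i) ^+ 2 <= th ^+ 2.
    rewrite exprMn ler_piMr ?sqr_ge0//.
    by rewrite -[c s i ^+ 2]real_normK ?num_real// expr_le1.
  apply: (@le_trans _ _ (rate s i / q s * (1 + th * c s i + 2 * (th * c s i) ^+ 2))).
    apply: ler_wpM2l => //; apply: expR_le_quadratic.
    by apply: le_trans tc; exact: ler_norm.
  apply: (@le_trans _ _ (rate s i / q s * (1 + th * c s i + 2 * th ^+ 2))).
    by apply: ler_wpM2l => //; rewrite lerD2l ler_pM2l.
  by rewrite le_eqVlt; apply/orP; left; apply/eqP; ring.
apply: (@le_trans _ _ (expR (x + 2 * th ^+ 2) * (expR (4 * th ^+ 2 * m%:R) * expR (- x + 2 * x ^+ 2)))).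
  by apply: ler_wpM2r => //; rewrite mulr_ge0 ?expR_ge0.
rewrite -!expRD ler_expR -[m.+1]addn1 natrD.
have : x ^+ 2 <= th ^+ 2.
  rewrite /x exprMn ler_piMr ?sqr_ge0//.
  rewrite -[mean_mark s ^+ 2]real_normK ?num_real// expr_le1//.
  exact: mean_mark_le1.
lra.
Qed.

Lemma noise_tail (th : R) m s x : 0 < th <= 2^-1 ->
  (lam [set w | (x <= `|noise m s w|)%R] <=
    (2 * expR (4 * th ^+ 2 * m%:R - th * x))%:E)%E.
Proof.
move=> /andP[th0 th2].
have mN (e : R) : measurable_fun setT (fun w => e * noise m s w).
  by apply: measurable_funM => //; exact: measurable_noise.
have one (e : R) : `|e| = th ->
    (lam [set w | (th * x <= e * noise m s w)%R] <= (expR (4 * th ^+ 2 * m%:R - th * x))%:E)%E.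
  move=> e_th; apply: (le_trans (exp_markov _ (mN e))).
  rewrite addrC expRD EFinM; apply: lee_wpmul2l; first by rewrite lee_fin expR_ge0.
  by rewrite -e_th real_normK ?num_real//; apply: integral_exp_noise; rewrite e_th.
have mS e : measurable [set w | (th * x <= e * noise m s w)%R].
  by apply: measurable_le_set.
apply: (@le_trans _ _ (lam ([set w | (th * x <= th * noise m s w)%R] `|`
    [set w | (th * x <= (- th) * noise m s w)%R]))).
  apply: le_measure; rewrite ?inE.
  - apply: measurable_le_set => //.
      by apply: measurableT_comp => //; exact: measurable_noise.
  - exact: measurableU.
  - move=> w /=; rewrite mulNr -mulrN !ler_pM2l//.
    by rewrite ler_normr => /orP.
apply: (le_trans (measureU2 _ _ _)) => //.
by rewrite mulrDl mul1r EFinD; apply: leeD; apply: one; rewrite ?normrN gtr0_norm.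
Qed.

End noise.

End exponential_bounds.

(** * Comparison of the jump times with a pure birth chain *)

Section jump_time_bounds.
Context {R : realType} {St : countType}.
Variables (n : nat) (rate : St -> nat -> R) (tgt : St -> nat -> St).
Hypothesis rate_ge0 : forall s i, 0 <= rate s i.
Local Notation q := (total_rate n rate).
Hypothesis q_gt0 : forall s, 0 < q s.
Local Notation mark := (mark n rate).
Local Notation hold := (hold n rate).
Local Notation next_state := (next_state n rate tgt).
Local Notation jump_time := (jump_time n rate tgt).
Local Notation jump_state := (jump_state n rate tgt).
Implicit Types (s a b : St) (w t u h x : R) (m k i L : nat).

Variables (C : R) (size : St -> R).
Hypothesis C_gt0 : 0 < C.
Hypothesis size_gt0 : forall s, 0 < size s.
Hypothesis rate_size : forall s, q s <= C * size s.
Hypothesis size_tgt : forall s i, size (tgt s i) <= size s + 1.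

(** This is also the product over [k < m] of [(x + k) / (x + k + L)], the Laplace transform at
    [C * L] of the [m]-th jump time of a chain with successive rates [C * (x + k)]. Written with [L]
    factors, it shows its decay in [m]. *)
Let g L m x := \prod_(j < L) ((x + j%:R) / (x + j%:R + m%:R)).

Let den_gt0 x j m : 0 < x -> 0 < x + j%:R + m%:R.
Proof. by move=> x0; rewrite -addrA ltr_wpDr// addr_ge0. Qed.

Let g_ge0 L m x : 0 < x -> 0 <= g L m x.
Proof.
move=> x0; apply: prodr_ge0 => j _.
by rewrite divr_ge0 ?(ltW (den_gt0 _ _ x0))// addr_ge0// ltW.
Qed.

Let ratio_le x y (m : R) : 0 < x -> x <= y -> 0 <= m -> x / (x + m) <= y / (y + m).
Proof.
move=> x0 xy m0; have y0 := lt_le_trans x0 xy.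
rewrite ler_pdivrMr ?ltr_wpDr// mulrAC ler_pdivlMr ?ltr_wpDr//.
by rewrite !mulrDr [y * x]mulrC lerD2l mulrC [y * m]mulrC; apply: ler_wpM2l.
Qed.

Let g_le L m x y : 0 < x -> x <= y -> g L m x <= g L m y.
Proof.
move=> x0 xy; apply: ler_prod => j _; rewrite divr_ge0/= ?(ltW (den_gt0 _ _ x0))//; last first.
  by rewrite addr_ge0// ltW.
by apply: ratio_le => //; [rewrite ltr_wpDr|rewrite lerD2r].
Qed.

(* Telescoping: shifting [x] by one trades the factor [x / (x + L)] for one more jump. *)
Let g_shift L m x : 0 < x -> x / (x + L%:R) * g L m (x + 1) = g L m.+1 x.
Proof.
move=> x0; rewrite /g.
have n0 (k : nat) : x + k%:R != 0 by rewrite gt_eqF// ltr_wpDr.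
have n1 (k k' : nat) : x + k%:R + k'%:R != 0 by rewrite -addrA -natrD.
elim: L => [|L IH]; first by rewrite !big_ord0 addr0 mulr1 divff// gt_eqF.
rewrite !big_ord_recr/= -IH.
have -> : x + 1 + L%:R = x + L.+1%:R by rewrite -natr1; ring.
have -> : x + L%:R + m.+1%:R = x + L.+1%:R + m%:R by rewrite -!natr1; ring.
by field; rewrite -[1]/(1%:R) -natrD n0 n1 n0.
Qed.

(** Among chains with rates at most [C * size] whose size gains at most 1 per jump, the birth chain
    jumps fastest. Accordingly [g] is monotone in [x] and solves the one-step equation exactly, so
    it is a supersolution here. *)
Lemma laplace_jump_time L m s :
  (\int[lam]_w (expR (- (C * L%:R * jump_time m s w)))%:E <= (g L m (size s))%:E)%E.
Proof.
pose G s (i : nat) e := expR (- (C * L%:R * (e / q s))).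
have mG s' i : measurable_fun setT (G s' i).
  apply: measurableT_comp => //; apply: measurableT_comp => //.
  by apply: measurable_funM => //; exact: measurable_funM.
have G0 s' i e : 0 <= G s' i e by exact: expR_ge0.
have E w : expR (- (C * L%:R * jump_time m s w)) = product_functional n rate tgt G m s w.
  elim: m s w => [|m IH] s w /=; first by rewrite mulr0 oppr0 expR0.
  by rewrite mulrDr opprD expRD IH.
under eq_integral do rewrite E.
apply: (integral_product_functional rate_ge0 q_gt0 mG G0 (f := fun m s => g L m (size s))).
- move=> s'; rewrite /g big1// => j _; rewrite addr0 divff// gt_eqF//.
  by rewrite ltr_wpDr.
- by move=> m' s'; exact: g_ge0.
move=> {m s E} m s.
have th0 : 0 <= C * L%:R by rewrite mulr_ge0// ltW.
have th1 : (-1 < C * L%:R / q s) by apply: (@lt_le_trans _ _ 0); rewrite ?divr_ge0// ?ltrN10// ltW.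
have int1 i : (\int[lam]_y (G s i (exp_time y))%:E <= (size s / (size s + L%:R))%:E)%E.
  rewrite (eq_integral (fun y => (expR (- (C * L%:R / q s * exp_time y)))%:E)); last first.
    by move=> y _; rewrite /G [exp_time y / _]mulrC mulrA.
  apply: (le_trans (integral_exp_time_laplace th1)); rewrite lee_fin.
  have -> : (1 + C * L%:R / q s)^-1 = q s / (q s + C * L%:R).
    by field; rewrite ?gt_eqF// ?ltr_wpDr.
  apply: (@le_trans _ _ (C * size s / (C * size s + C * L%:R))).
    exact: ratio_le.
  rewrite -mulrDr -mulf_div divff ?mul1r// ?gt_eqF//.
apply: (@le_trans _ _ (\sum_(i < n) (rate s i / q s * g L m (size s + 1))%:E *
   (size s / (size s + L%:R))%:E)%E).
  apply: lee_sum => i _; apply: lee_pmul => //.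
  - by rewrite lee_fin mulr_ge0 ?g_ge0// divr_ge0// ltW.
  - by apply: integral_ge0 => y _; rewrite lee_fin.
  - rewrite lee_fin; apply: ler_wpM2l; first by rewrite divr_ge0// ltW.
    exact: g_le.
under eq_bigr do rewrite -EFinM.
rewrite sumEFin lee_fin -mulr_suml -mulr_suml (sum_probabilities q_gt0) mul1r.
by rewrite mulrC g_shift.
Qed.

(** The Chernoff bound at parameter [C * L]; each of the [L] factors of [g] is then bounded by the
    value it would have at [j = L]. *)
Lemma jump_time_tail L m s t :
  (lam [set w | (jump_time m s w <= t)%R] <=
   (expR (C * L%:R * t) * ((size s + L%:R) / (size s + L%:R + m%:R)) ^+ L)%:E)%E.
Proof.
have th0 : 0 <= C * L%:R by rewrite mulr_ge0// ltW.
have mJ : measurable_fun setT (jump_time m s) by exact: measurable_jump_time.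
have mX : measurable_fun setT (fun w => - (C * L%:R * jump_time m s w)).
  by apply: measurableT_comp => //; exact: measurable_funM.
apply: (@le_trans _ _ (lam [set w | (- (C * L%:R * t) <= - (C * L%:R * jump_time m s w))%R])).
  apply: le_measure; rewrite ?inE.
  - by apply: measurable_le_set.
  - by apply: measurable_le_set.
  - by move=> w /= wt; rewrite lerN2; exact: ler_wpM2l.
apply: (le_trans (exp_markov _ mX)); rewrite opprK EFinM.
apply: lee_wpmul2l; first by rewrite lee_fin expR_ge0.
apply: (le_trans (laplace_jump_time _ _ _)); rewrite lee_fin.
rewrite -[L in leRHS]card_ord -prodr_const; apply: ler_prod => j _.
rewrite divr_ge0/= ?(ltW (den_gt0 _ _ _))//; last by rewrite addr_ge0// ltW.
apply: ratio_le => //; first by rewrite ltr_wpDr.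
by rewrite lerD2l ler_nat card_ord ltnW.
Qed.

(** For fixed time, the tail bound with [L = 1] already tends to 0 as the number of jumps grows. *)
Lemma lam_nonexplosive s : lam (~` nonexplosive n rate tgt s) = 0%E.
Proof.
have mJ m : measurable_fun setT (jump_time m s) by exact: measurable_jump_time.
pose B k := [set w | forall m, jump_time m s w <= k%:R].
have mle m (t : R) : measurable [set w | jump_time m s w <= t].
  by apply: measurable_le_set.
have mB k : measurable (B k).
  rewrite (_ : B k = \bigcap_m [set w | jump_time m s w <= k%:R]).
    exact: bigcapT_measurable.
  by apply/seteqP; split => w h m; [move=> _; exact: h|exact: (h m Logic.I)].
have B0 k : lam (B k) = 0%E.
  apply/le_anti/andP; split => //.
  have up m : (lam (B k) <= (expR (C * k%:R) * ((size s + 1) / (size s + 1 + m%:R)))%:E)%E.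
    have := jump_time_tail 1 m s k%:R; rewrite mulr1 expr1; apply: le_trans.
    by apply: le_measure; rewrite ?inE// => w; apply.
  have fB : lam (B k) \is a fin_num by rewrite fin_num_measure.
  rewrite -(fineK fB) lee_fin leNgt; apply/negP => p0.
  pose K := expR (C * k%:R) * (size s + 1).
  have s1 : 0 < size s + 1 by rewrite addr_gt0.
  (* Enough jumps for [K / m] to fall below the supposedly positive probability. *)
  pose m := (Num.trunc (K / fine (lam (B k)))).+1.
  have := up m; rewrite -(fineK fB) lee_fin mulrA -/K leNgt => /negP; apply.
  rewrite ltr_pdivrMr; last by rewrite ltr_wpDr.
  have : K / fine (lam (B k)) < m%:R by exact: truncnS_gt.
  by rewrite ltr_pdivrMr// mulrC => h; apply: lt_le_trans h _; apply: ler_wpM2l; [exact: ltW|rewrite lerDr ltW].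
have -> : ~` nonexplosive n rate tgt s = \bigcup_k B k.
  apply/seteqP; split => w /=.
    move=> /existsNP[k hk]; exists k => // m; rewrite leNgt; apply/negP => h.
    by apply: hk; exists m.
  by move=> [k _ h] /(_ k)[m]; rewrite ltNge h.
apply/le_anti/andP; split => //.
by apply: (le_trans (generalized_Boole_inequality lam mB (bigcupT_measurable _ mB))); rewrite eseries0// => k _ _; exact: B0.
Qed.

End jump_time_bounds.

(** * Coupling *)

Section coupling.
Context {R : realType}.

(** If [Q n j] holds from [N j] on, [jn n] is the largest [j <= n] with [N j <= n]. It tends to
    infinity, as slowly as the thresholds demand. *)
Lemma diagonal_sequence (Q : nat -> nat -> Prop) :
  (forall j, \forall n \near \oo, Q n j) ->
  exists jn : nat -> nat, (forall i, \forall n \near \oo, (i <= jn n)%N) /\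
    \forall n \near \oo, Q n (jn n).
Proof.
move=> Qnear.
have /choice[N HN] : forall j, exists N, forall n, (N <= n)%N -> Q n j.
  by move=> j; have [N _ HN] := Qnear j; exists N => n; exact: HN.
pose jn n := (\max_(j < n.+1 | (N j <= n)%N) j)%N.
exists jn; split.
  move=> i; exists (maxn i (N i)) => // n /=; rewrite geq_max => /andP[ni Nn].
  exact: (leq_bigmax_cond (Ordinal (ni : i < n.+1)%N)).
exists (N 0%N) => // n /= n0; apply: HN.
rewrite /jn.
have : (0 < #|[pred j : 'I_n.+1 | (N j <= n)%N]|)%N.
  by apply/card_gt0P; exists ord0; rewrite inE.
by move=> /(eq_bigmax_cond (fun j : 'I_n.+1 => (j : nat))) [j]; rewrite inE => Nj ->.
Qed.

(* Rearranging the unit interval by a bad event of probability [p] confines it to [0, p]; doing this for every [n] makes the bad events nested. *)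
Lemma exists_coupling (A : nat -> nat -> set R) :
  (forall n i, measurable (A n i)) ->
  (forall i d, 0 < d -> \forall n \near \oo, (lam (A n i) <= d%:E)%E) ->
  exists th : nat -> R -> R, [/\ forall n, measurable_fun setT (th n),
    forall n B, measurable B -> lam (th n @^-1` B) = lam B &
    {ae lam, forall w, forall i, \forall n \near \oo, ~ A n i (th n w)}].
Proof.
move=> mA A0.
pose B n j := \big[setU/set0]_(i < j.+1) A n i.
have mB n j : measurable (B n j) by apply: bigsetU_measurable => i _.
have B0 j d : 0 < d -> \forall n \near \oo, (lam (B n j) <= d%:E)%E.
  elim: j d => [|j IH] d d0.
    by near=> n; rewrite /B big_ord1; near: n; exact: A0.
  have d2 : 0 < d / 2 by rewrite divr_gt0.
  near=> n; rewrite /B big_ord_recr/=; apply: (le_trans (measureU2 _ _ _)) => //; first exact: (mB n j).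
  have -> : d%:E = ((d / 2)%:E + (d / 2)%:E)%E by rewrite -EFinD -splitr.
  by apply: leeD; near: n; [exact: IH|exact: A0].
(* The bad events of index up to [jn n] together have probability at most [1 / (jn n + 1)]. After
   rearrangement they lie below this bound, which drops under any given [v > 0]. *)
have [|jn [jn_oo jnB]] := @diagonal_sequence
    (fun n j => (lam (B n j) <= (j.+1%:R^-1)%:E)%E).
  by move=> j; apply: B0; rewrite invr_gt0.
have /choice[th thP] : forall n, exists th : R -> R, [/\ measurable_fun setT th,
    forall C, measurable C -> lam (th @^-1` C) = lam C &
    {ae lam, forall v, fine (lam (B n (jn n))) < v -> ~ B n (jn n) (th v)}].
  by move=> n; exact: exists_rearrangement.
exists th; split => [n|n|]; [by have [] := thP n|by have [] := thP n|].
have ae_all : {ae lam, forall v, forall n, fine (lam (B n (jn n))) < v -> ~ B n (jn n) (th n v)}.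
  by apply: ae_foralln => n; have [] := thP n.
have ae_pos : {ae lam, forall v : R, 0 < v}.
  exists `]-oo, 0]%classic; split; first exact: measurable_itv.
    by rewrite lam_rayc clip_le0.
  by move=> v /= /negP; rewrite in_itv/= -leNgt.
apply: filterS2 ae_all ae_pos => v hv v0 i; near=> n.
have small : fine (lam (B n (jn n))) < v.
  apply: (@le_lt_trans _ _ (jn n).+1%:R^-1).
    rewrite -lee_fin fineK ?fin_num_measure//; near: n; exact: jnB.
  rewrite invf_plt ?posrE//; apply: (lt_le_trans (truncnS_gt _)).
  by rewrite ler_nat ltnS; near: n; exact: jn_oo.
have ijn : (i < (jn n).+1)%N by rewrite ltnS; near: n; exact: jn_oo.
move=> Ai; apply: (hv n small); rewrite /B (bigD1 (Ordinal ijn))//=; by left.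
Unshelve. all: by end_near. Qed.

End coupling.

(** * Ultrafilter limits *)

Section analysis_toolbox.
Context {R : realType}.
Implicit Types (t u v K d e : R) (f : nat -> R -> R).

(** Compactness of the segment gives a cluster point, and a cluster point of an ultrafilter is a
    limit. *)
Lemma bounded_ultra_cvg (U : set_system nat) (a : nat -> R) M :
  UltraFilter U -> (\forall n \near U, `|a n| <= M) -> exists l : R, a @ U --> l.
Proof.
move=> UU aM.
have [|l [_ cl]] := @segment_compact R (- M) M (a @ U) _.
  suff : \forall n \near U, a n \in `[- M, M] by [].
  by apply: filterS aM => n; rewrite in_itv/= ler_norml.
exists l => V lV; have [//|UV] := in_ultra_setVsetC (a @^-1` V) UU.
by have [z []] := cl (~` V) V UV lV.
Qed.

Lemma is_derive_estimate (c : R -> R) t (l : R) :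
  (forall e, 0 < e -> \forall u \near t, `|c u - c t - l * (u - t)| <= e * `|u - t|) ->
  is_derive t 1 c l.
Proof.
move=> H.
have cv : h^-1 *: (c (h *: 1 + t) - c t) @[h --> 0^'] --> l.
  apply/cvgrPdist_le => e e0.
  have /nbhs_ballP[r r0 Hr] := H e e0.
  near=> h.
  have h0 : h != 0 by near: h; exact: nbhs_dnbhs_neq.
  have := Hr (h *: 1 + t); rewrite /ball/= [h *: 1]mulr1 opprD addrCA subrr addr0 normrN.
  rewrite addrK => /(_ _)/=; rewrite /GRing.scale/=.
  have -> : l - h^-1 * (c (h + t) - c t) = - (h^-1 * (c (h + t) - c t - l * h)).
    by field.
  rewrite normrN normrM normfV ler_pdivrMl ?normr_gt0// mulrC [_ * e]mulrC.
  rewrite mulrC; apply; near: h.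
  by apply: dnbhs0_lt.
by apply: DeriveDef; [apply/cvg_ex; exists l|exact: cvg_lim].
Unshelve. all: by end_near. Qed.

Lemma cvg_uoc_dist f (g : R -> R) :
  (forall H e, 0 < e -> \forall n \near \oo, forall t, 0 <= t <= H -> `|f n t - g t| < e) ->
  cvg_uoc f g.
Proof.
move=> fg K cK K0 P /uniform_nbhs[E [entE EP]].
have [M [_ KM]] := compact_bounded cK.
have {KM} KM := KM (M + 1) (ltr_pwDr ltr01 (lexx M)).
move: entE; rewrite -entourage_ballE => -[e /= e0 eE].
apply: filterS (fg (M + 1) e e0) => n fn; apply: EP => t Kt; apply: eE.
rewrite /ball/= distrC; apply: fn; rewrite K0//=.
by apply: (le_trans (ler_norm t)); exact: KM.
Qed.

Lemma locally_lipschitz_segments (x : R -> R) :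
  (forall H, exists K, forall t u, 0 <= t -> t <= u -> u <= H -> `|x u - x t| <= K * (u - t)) ->
  locally_lipschitz x.
Proof.
move=> xL [s t] [/= s0 t0].
have [K HK] := xL (Num.max s t + 1).
exists K; split; first exact: num_real.
move=> M KM.
suff : \forall z \near (s, t), (([set u : R | 0 <= u] `*` [set u : R | 0 <= u]) z) ->
    `|x z.1 - x z.2| <= M * `|z.1 - z.2| by [].
have st1 : s < Num.max s t + 1 by rewrite ltr_pwDr// le_max lexx.
have tt1 : t < Num.max s t + 1 by rewrite ltr_pwDr// le_max lexx orbT.
near=> z => -[z10 z20].
have z1 : z.1 <= Num.max s t + 1.
  apply: ltW; near: z; exact: (cvg_fst (lt_nbhsl st1)).
have z2 : z.2 <= Num.max s t + 1.
  apply: ltW; near: z; exact: (cvg_snd (lt_nbhsl tt1)).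
have [z12|z21] := leP z.2 z.1.
  apply: (le_trans (HK _ _ z20 z12 z1)).
  by rewrite ger0_norm ?subr_ge0//; apply: ler_wpM2r; rewrite ?subr_ge0// ltW.
rewrite distrC [`|z.1 - z.2|]distrC; apply: (le_trans (HK _ _ z10 (ltW z21) z2)).
by rewrite ger0_norm ?subr_ge0 ?(ltW z21)//; apply: ler_wpM2r; rewrite ?subr_ge0 ?ltW.
Unshelve. all: by end_near. Qed.

End analysis_toolbox.

Section ultralimit.
Context {R : realType}.
Variables (U : set_system nat) (UU : UltraFilter U) (U_oo : \oo `<=` U).
Implicit Types (t u v K d e H hi : R) (f C h : nat -> R -> R) (c g l : R -> R).

Let UF : ProperFilter U. Proof. by case: UU. Qed.

(** The additive error [d] makes room for the jumps and the noise of the prelimit paths; it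
    disappears in the limit, which is genuinely Lipschitz. *)
Definition asymptotically_lipschitz f := forall H, exists K, forall d, 0 < d ->
  \forall n \near \oo, forall t u, 0 <= t -> t <= u -> u <= H ->
    `|f n u - f n t| <= K * (u - t) + d.

(* [C] grows at rate at most [h] up to a vanishing error, along intervals where [P] holds. *)
Definition drift_bound (P : nat -> R -> Prop) C h := forall H K d, 0 < d ->
  \forall n \near \oo, forall t u hi, 0 <= t -> t <= u -> u <= H -> `|hi| <= K ->
    (forall v, t <= v <= u -> P n v /\ h n v <= hi) ->
    C n u - C n t <= hi * (u - t) + d.

Definition uniform_ultralimit f l := forall H e, 0 < e ->
  \forall n \near U, forall t, 0 <= t <= H -> `|f n t - l t| < e.

Lemma ultralimit_le (a : nat -> R) (x M : R) : a @ U --> x ->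
  (forall d, 0 < d -> \forall n \near U, a n <= M + d) -> x <= M.
Proof.
move=> ax aM; apply/ler_addgt0Pr => d d0.
exact: (cvgr_to_le ax (aM d d0)).
Qed.

(** A form of the Arzela-Ascoli theorem. Boundedness at each time gives pointwise limits along the
    ultrafilter, and the asymptotic Lipschitz bound carries closeness on a finite grid over to the
    whole segment. *)
Lemma exists_uniform_ultralimit f (x0 : R) : f n 0 @[n --> \oo] --> x0 ->
  asymptotically_lipschitz f -> exists l, [/\ l 0 = x0, uniform_ultralimit f l &
    forall H, exists K, forall t u, 0 <= t -> t <= u -> u <= H -> `|l u - l t| <= K * (u - t)].
Proof.
move=> f0 flip.
have f0U : f n 0 @[n --> U] --> x0 by move=> V /f0; exact: U_oo.
have /choice[l lP] : forall t, exists y : R, 0 <= t -> f n t @[n --> U] --> y.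
  move=> t; have [t0|t0] := leP 0 t; last by exists 0.
  have [K HK] := flip t.
  have [|y fy] := @bounded_ultra_cvg R U (f ^~ t) (`|x0| + 1 + (K * t + 1)) UU; last by exists y.
  have near1 : \forall n \near U, `|f n t - f n 0| <= K * (t - 0) + 1.
    by apply: U_oo; apply: filterS (HK 1 ltr01) => n; apply.
  move/cvgrPdist_lt : f0U => /(_ 1 ltr01) near2.
  apply: filterS2 near1 near2 => n h1 h2.
  rewrite (_ : f n t = (f n t - f n 0) - (x0 - f n 0) + x0); last ring.
  apply: (le_trans (ler_normD _ _)); rewrite subr0 in h1.
  have := ler_normB (f n t - f n 0) (x0 - f n 0); lra.
have llip H : exists K, 0 <= K /\ (forall d, 0 < d -> \forall n \near U,
    forall t u, 0 <= t -> t <= u -> u <= H -> `|f n u - f n t| <= K * (u - t) + d) /\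
    forall t u, 0 <= t -> t <= u -> u <= H -> `|l u - l t| <= K * (u - t).
  have [K HK] := flip H; pose K' := Num.max K 0.
  have near1 d : 0 < d -> \forall n \near U,
    forall t u, 0 <= t -> t <= u -> u <= H -> `|f n u - f n t| <= K' * (u - t) + d.
    move=> d0; apply: U_oo; apply: filterS (HK d d0) => n hn t u t0 tu uH.
    apply: (le_trans (hn t u t0 tu uH)); rewrite lerD2r; apply: ler_wpM2r.
      by rewrite subr_ge0.
    by rewrite /K' le_max lexx.
  exists K'; split; first by rewrite /K' le_max lexx orbT.
  split => // t u t0 tu uH.
  have c : `|f n u - f n t| @[n --> U] --> `|l u - l t|.
    by apply: cvg_norm; apply: cvgB; apply: lP => //; exact: le_trans tu.
  apply: (ultralimit_le c) => d d0; apply: filterS (near1 d d0) => n; exact.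
exists l; split.
- exact: (cvg_unique _ (lP 0 (lexx 0)) f0U).
- move=> H e e0.
  have [H0|H0] := ltP H 0.
    near=> n => t /andP[t0 /(le_trans t0)]; by rewrite leNgt H0.
  have [K [K0 [Kf Kl]]] := llip H.
  (* a grid of mesh [H / N] with [K H / N <= e / 6] *)
  pose N := (Num.trunc (K * H * 6 / e)).+1.
  have N0 : 0 < N%:R :> R by rewrite ltr0n.
  have KN : K * (H / N%:R) <= e / 6.
    rewrite mulrA ler_pdivrMr// mulrAC ler_pdivlMr// -ler_pdivrMl// mulrC.
    by rewrite ltW// truncnS_gt.
  have grid : \forall n \near U, forall i : 'I_N.+1, `|f n (i%:R * (H / N%:R)) - l (i%:R * (H / N%:R))| < e / 6.
    apply: filter_forall => i.
    have i0 : 0 <= i%:R * (H / N%:R) by rewrite mulr_ge0// divr_ge0.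
    have := lP _ i0; move/cvgrPdist_lt => /(_ (e / 6)); rewrite divr_gt0// => /(_ isT).
    by apply: filterS => n; rewrite distrC.
  have e6 : 0 < e / 6 by rewrite divr_gt0.
  apply: filterS2 grid (Kf _ e6) => n hg hK t /andP[t0 tH].
  have [i [iN it ti]] : exists i : nat, [/\ (i < N.+1)%N, i%:R * (H / N%:R) <= t & t - i%:R * (H / N%:R) <= H / N%:R].
    have [HE|Hne] := eqVneq H 0.
      by exists 0%N; split => //; [rewrite mul0r|move: tH; rewrite mul0r HE mul0r subr0].
    have Hp : 0 < H by rewrite lt_def Hne.
    have HN : 0 < H / N%:R by rewrite divr_gt0.
    have dv : 0 <= t / (H / N%:R) by apply: divr_ge0 => //; exact: ltW.
    have /andP[h1 h2] := truncn_itv dv.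
    exists (Num.trunc (t / (H / N%:R))); split.
    - rewrite -(ltr_nat R); apply: (le_lt_trans h1).
      rewrite ltr_pdivrMr//; apply: (le_lt_trans tH).
      by rewrite mulrCA -natr1 mulrDl mul1r mulfV ?gt_eqF// mulrDr mulr1 ltrDl mulr_gt0// invr_gt0.
    - by rewrite -ler_pdivlMr.
    - move: h2; rewrite ltr_pdivrMr// -natr1 mulrDl mul1r => /ltW; lra.
  have i0 : 0 <= i%:R * (H / N%:R) by rewrite mulr_ge0// divr_ge0.
  have a1 := hK _ _ i0 it tH; have a2 := Kl _ _ i0 it tH.
  have a3 := hg (Ordinal iN); rewrite /= in a3.
  have a4 : K * (t - i%:R * (H / N%:R)) <= e / 6 by apply: le_trans KN; apply: ler_wpM2l.
  set a := i%:R * _ in a1 a2 a3 a4.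
  (* Four errors of [e / 6] arise from the grid point [a]: two in the increment of [f n], one in the
     increment of [l] and one at [a] itself. *)
  rewrite (_ : f n t - l t = (f n t - f n a) - (l t - l a) + (f n a - l a)); last ring.
  apply: (le_lt_trans (ler_normD _ _)).
  have := ler_normB (f n t - f n a) (l t - l a); lra.
- by move=> H; have [K [_ [_ Kl]]] := llip H; exists K.
Unshelve. all: by end_near. Qed.

(** Members of [U] meet every tail, since the tails belong to [U] too; so each index can be chosen
    above the previous one. *)
Lemma exists_subsequence (Q : nat -> set nat) : (forall k, U (Q k)) ->
  exists psi : nat -> nat, subsequence psi /\ forall k, Q k (psi k).
Proof.
move=> UQ.
have /choice[g gP] : forall kN : nat * nat, exists n, Q kN.1 n /\ (kN.2 < n)%N.
  move=> [k N]; apply: (@filter_ex _ U _ _); apply: filterI; first exact: UQ.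
  by apply: U_oo; exists N.+1.
pose psi := fix psi k := g (k, if k is k'.+1 then psi k' else 0%N).
exists psi; split; last by case=> [|k]; [exact: (gP (0, 0)%N).1|exact: (gP (k.+1, psi k)).1].
apply: homo_ltn => [? ? ?|k]; first exact: ltn_trans.
exact: (gP (k.+1, psi k)).2.
Qed.

(** Near [t] the drift [h n] stays below the constant [l t + e]: half of [e] pays for the continuity
    of [l], half for the uniform convergence. The error allowed by [drift_bound] then vanishes along
    the ultrafilter. *)
Lemma drift_ultralimit (P : nat -> R -> Prop) C h c l t : drift_bound P C h ->
  (forall v, 0 <= v -> C n v @[n --> U] --> c v) -> uniform_ultralimit h l ->
  0 < t -> {for t, continuous l} ->
  (exists2 d, 0 < d & \forall n \near U, forall v, `|v - t| <= d -> P n v) ->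
  forall e, 0 < e -> exists2 d, 0 < d & forall u v, t - d <= u -> u <= v -> v <= t + d ->
    c v - c u <= (l t + e) * (v - u).
Proof.
move=> CP Cc hl t0 lc [dP dP0 nP] e e0.
have e2 : 0 < e / 2 by rewrite divr_gt0.
have /nbhs_ballP[r r0 Hr] : \forall v \near t, `|l t - l v| < e / 2.
  by move/cvgrPdist_lt : lc; exact.
(* The three bounds ensure in turn that [P] holds, that [l] is close to [l t], and that all times
   involved are nonnegative. *)
pose d := Num.min (Num.min dP (r / 2)) t.
have d0 : 0 < d by rewrite /d !lt_min dP0 t0 divr_gt0.
have [ddP dr dt] : [/\ d <= dP, d <= r / 2 & d <= t].
  by rewrite /d; split; rewrite !ge_min lexx ?orbT.
exists d => // u v tu uv vt.
have u0 : 0 <= u by lra.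
have c' : (C n v - C n u) @[n --> U] --> c v - c u.
  by apply: cvgB; apply: Cc => //; exact: le_trans uv.
apply: (ultralimit_le c') => d' d'0.
have nC := U_oo (CP (t + d) `|l t + e| d' d'0).
apply: filterS3 nC nP (hl (t + d) _ e2) => n hC hP hh.
apply: hC => // z /andP[uz zv]; split.
  by apply: hP; rewrite ler_norml; lra.
have := hh z; have -> : 0 <= z <= t + d by lra.
move=> /(_ isT); have := Hr z; rewrite /ball/= => /(_ _)/wrap[].
  by rewrite ltr_norml; lra.
by rewrite !ltr_norml; lra.
Qed.

End ultralimit.

(** * Fluid limits *)

Section fluid_limit.
Context {R : realType}.
Implicit Types (t u v K d e H hi : R) (c g : R -> R).

Lemma derive_estimate c t (L : R) : is_derive t 1 c L ->
  forall e, 0 < e -> \forall u \near t, `|c u - c t - L * (u - t)| <= e * `|u - t|.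
Proof.
move=> [dc dcE] e e0.
have cv : h^-1 *: (c (h *: 1 + t) - c t) @[h --> 0^'] --> L by rewrite -dcE.
move/cvgrPdist_le : cv => /(_ e e0).
rewrite /prop_near1/= => /nbhs_ballP[r r0 Hr].
apply/nbhs_ballP; exists r => // u; rewrite /ball/= distrC => ur.
have [->|ut] := eqVneq u t; first by rewrite !subrr mulr0 subr0 normr0 mulr0.
have ut0 : u - t != 0 by rewrite subr_eq0.
have := Hr (u - t); rewrite /ball/= sub0r normrN => /(_ ur ut0).
rewrite [(u - t) *: 1]mulr1 subrK /GRing.scale/= => h.
have -> : c u - c t - L * (u - t) = - ((L - (u - t)^-1 * (c u - c t)) * (u - t)).
  by field.
by rewrite normrN normrM; apply: ler_wpM2r.
Qed.

(** A derivative that exists is also the right derivative, so increments to the right are enough to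
    bound it. *)
Lemma derive_le_right c t (L M : R) : is_derive t 1 c L ->
  (forall e, 0 < e -> exists2 d, 0 < d & forall u, t <= u <= t + d -> c u - c t <= (M + e) * (u - t)) ->
  L <= M.
Proof.
move=> dc cM; rewrite leNgt; apply/negP => ML.
(* One third of the gap is lost to the derivative estimate, one to the hypothesis, and the last one
   gives the contradiction. *)
pose e := (L - M) / 3; have e0 : 0 < e by rewrite divr_gt0 ?subr_gt0.
have [d d0 hd] := cM e e0.
have /nbhs_ballP[r r0 Hr] := derive_estimate dc e0.
pose h := Num.min d (r / 2); have h0 : 0 < h by rewrite lt_min d0 divr_gt0.
have hr : h <= r / 2 by rewrite ge_min lexx orbT.
have hd' : h <= d by rewrite ge_min lexx.
have := hd (t + h); have -> : t <= t + h <= t + d by lra.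
move=> /(_ isT); have := Hr (t + h).
have -> : t + h - t = h by ring.
rewrite /ball/= (_ : t - (t + h) = - h); last by ring.
rewrite normrN gtr0_norm// => /(_ _)/wrap[]; first lra.
rewrite ler_norml => /andP[h1 _] h2.
have : (L - M - 2 * e) * h <= 0 by lra.
have -> : L - M - 2 * e = e by rewrite /e; field.
by rewrite leNgt mulr_gt0.
Qed.

Lemma derive_le_left c t (L M : R) : is_derive t 1 c L ->
  (forall e, 0 < e -> exists2 d, 0 < d & forall u, t - d <= u <= t -> c t - c u <= (M + e) * (t - u)) ->
  L <= M.
Proof.
move=> dc cM; rewrite leNgt; apply/negP => ML.
pose e := (L - M) / 3; have e0 : 0 < e by rewrite divr_gt0 ?subr_gt0.
have [d d0 hd] := cM e e0.
have /nbhs_ballP[r r0 Hr] := derive_estimate dc e0.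
pose h := Num.min d (r / 2); have h0 : 0 < h by rewrite lt_min d0 divr_gt0.
have hr : h <= r / 2 by rewrite ge_min lexx orbT.
have hd' : h <= d by rewrite ge_min lexx.
have := hd (t - h); have -> : t - d <= t - h <= t by lra.
move=> /(_ isT); have := Hr (t - h).
have -> : t - h - t = - h by ring.
rewrite /ball/= (_ : t - (t - h) = h); last by ring.
rewrite normrN gtr0_norm// => /(_ _)/wrap[]; first lra.
rewrite ler_norml => /andP[_ h1] h2.
have : (L - M - 2 * e) * h <= 0 by lra.
have -> : L - M - 2 * e = e by rewrite /e; field.
by rewrite leNgt mulr_gt0.
Qed.

Lemma bigmax_singleton (N : finType) (n0 : N) (F : N -> R) :
  \big[Num.max/F n0]_(n in [set n0]%SET) F n = F n0.
Proof.
apply: (big_ind (fun z => z = F n0)) => // [x y -> ->|i]; first by rewrite maxxx.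
by rewrite inE => /eqP ->.
Qed.

Section derivative.
Variables (U : set_system nat) (UU : UltraFilter U) (U_oo : \oo `<=` U).

Lemma is_derive_ultralimit (P Q : nat -> R -> Prop) (C h : nat -> R -> R) c (l : R -> R) t :
  drift_bound P C h -> drift_bound Q (fun n v => - C n v) (fun n v => - h n v) ->
  (forall v, 0 <= v -> C n v @[n --> U] --> c v) -> uniform_ultralimit U h l ->
  0 < t -> {for t, continuous l} ->
  (exists2 d, 0 < d & \forall n \near U, forall v, `|v - t| <= d -> P n v) ->
  (exists2 d, 0 < d & \forall n \near U, forall v, `|v - t| <= d -> Q n v) ->
  is_derive t 1 c (l t).
Proof.
move=> CP CQ Cc hl t0 lc nP nQ; apply: is_derive_estimate => e e0.
have UF : ProperFilter U by case: UU.
have [d1 d10 H1] := drift_ultralimit UU U_oo CP Cc hl t0 lc nP e0.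
have Cc' v : 0 <= v -> - C n v @[n --> U] --> - c v by move=> v0; apply: cvgN; exact: Cc.
have hl' : uniform_ultralimit U (fun n v => - h n v) (fun v => - l v).
  move=> H e' e'0; apply: filterS (hl H e' e'0) => n hn v v0.
  by rewrite -opprD normrN; exact: hn.
have lc' : {for t, continuous (fun v => - l v)} by apply: cvgN.
have [d2 d20 H2] := drift_ultralimit UU U_oo CQ Cc' hl' t0 lc' nQ e0.
have d0 : 0 < Num.min d1 d2 by rewrite lt_min d10.
apply/nbhs_ballP; exists (Num.min d1 d2) => // u; rewrite /ball/= lt_min !ltr_norml.
move=> /andP[/andP[a1 a2] /andP[a3 a4]].
have [tu|ut] := leP t u.
  rewrite [`|u - t|]ger0_norm ?subr_ge0//.
  have := H1 t u ltac:(lra) tu ltac:(lra); have := H2 t u ltac:(lra) tu ltac:(lra).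
  by rewrite ler_norml; lra.
rewrite [`|u - t|]ltr0_norm ?subr_lt0//.
have := H1 u t ltac:(lra) (ltW ut) ltac:(lra); have := H2 u t ltac:(lra) (ltW ut) ltac:(lra).
by rewrite ler_norml; lra.
Qed.

End derivative.

Variables (lambda beta mu eps alpha : R) (gamma : nat).
Hypotheses (beta_gt0 : 0 < beta) (mu_gt0 : 0 < mu) (eps_gt0 : 0 < eps).

Let b := - (lambda * (1 - alpha) / beta).

(** The right-hand side of the equation of [y] for [kappa = alpha], and of that of [w] for
    [kappa = alpha - 2]. *)
Definition fluid_drift (kappa x y w : R) := beta * x + 2^-1 * kappa * mu * (w - `|y|).

Variables (X Y W : nat -> R -> R) (x0 y0 w0 : R).
Hypotheses (X0 : X n 0 @[n --> \oo] --> x0) (Y0 : Y n 0 @[n --> \oo] --> y0)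
  (W0 : W n 0 @[n --> \oo] --> w0).
Hypotheses (lipX : asymptotically_lipschitz X) (lipY : asymptotically_lipschitz Y)
  (lipW : asymptotically_lipschitz W).
Let Yd n v := fluid_drift alpha (X n v) (Y n v) (W n v).
Let Wd n v := fluid_drift (alpha - 2) (X n v) (Y n v) (W n v).
(** An arrival changes the unscaled pair by [gamma] and [-1], an acceptance or a return by [- gamma]
    and 1. In this combination they cancel unless truncation at zero interferes, which leaves the
    additional events. *)
Let Xr n v := X n v + gamma%:R * Y n v.
Let any (_ : nat) (_ : R) := True.
Hypotheses
  (driftY : drift_bound any Y Yd)
  (driftYN : drift_bound any (fun n v => - Y n v) (fun n v => - Yd n v))
  (driftW : drift_bound any W Wd)
  (driftWN : drift_bound any (fun n v => - W n v) (fun n v => - Wd n v))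
  (driftXN : drift_bound any (fun n v => - Xr n v) (fun n v => eps * Y n v))
  (driftX : forall kappa, 0 < kappa ->
     drift_bound (fun n v => b + kappa <= X n v) Xr (fun n v => - (eps * Y n v)))
  (X_ge : forall n t, 0 <= t -> b <= X n t).

Theorem fluid_limit : exists psi : nat -> nat, subsequence psi /\
  exists x y w : R -> R,
  [/\ cvg_uoc (fun n => X (psi n)) x, cvg_uoc (fun n => Y (psi n)) y,
      cvg_uoc (fun n => W (psi n)) w, [/\ x 0 = x0, y 0 = y0 & w 0 = w0] &
      fluid_trajectory lambda beta mu eps alpha gamma x y w].
Proof.
have [U [UU U_oo]] := ultraFilterLemma (@eventually_filter).
have UF : ProperFilter U by case: UU.
have [x [x00 Xx xL]] := exists_uniform_ultralimit UU U_oo X0 lipX.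
have [y [y00 Yy yL]] := exists_uniform_ultralimit UU U_oo Y0 lipY.
have [w [w00 Ww wL]] := exists_uniform_ultralimit UU U_oo W0 lipW.
have ptw f l : uniform_ultralimit U f l -> forall v, 0 <= v -> f n v @[n --> U] --> l v.
  move=> fl v v0; apply/cvgrPdist_lt => e e0.
  by apply: filterS (fl v e e0) => n hn; rewrite distrC; apply: hn; rewrite v0 lexx.
(* Closeness [1 / (k + 1)] up to time [k + 1] for all three coordinates: any sequence that meets the
   [Q k] in turn converges uniformly on compact sets. *)
pose Q k n := forall t, 0 <= t <= k.+1%:R ->
    [/\ `|X n t - x t| < k.+1%:R^-1, `|Y n t - y t| < k.+1%:R^-1 & `|W n t - w t| < k.+1%:R^-1].
have UQ k : U (Q k).
  have k0 : 0 < k.+1%:R^-1 :> R by rewrite invr_gt0.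
  apply: filterS3 (Xx k.+1%:R _ k0) (Yy k.+1%:R _ k0) (Ww k.+1%:R _ k0) => n h1 h2 h3 t tk.
  by split; [exact: h1|exact: h2|exact: h3].
have [psi [sub Qpsi]] := exists_subsequence UU U_oo UQ.
have cont (f : R -> R) :
    (forall H, exists K, forall t u, 0 <= t -> t <= u -> u <= H -> `|f u - f t| <= K * (u - t)) ->
    forall t, 0 < t -> {for t, continuous f}.
  move=> fL t t0; have [K hK] := fL (t + 1); pose K' := `|K| + 1.
  have K'0 : 0 < K' by rewrite ltr_pwDr.
  apply/cvgrPdist_lt => e e0; pose d := Num.min (Num.min t 1) (e / K').
  have d0 : 0 < d by rewrite /d !lt_min t0 ltr01 divr_gt0.
  apply/nbhs_ballP; exists d => // u; rewrite /ball/= /d !lt_min => /andP[/andP[a12 a34] a5].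
  have := a12; rewrite ltr_norml => /andP[a1 a2].
  have := a34; rewrite ltr_norml => /andP[a3 a4].
  have KK : K <= K' by rewrite /K'; have := ler_norm K; lra.
  have [tu|ut] := leP t u.
    rewrite distrC; apply: (le_lt_trans (hK _ _ (ltW t0) tu _)); first lra.
    apply: (@le_lt_trans _ _ (K' * (u - t))); first by apply: ler_wpM2r; rewrite ?subr_ge0.
    by move: a5; rewrite distrC ger0_norm ?subr_ge0// ltr_pdivlMr// mulrC.
  apply: (le_lt_trans (hK _ _ _ (ltW ut) _)); [lra|lra|].
  apply: (@le_lt_trans _ _ (K' * (t - u))); first by apply: ler_wpM2r => //; rewrite subr_ge0 ltW.
  by move: a5; rewrite gtr0_norm ?subr_gt0// ltr_pdivlMr// mulrC.
have [[xc yc] wc] := (cont x xL, cont y yL, cont w wL).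
have uoc (f : nat -> R -> R) (l : R -> R) :
    (forall k t, 0 <= t <= k.+1%:R -> `|f (psi k) t - l t| < k.+1%:R^-1) ->
    cvg_uoc (fun n => f (psi n)) l.
  move=> fk; apply: cvg_uoc_dist => H e e0.
  exists (maxn (Num.trunc H) (Num.trunc e^-1)) => // n /=; rewrite geq_max => /andP[n1 n2] t /andP[t0 tH].
  apply: (lt_le_trans (fk n t _)).
    rewrite t0/= (le_trans tH)// (le_trans (ltW (truncnS_gt _)))// ler_nat ltnS//.
  rewrite -[e]invrK lef_pV2 ?posrE ?invr_gt0//.
  by rewrite (le_trans (ltW (truncnS_gt _)))// ler_nat ltnS.
have drift_lim kappa : uniform_ultralimit U (fun n v => fluid_drift kappa (X n v) (Y n v) (W n v))
    (fun v => fluid_drift kappa (x v) (y v) (w v)).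
  move=> H e e0.
  (* [beta] and [2 * |k|] measure the effect of errors in [X] and in [W] and [|Y|]; the added 1
     makes the final estimate strict. *)
  pose k := 2^-1 * kappa * mu; pose M := beta + 2 * `|k| + 1.
  have k0 := normr_ge0 k.
  have M0 : 0 < M by rewrite /M ltr_wpDl//; apply: addr_ge0; [exact: ltW|exact: mulr_ge0].
  have eM : 0 < e / M by rewrite divr_gt0.
  apply: filterS3 (Xx H _ eM) (Yy H _ eM) (Ww H _ eM) => n h1 h2 h3 v hv.
  rewrite /fluid_drift -/k.
  rewrite (_ : _ - _ = beta * (X n v - x v) + k * ((W n v - w v) - (`|Y n v| - `|y v|))); last ring.
  apply: (le_lt_trans (ler_normD _ _)); rewrite (normrM beta) (normrM k) (gtr0_norm beta_gt0).
  have a1 := ltW (h1 v hv); have a2 := ltW (h2 v hv); have a3 := ltW (h3 v hv).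
  have a4 : `|W n v - w v - (`|Y n v| - `|y v|)| <= 2 * (e / M).
    apply: (le_trans (ler_normB _ _)); have := ler_dist_dist (Y n v) (y v); lra.
  have eE : e = beta * (e / M) + `|k| * (2 * (e / M)) + e / M.
    transitivity (M * (e / M)); first by rewrite mulrCA divff ?mulr1// gt_eqF.
    by rewrite {1}/M; ring.
  have b1 : beta * `|X n v - x v| <= beta * (e / M) by apply: ler_wpM2l => //; exact: ltW.
  have b2 : `|k| * `|W n v - w v - (`|Y n v| - `|y v|)| <= `|k| * (2 * (e / M)) by apply: ler_wpM2l.
  by rewrite [ltRHS]eE; apply: le_lt_trans (lerD b1 b2) _; rewrite ltrDl.
have drift_cont kappa t : 0 < t -> {for t, continuous (fun v => fluid_drift kappa (x v) (y v) (w v))}.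
  move=> t0; apply: cvgD; first by apply: cvgMr; exact: xc.
  by apply: cvgMr; apply: cvgB; [exact: wc|apply: cvg_norm; exact: yc].
have ok t : exists2 d : R, 0 < d & \forall n \near U, forall v, `|v - t| <= d -> any n v.
  by exists 1 => //; apply: nearW.
have dy t : 0 < t -> is_derive t 1 y (fluid_drift alpha (x t) (y t) (w t)).
  move=> t0; exact: (is_derive_ultralimit UU U_oo driftY driftYN (ptw _ _ Yy) (drift_lim alpha) t0
    (drift_cont alpha t t0) (ok t) (ok t)).
have dw t : 0 < t -> is_derive t 1 w (fluid_drift (alpha - 2) (x t) (y t) (w t)).
  move=> t0; exact: (is_derive_ultralimit UU U_oo driftW driftWN (ptw _ _ Ww) (drift_lim (alpha - 2)) t0
    (drift_cont (alpha - 2) t t0) (ok t) (ok t)).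
have x_ge t : 0 <= t -> b <= x t.
  move=> t0; apply: (cvgr_to_ge (ptw _ _ Xx t t0)); apply: nearW => n; exact: X_ge.
have Xr_lim v : 0 <= v -> Xr n v @[n --> U] --> x v + gamma%:R * y v.
  by move=> v0; apply: cvgD; [exact: (ptw _ _ Xx)|apply: cvgMr; exact: (ptw _ _ Yy)].
have Yeps_lim : uniform_ultralimit U (fun n v => eps * Y n v) (fun v => eps * y v).
  move=> H e e0; have ee : 0 < e / eps by rewrite divr_gt0.
  apply: filterS (Yy H _ ee) => n h v hv; rewrite -mulrBr normrM gtr0_norm// mulrC.
  by rewrite -ltr_pdivlMr//; exact: h.
have Yeps_cont t : 0 < t -> {for t, continuous (fun v => eps * y v)}.
  by move=> t0; apply: cvgMr; exact: yc.
have x_interior t : 0 < t -> b < x t -> is_derive t 1 x (- gamma%:R * derive1 y t - eps * y t).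
  (* One third of the distance to the boundary is spent on the variation of [x] near [t], one on the
     distance from [X n] to [x], and one remains as margin. *)
  move=> t0 bx; pose kappa := (x t - b) / 3.
  have k0 : 0 < kappa by rewrite divr_gt0 ?subr_gt0.
  have near_x : exists2 d : R, 0 < d & \forall n \near U, forall v, `|v - t| <= d -> b + kappa <= X n v.
    have /nbhs_ballP[r r0 Hr] : \forall v \near t, `|x t - x v| < kappa.
      by move/cvgrPdist_lt : (xc t t0); exact.
    pose d := Num.min (r / 2) t.
    have d0 : 0 < d by rewrite lt_min t0 divr_gt0.
    have [dr dt] : d <= r / 2 /\ d <= t by rewrite /d !ge_min !lexx orbT.
    exists d => //; apply: filterS (Xx (2 * t) _ k0) => n h v; rewrite ler_norml => /andP[v1 v2].
    have := h v; have -> : 0 <= v <= 2 * t by lra.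
    move=> /(_ isT); have := Hr v; rewrite /ball/= => /(_ _)/wrap[]; first by rewrite ltr_norml; lra.
    have : x t = b + 3 * kappa by rewrite /kappa; field.
    by rewrite !ltr_norml; lra.
  have dr1 : drift_bound (fun n v => b + kappa <= X n v) Xr (fun n v => - (eps * Y n v)) by exact: driftX.
  have dr2 : drift_bound any (fun n v => - Xr n v) (fun n v => - - (eps * Y n v)).
    rewrite (_ : (fun n v => - - (eps * Y n v)) = (fun n v => eps * Y n v))//.
    by apply/funext => n; apply/funext => v; rewrite opprK.
  have lim' : uniform_ultralimit U (fun n v => - (eps * Y n v)) (fun v => - (eps * y v)).
    move=> H e e0; apply: filterS (Yeps_lim H e e0) => n h v hv.
    by rewrite -opprD normrN; exact: h.
  have cont' : {for t, continuous (fun v => - (eps * y v))} by apply: cvgN; exact: Yeps_cont.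
  have dz := is_derive_ultralimit UU U_oo dr1 dr2 Xr_lim lim' t0 cont' near_x (ok t).
  have dyt := dy t t0.
  (* The limits yield derivatives of [x + gamma y] and of [y], from which that of [x] is
     recovered. *)
  have -> : x = (fun v => x v + gamma%:R * y v) - (gamma%:R *: y).
    by apply/funext => v; rewrite /= fctE /GRing.scale/= addrK.
  apply: is_derive_eq.
  rewrite derive1E derive_val /GRing.scale/=; ring.
exists psi; split => //; exists x, y, w; split => //.
- by apply: uoc => k t /(Qpsi k)[].
- by apply: uoc => k t /(Qpsi k)[].
- by apply: uoc => k t /(Qpsi k)[].
split => //; try exact: locally_lipschitz_segments.
move=> t _ [t0 reg].
have dyt := dy t t0; have dwt := dw t t0.
split.
- move=> bx; rewrite [LHS]derive1E; have := x_interior t t0 bx => dxt.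
  exact: derive_val.
- move=> xb.
  (* Regularity for the family reduced to [x] provides its two-sided derivative. *)
  have [dx _] := reg [set ord0]%SET ord0 (set11 _).
  rewrite (_ : (fun u => _) = x) in dx; last first.
    by apply/funext => u; rewrite (bigmax_singleton ord0 (fun n => tnth [tuple x; y; w] n u)).
  have dxt : is_derive t 1 x ('D_1 x t) by exact: derivableP.
  have Dx0 : 'D_1 x t = 0.
    apply/le_anti/andP; split.
      apply: (derive_le_left dxt) => e e0; exists t => // u /andP[u0 ut].
      have := x_ge u; have -> : 0 <= u by lra.
      move=> /(_ isT) bu; rewrite add0r xb -/b; apply: (@le_trans _ _ 0); first lra.
      by rewrite mulr_ge0 ?subr_ge0// ltW.
    rewrite -oppr_le0.
    have dxn : is_derive t 1 (- x) (- 'D_1 x t) by exact: is_deriveN.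
    apply: (derive_le_right dxn) => e e0; exists 1 => // u /andP[tu ut].
    have := x_ge u; have -> : 0 <= u by lra.
    move=> /(_ isT) bu; rewrite add0r !fctE xb -/b; apply: (@le_trans _ _ 0); first lra.
    by rewrite mulr_ge0 ?subr_ge0// ltW.
  have dz : is_derive t 1 (fun v => - (x v + gamma%:R * y v)) (- (0 + gamma%:R * derive1 y t)).
    have -> : (fun v => - (x v + gamma%:R * y v)) = - (x + (gamma%:R *: y)).
      by apply/funext.
    by apply: is_derive_eq; rewrite Dx0 derive1E derive_val /GRing.scale.
  (* The bound that survives at the boundary, combined with the vanishing derivative of [x], reads
     [- gamma y' - eps y <= 0]; so the maximum in the equation is 0. *)
  have le0 : - (0 + gamma%:R * derive1 y t) <= eps * y t.
    apply: (derive_le_right dz) => e e0.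
    have XrN v : 0 <= v -> - Xr n v @[n --> U] --> - (x v + gamma%:R * y v).
      by move=> v0; apply: cvgN; exact: Xr_lim.
    have [d d0 hd] := drift_ultralimit UU U_oo driftXN XrN Yeps_lim t0 (Yeps_cont t t0) (ok t) e0.
    by exists d => // u /andP[tu ut]; apply: hd => //; lra.
  rewrite [LHS]derive1E Dx0 max_r//; lra.
- by rewrite derive1E derive_val.
- by rewrite derive1E derive_val.
Qed.

End fluid_limit.

(** * The invitation model *)

Definition model_state : countType := (nat * int * nat)%type.

Section model.
Context {R : realType}.
Variables (lambda beta mu eps alpha : R) (gamma : nat) (r : R).
Hypotheses (lambda_gt0 : 0 < lambda) (beta_gt0 : 0 < beta) (mu_gt0 : 0 < mu)
  (eps_gt0 : 0 < eps) (alpha_ge0 : 0 <= alpha) (alpha_lt1 : alpha < 1) (r_gt0 : 0 < r).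

Local Notation ev := (events (lambda * r) beta mu eps alpha gamma).

(** The default [(0, s)] gives indices past the five events rate zero and no effect, so that
    hypotheses quantified over all indices hold. *)
Definition model_rate (s : model_state) (i : nat) : R := (nth (0, s) (ev s) i).1.
Definition model_tgt (s : model_state) (i : nat) : model_state := (nth (0, s) (ev s) i).2.

Local Notation q := (total_rate 5 model_rate).

Lemma model_rate_ge0 s i : 0 <= model_rate s i.
Proof.
have a1 : 0 <= 1 - alpha by rewrite subr_ge0 ltW.
case: s => -[x y] z; rewrite /model_rate.
do 5?[case: i => [|i] /=]; rewrite ?nth_nil ?mulr_ge0// ?ltW// ?mulr_gt0//.
Qed.

Lemma total_model_rate x y z :
  q (x, y, z) = lambda * r + beta * x%:R + eps * `|y%:~R| + mu * z%:R.
Proof.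
rewrite /total_rate /partial_sum !big_ord_recl big_ord0 /model_rate /=; ring.
Qed.

Lemma total_model_rate_ge s : lambda * r <= q s.
Proof.
case: s => -[x y] z; rewrite total_model_rate -!addrA lerDl.
by rewrite !addr_ge0 ?mulr_ge0// ltW.
Qed.

Lemma total_model_rate_gt0 s : 0 < q s.
Proof. by apply: lt_le_trans (total_model_rate_ge s); rewrite mulr_gt0. Qed.

Definition state_norm (s : model_state) : nat := let: (x, y, z) := s in (x + `|y| + z)%N.

Lemma state_norm_tgt s i : (state_norm (model_tgt s i) <= state_norm s + gamma.+2)%N.
Proof.
case: s => -[x y] z; rewrite /model_tgt.
do 5?[case: i => [|i] /=]; rewrite /state_norm; last by rewrite ?nth_nil/= leq_addr.
- by case: ifP => _; lia.
- by case: ifP => _; lia.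
- case: x => [|x] /=; first by case: ifP => _; lia.
  rewrite /sgz; case: (y == 0); [lia|]; case: ifP => _; lia.
- by case: ifP => _; lia.
- lia.
Qed.

(** The added [r] ensures positivity and accounts for the arrival rate; the divisor normalises the
    growth per jump to at most 1, as the birth chain comparison requires. *)
Definition rate_size (s : model_state) : R := ((state_norm s)%:R + r) / gamma.+2%:R.

Lemma rate_size_gt0 s : 0 < rate_size s.
Proof. by rewrite divr_gt0// ltr_wpDl. Qed.

Lemma rate_size_tgt s i : rate_size (model_tgt s i) <= rate_size s + 1.
Proof.
rewrite /rate_size ler_pdivrMr// mulrDl divfK ?pnatr_eq0// mul1r addrAC lerD2r.
by rewrite -natrD ler_nat state_norm_tgt.
Qed.

Definition rate_const : R := gamma.+2%:R * (lambda + beta + eps + mu).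

Lemma rate_const_gt0 : 0 < rate_const.
Proof. by rewrite mulr_gt0// !addr_gt0. Qed.

Lemma total_model_rate_le s : q s <= (lambda + beta + eps + mu) * ((state_norm s)%:R + r).
Proof.
have H (a b c d : R) : 0 < a -> 0 < b -> 0 < c -> 0 < d ->
    [/\ a <= a + b + c + d, b <= a + b + c + d, c <= a + b + c + d & d <= a + b + c + d].
  by split; lra.
have [? ? ? ?] := H _ _ _ _ lambda_gt0 beta_gt0 eps_gt0 mu_gt0.
case: s => -[x y] z; rewrite total_model_rate /state_norm !natrD.
rewrite natr_absz intr_norm.
rewrite [leRHS](_ : _ = (lambda + beta + eps + mu) * r + (lambda + beta + eps + mu) * x%:R +
  (lambda + beta + eps + mu) * `|y%:~R| + (lambda + beta + eps + mu) * z%:R); last by ring.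
by rewrite !lerD//; (apply: ler_wpM2r; [by []||exact: ltW|assumption]).
Qed.

Lemma total_rate_size s : q s <= rate_const * rate_size s.
Proof.
apply: (le_trans (total_model_rate_le s)).
rewrite [leRHS](_ : _ = (lambda + beta + eps + mu) * ((state_norm s)%:R + r))//.
have : gamma.+2%:R != 0 :> R by rewrite pnatr_eq0.
by rewrite /rate_const /rate_size; move: gamma.+2%:R => g g0; field.
Qed.

Local Notation nonexplosive := (nonexplosive 5 model_rate model_tgt).

Lemma model_nonexplosive s : lam (~` nonexplosive s) = 0%E.
Proof.
exact: (lam_nonexplosive model_rate_ge0 total_model_rate_gt0 rate_const_gt0
  rate_size_gt0 total_rate_size rate_size_tgt).
Qed.

Lemma generator_jump s s' : generator ev s s' = jump_generator 5 model_rate model_tgt s s'.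
Proof.
case: s => -[x y] z; rewrite /generator /jump_generator (big_nth (0, (x, y, z))) big_mkord.
by apply: eq_bigr.
Qed.

Let dead : model_state := (0%N, 0%R, 0%N).
Local Notation traj := (trajectory 5 model_rate model_tgt dead).

(* On the null set of explosion the path is frozen. *)
Definition model_path (s0 : model_state) (t w : R) : model_state :=
  if `[< nonexplosive s0 w >] then traj s0 w t else s0.

Lemma model_pathE s0 t w : nonexplosive s0 w ->
  model_path s0 t w = traj s0 w t.
Proof. by move=> h; rewrite /model_path asboolT. Qed.

Lemma model_markov_process (s0 : model_state) (th : R -> R) :
  measurable_fun setT th ->
  (forall B, measurable B -> lam (th @^-1` B) = lam B) ->
  markov_process lam ev s0 (fun t w => model_path s0 t (th w)).
Proof.
move=> mth lam_th.
have rg0 := model_rate_ge0; have qg0 := total_model_rate_gt0.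
have mNE : measurable (nonexplosive s0) by exact: measurable_nonexplosive.
have mtraj t (A : set model_state) : measurable [set w | A (traj s0 w t)].
  exact: (measurable_trajectory model_tgt dead rg0 qg0 (@measurable_id _ _ setT) (@measurable_cst _ _ _ _ _ t)).
have mpath t (A : set model_state) : measurable [set w | A (model_path s0 t w)].
  rewrite (_ : mkset _ = (nonexplosive s0 `&` [set w | A (traj s0 w t)]) `|`
    (~` nonexplosive s0 `&` [set _ | A s0])).
    apply: measurableU; apply: measurableI => //; last exact: measurable_cst_prop.
    exact: measurableC.
  apply/seteqP; split => w /=; rewrite /model_path.
    by case: asboolP => h; [left|right].
  by case: asboolP => h [] [].
split.
- by move=> t A t0; exact: (measurable_preimage mth (mpath t A)).
- move=> w; rewrite /model_path; case: asboolP => // _.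
  apply: (trajectory_before model_tgt dead qg0).
  by rewrite lexx hold_gt0.
- move=> w; rewrite /model_path; case: asboolP => h.
    by have [h1 h2] := nonexplosive_rcll dead qg0 h.
  by split=> t _; [exact: nearW|exists s0; exact: nearW].
exists (transition 5 model_rate model_tgt dead); split.
  move=> s s'; have [M HM] := transition_derivative model_tgt dead rg0 qg0 s s'.
  apply/cvgrPdist_le => e e0; near=> h.
  have h0 : 0 < h by near: h; exact: nbhs_right_gt.
  rewrite generator_jump distrC.
  have -> : (transition 5 model_rate model_tgt dead h s s' - (s == s')%:R) / h -
      jump_generator 5 model_rate model_tgt s s' =
      (transition 5 model_rate model_tgt dead h s s' - (s == s')%:R -
       h * jump_generator 5 model_rate model_tgt s s') / h.
    by field; rewrite gt_eqF.
  rewrite normrM normfV (gtr0_norm h0) ler_pdivrMr//; apply: (le_trans (HM h h0)).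
  rewrite expr2 mulrA ler_pM2r//; apply: (@le_trans _ _ ((`|M| + 1) * h)).
    by apply: ler_wpM2r; [exact: ltW|have := ler_norm M; lra].
  have M0 : 0 < `|M| + 1 by rewrite ltr_wpDl.
  rewrite mulrC -ler_pdivlMr//; near: h; apply: nbhs_right_le.
  by rewrite divr_gt0.
move=> t h past s s' t0 h0 past_t H.
pose Hp : set R := [set w | model_path s0 t w = s /\
   forall us : R * model_state, us \in past -> model_path s0 us.1 w = us.2].
pose Ht : set R := [set w | traj s0 w t = s /\
   forall us : R * model_state, us \in past -> traj s0 w us.1 = us.2].
pose Fp : set R := [set w | model_path s0 (t + h) w = s'].
pose Ft : set R := [set w | traj s0 w (t + h) = s'].
have mHp : measurable Hp.
  apply: (measurableI [set w | model_path s0 t w = s]); first exact: (mpath t (fun x => x = s)).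
  by apply: measurable_forall_in => us _; exact: (mpath us.1 (fun x => x = us.2)).
have mHt : measurable Ht.
  apply: (measurableI [set w | traj s0 w t = s]); first exact: (mtraj t (fun x => x = s)).
  by apply: measurable_forall_in => us _; exact: (mtraj us.1 (fun x => x = us.2)).
have mFp : measurable Fp by exact: (mpath _ (fun x => x = s')).
have mFt : measurable Ft by exact: (mtraj _ (fun x => x = s')).
have null := lam_eq_nonexplosive rg0 qg0 model_nonexplosive (s := s0).
have hp w : nonexplosive s0 w -> Hp w <-> Ht w.
  by move=> ne; rewrite /Hp /Ht /=; split => -[<- h2];
    (split; first by rewrite model_pathE); move=> us /h2 <-; rewrite model_pathE.
have hf w : nonexplosive s0 w -> Fp w <-> Ft w.
  by move=> ne; rewrite /Fp /Ft /= model_pathE.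
transitivity (lam (th @^-1` (Hp `&` Fp))) => //.
rewrite [in RHS](_ : H = th @^-1` Hp)// lam_th; last exact: measurableI.
rewrite (null (Hp `&` Fp) (Ht `&` Ft)); [|exact: measurableI|exact: measurableI|]; last first.
  by move=> w ne; split => -[/hp h1 /hf h2]; split; auto.
rewrite [X in _ = (X * _)%E](lam_th Hp mHp : _ = lam Hp) [X in _ = (X * _)%E](null Hp Ht)//.
exact: (@markov_trajectory _ _ _ _ _ dead rg0 qg0 model_nonexplosive s0 t past s h s' t0 h0 past_t).
Unshelve. all: by end_near. Qed.

End model.

(** * Drifts along paths *)

Section path_drift.
Context {R : realType} {St : countType}.
Variables (n : nat) (rate : St -> nat -> R) (tgt : St -> nat -> St).
Hypothesis rate_ge0 : forall s i, 0 <= rate s i.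
Local Notation q := (total_rate n rate).
Hypothesis q_gt0 : forall s, 0 < q s.
Local Notation noise c m s w := (noise n rate tgt c m s w).
Local Notation mean_mark := (mean_mark n rate).
Local Notation S s w j := (jump_state n rate tgt j s w).
Local Notation T s w j := (jump_time n rate tgt j s w).
Local Notation e s w j := (mark n rate (S s w j) (iter j rest w)).
Implicit Types (c : St -> nat -> R) (s : St) (w t u : R).

Definition drift c s : R := \sum_(i < n) rate s i * c s i.

Lemma driftE c s : drift c s = q s * mean_mark c s.
Proof.
rewrite /drift /mean_mark mulr_sumr; apply: eq_bigr => i _.
by field; rewrite gt_eqF.
Qed.

Lemma mean_mark_cst1 s : mean_mark (fun _ _ => 1) s = 1.
Proof.
rewrite /mean_mark; under eq_bigr do rewrite mulr1.
exact: sum_probabilities.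
Qed.

(** The compensator [mean_mark * clock] is the drift times the holding time, so the marks add up to
    noise plus the integral of the drift between jump times. *)
Lemma sum_marks_noise c s w m k : (m <= k)%N ->
  \sum_(m <= j < k) c (S s w j) (e s w j) = noise c k s w - noise c m s w +
    \sum_(m <= j < k) drift c (S s w j) * (T s w j.+1 - T s w j).
Proof.
move=> mk; rewrite -(telescope_sumr (fun j => noise c j s w)) // -big_split.
apply: eq_bigr => j _; cbv beta; rewrite (noiseS n rate tgt c j) jump_timeS driftE /hold.
by rewrite /=; field; rewrite gt_eqF.
Qed.

Variables (s0 : St) (w delta Lam : R) (N : nat).
Hypotheses (Lam_gt0 : 0 < Lam) (Lam_q : forall s, Lam <= q s).
Hypothesis noise1 : forall m, (m <= N)%N -> `|noise (fun _ _ => 1) m s0 w| <= delta.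

(** With the constant mark 1 the noise has increments [1 - clock], so a bound on it at two
    successive jumps bounds a single clock. *)
Lemma hold_le j : (j < N)%N -> T s0 w j.+1 - T s0 w j <= (1 + 2 * delta) / Lam.
Proof.
move=> jN; rewrite jump_timeS [X in X - _]addrC addrK /hold.
have h1 := noise1 jN; have h0 := noise1 (ltnW jN).
have : clock (iter j rest w) <= 1 + 2 * delta.
  by move: h1 h0; rewrite noiseS mean_mark_cst1 mul1r !ler_norml; lra.
move=> h; apply: ler_pM; [exact/ltW/clock_gt0|by rewrite invr_ge0 ltW|exact: h|].
by rewrite lef_pV2 ?posrE.
Qed.

Lemma state_between t u m k j : is_njumps n rate tgt s0 w t m -> is_njumps n rate tgt s0 w u k ->
  t <= u -> (m <= j <= k)%N -> exists2 v, t <= v <= u & is_njumps n rate tgt s0 w v j.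
Proof.
move=> /andP[mt tm] /andP[ku uk] tu /andP[mj jk].
have [->|mj'] := eqVneq j m; first by exists t; rewrite /is_njumps ?lexx ?mt.
have {}mj : (m < j)%N by rewrite ltn_neqAle eq_sym mj'.
exists (T s0 w j).
  apply/andP; split.
    by apply: (le_trans (ltW tm)); exact: (jump_time_homo tgt q_gt0 s0 w mj).
  by apply: le_trans ku; exact: (jump_time_homo tgt q_gt0 s0 w jk).
by rewrite /is_njumps lexx (jump_time_lt tgt q_gt0).
Qed.

(** Requiring only an upper bound [a * c] on the increments of [V] lets one statement cover exact
    and one-sided cases. The last two terms are the distance from [t] and [u] to the jumps before
    them and the noise at both ends. *)
Lemma path_drift c (V : St -> R) (P : St -> Prop) (a hi t u : R) m k :
  (forall j, (j <= N)%N -> `|noise c j s0 w| <= delta) ->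
  (forall s i, P s -> 0 < rate s i -> (i < n)%N -> V (tgt s i) - V s <= a * c s i) ->
  is_njumps n rate tgt s0 w t m -> is_njumps n rate tgt s0 w u k -> (k < N)%N -> t <= u ->
  (forall v j, t <= v <= u -> is_njumps n rate tgt s0 w v j ->
    P (S s0 w j) /\ a * drift c (S s0 w j) <= hi) ->
  V (S s0 w k) - V (S s0 w m) <=
    hi * (u - t) + `|hi| * ((1 + 2 * delta) / Lam) + 2 * (`|a| * delta).
Proof.
move=> noise_c V_c tm uk kN tu hP.
have mk : (m <= k)%N.
  rewrite leqNgt; apply/negP => km; move: tm uk => /andP[tm _] /andP[_ uk].
  have := lt_le_trans uk (le_trans (jump_time_homo tgt q_gt0 s0 w km) tm).
  by rewrite ltNge tu.
have PS j : (m <= j <= k)%N -> P (S s0 w j) /\ a * drift c (S s0 w j) <= hi.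
  by move=> /(state_between tm uk tu)[v tvu vj]; exact: (hP v j).
have h1 : V (S s0 w k) - V (S s0 w m) <= a * \sum_(m <= j < k) c (S s0 w j) (e s0 w j).
  rewrite -(telescope_sumr (fun j => V (S s0 w j)))// mulr_sumr.
  rewrite big_nat_cond [leRHS]big_nat_cond; apply: ler_sum => j; rewrite andbT => /andP[mj jk].
  cbv beta; rewrite jump_stateS; apply: V_c.
  - by have [] := PS j; rewrite ?mj ?(ltnW jk).
  - exact: (rate_mark_gt0 rate_ge0 q_gt0).
  - exact: mark_lt.
have h2 : a * \sum_(m <= j < k) c (S s0 w j) (e s0 w j) <=
    2 * (`|a| * delta) + hi * (T s0 w k - T s0 w m).
  rewrite sum_marks_noise// mulrDr; apply: lerD.
    apply: (le_trans (ler_norm _)); rewrite normrM mulrCA; apply: ler_wpM2l => //.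
    have := noise_c _ (ltnW kN); have := noise_c _ (leq_trans mk (ltnW kN)).
    by rewrite !ler_norml; lra.
  rewrite -(telescope_sumr (fun j => T s0 w j))// !mulr_sumr.
  rewrite big_nat_cond [leRHS]big_nat_cond; apply: ler_sum => j; rewrite andbT => /andP[mj jk].
  rewrite mulrA; apply: ler_wpM2r.
    by rewrite subr_ge0; exact/ltW/(jump_time_lt tgt q_gt0).
  by have [] := PS j; rewrite ?mj ?(ltnW jk).
(* The differences [t - T m] and [u - T k] both lie between 0 and one holding time. *)
have h3 : hi * (T s0 w k - T s0 w m) <= hi * (u - t) + `|hi| * ((1 + 2 * delta) / Lam).
  rewrite -lerBlDl -mulrBr; apply: (le_trans (ler_norm _)); rewrite normrM.
  apply: ler_wpM2l => //.
  have := hold_le kN; have := hold_le (leq_ltn_trans mk kN).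
  by move: tm uk => /andP[? ?] /andP[? ?]; rewrite ler_norml; lra.
lra.
Qed.

End path_drift.

(** * Marks and drifts of the model *)

Section model_drifts.
Context {R : realType}.
Variables (lambda beta mu eps alpha : R) (gamma : nat) (r : R).
Hypotheses (gamma_gt0 : (0 < gamma)%N).
Local Notation rate := (model_rate lambda beta mu eps alpha gamma r).
Local Notation tgt := (model_tgt lambda beta mu eps alpha gamma r).
Local Notation q := (total_rate 5 rate).
Implicit Types (s : model_state) (i : nat).

Definition pending s : R := let: (x, _, _) := s in x%:R.
Definition imbalance s : R := let: (_, y, _) := s in y%:~R.
Definition occupancy s : R := let: (_, y, z) := s in `|y%:~R| + 2 * z%:R.

Definition unit_mark (s : model_state) (i : nat) : R := 1.
Definition imbalance_mark (s : model_state) (i : nat) : R := nth 0 [:: -1; 1; 0; 1; 0] i.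
(** Half of the increments of [occupancy], to stay within the bound 1 on marks. They depend on the
    event alone: whether one queues or is matched, [|y| + 2 z] changes by the same amount. *)
Definition occupancy_mark (s : model_state) (i : nat) : R :=
  nth 0 [:: 2^-1; 2^-1; 0; - 2^-1; -1] i.
(** The opposite of the change of [pending] at an additional event when an invitation is pending. *)
Definition additional_mark (s : model_state) (i : nat) : R :=
  if i == 2%N then Num.sg (imbalance s) else 0.

Lemma unit_mark_le1 s i : `|unit_mark s i| <= 1.
Proof. by rewrite normr1. Qed.

Lemma imbalance_mark_le1 s i : `|imbalance_mark s i| <= 1.
Proof. by rewrite /imbalance_mark; do 5?[case: i => [|i] /=]; rewrite ?nth_nil ?normrN ?normr1 ?normr0. Qed.

Lemma occupancy_mark_le1 s i : `|occupancy_mark s i| <= 1.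
Proof.
rewrite /occupancy_mark; do 5?[case: i => [|i] /=];
  rewrite ?nth_nil ?normrN ?normr1 ?normr0// ger0_norm//; lra.
Qed.

Lemma additional_mark_le1 s i : `|additional_mark s i| <= 1.
Proof.
rewrite /additional_mark; case: ifP => _; last by rewrite normr0.
by rewrite normr_sg; case: (_ != 0).
Qed.

Lemma imbalance_tgt s i : (i < 5)%N -> imbalance (tgt s i) - imbalance s = imbalance_mark s i.
Proof.
case: s => -[x y] z; rewrite /imbalance_mark /model_tgt.
do 5?[case: i => [_|i] /=] => //; rewrite ?intrD ?intrB; lra.
Qed.

(** A positive rate excludes completions at [z = 0], where [z.-1] would not decrease. *)
Lemma occupancy_tgt s i : (i < 5)%N -> 0 < rate s i -> occupancy (tgt s i) - occupancy s = 2 * occupancy_mark s i.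
Proof.
case: s => -[x y] z; rewrite /occupancy_mark /model_tgt /model_rate.
have abs_up : 0 <= y -> `|(y + 1)%:~R| = `|y%:~R| + 1 :> R.
  by move=> y0; rewrite intrD !ger0_norm ?addr_ge0 ?ler0z.
have abs_down : y <= 0 -> `|(y - 1)%:~R| = `|y%:~R| + 1 :> R.
  by move=> y0; rewrite intrB !ler0_norm ?subr_le0 ?lerz0//; [lra|rewrite (le_trans (y := 0)) ?lerz0].
have abs_up' : y < 0 -> `|(y + 1)%:~R| = `|y%:~R| - 1 :> R.
  by move=> y0; rewrite intrD !ler0_norm ?ler_pDr ?lerz0 -?intrD ?lerz0; [rewrite intrD; lra|lia..].
have abs_down' : 0 < y -> `|(y - 1)%:~R| = `|y%:~R| - 1 :> R.
  by move=> y0; rewrite !ger0_norm ?ler0z; [rewrite intrB; lra|lia..].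
have zS : 0 < mu * z%:R -> z%:R = z.-1%:R + 1 :> R.
  by case: z => [|z _] /=; rewrite ?mulr0 ?ltxx// -natr1.
have z0 a : 0 < mu * z%:R * a -> z%:R = z.-1%:R + 1 :> R.
  by case: z {zS} => [|z _] /=; rewrite ?(mulr0, mul0r) ?ltxx// -natr1.
do 5?[case: i => [_|i] /=] => //.
- move=> _; case: ltP => hy; first by rewrite abs_down'// -[z.+1%:R]natr1; lra.
  by rewrite abs_down//; lra.
- move=> _; case: ltP => hy; first by rewrite abs_up'// -[z.+1%:R]natr1; lra.
  by rewrite abs_up//; lra.
- by lra.
- move=> /z0 zE; case: ltP => hy; first by rewrite abs_up'//; lra.
  by rewrite abs_up//; lra.
- by move=> /z0 zE; lra.
Qed.

Let natr_subn_ge (x g : nat) : x%:R - g%:R <= (x - g)%:R :> R.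
Proof. by rewrite lerBlDr -natrD ler_nat; lia. Qed.

Let additional_pending (x : nat) (y : int) : (0 < x)%N ->
  `|(x%:Z - sgz y)%R|%N%:R = x%:R - Num.sg (y%:~R : R) :> R.
Proof.
move=> x0; rewrite natr_absz ger0_norm; last by rewrite /sgz; case: (y == 0); [|case: ifP => _]; lia.
rewrite intrB; congr (_ - _).
by case: (ltgtP y 0) => [y0|y0|->]; rewrite /sgz ?sgr0 ?eqxx// ?(lt_eqF y0) ?(gt_eqF y0);
  [rewrite y0 ltr0_sg ?ltrz0|rewrite ltNge (ltW y0)/= gtr0_sg ?ltr0z].
Qed.

Lemma pending_tgt_le s i : (i < 5)%N -> `|pending (tgt s i) - pending s| <= gamma%:R.
Proof.
have g1 : 1 <= gamma%:R :> R by rewrite ler1n.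
case: s => -[x y] z; rewrite /model_tgt.
have sub : `|(x - gamma)%:R - x%:R| <= gamma%:R :> R.
  rewrite ler_norml; have := natr_subn_ge x gamma.
  have : (x - gamma)%:R <= x%:R :> R by rewrite ler_nat leq_subr.
  lra.
do 5?[case: i => [_|i] /=] => //.
- by rewrite natrD [X in X - _]addrC addrK ger0_norm.
- case: ifP => x0.
    by rewrite additional_pending// [X in X - _]addrC addrK normrN normr_sg; rewrite ler_nat; case: (_ != 0); lia.
  move: x0; case: (x) => // _.
  by case: ifP => _; rewrite subr0 ?normr1 ?normr0//.
- by rewrite subrr normr0; lra.
Qed.

(** Truncation at zero is all that can break the cancellation of the [gamma] terms, and it always
    raises [pending]; at [x = 0] the additional event likewise removes nothing. *)
Lemma pending_imbalance_tgt_ge s i : (i < 5)%N ->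
  - (pending (tgt s i) + gamma%:R * imbalance (tgt s i)) - - (pending s + gamma%:R * imbalance s)
   <= additional_mark s i.
Proof.
move=> i5; have := imbalance_tgt s i5; rewrite /imbalance_mark /additional_mark.
move: i5; case: s => -[x y] z; rewrite /model_tgt.
have sub := natr_subn_ge x gamma.
do 5?[case: i => [_|i] /=] => //.
- by rewrite natrD => h; nra.
- by move=> h; nra.
- move=> _; case: ifP => x0.
    by rewrite additional_pending//; lra.
  move: x0; case: (x) => // _.
  case: ltP => y0; first by rewrite ltr0_sg ?ltrz0//; lra.
  have : 0 <= Num.sg (y%:~R : R) by rewrite sgr_ge0 ler0z.
  lra.
- by move=> h; nra.
- by move=> h; lra.
Qed.

(** With [gamma] invitations pending nothing is truncated, and [gamma > 0] puts the additional event
    in its regular case. *)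
Lemma pending_imbalance_tgt_le s i : (i < 5)%N -> gamma%:R <= pending s ->
  pending (tgt s i) + gamma%:R * imbalance (tgt s i) - (pending s + gamma%:R * imbalance s)
   <= - additional_mark s i.
Proof.
move=> i5; have := imbalance_tgt s i5; rewrite /imbalance_mark /additional_mark.
move: i5; case: s => -[x y] z; rewrite /model_tgt.
do 5?[case: i => [_|i] /=] => //; rewrite ?ler_nat.
- by rewrite natrD => h _; nra.
- by move=> h gx; rewrite natrB//; nra.
- by move=> _ gx; rewrite (leq_trans gamma_gt0 gx) additional_pending ?(leq_trans gamma_gt0)//; lra.
- by move=> h gx; rewrite natrB//; nra.
- by move=> h _; lra.
Qed.

Lemma drift_unit s : drift 5 rate unit_mark s = q s.
Proof. by rewrite /drift /unit_mark; under eq_bigr do rewrite mulr1. Qed.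

Lemma drift_imbalance s : drift 5 rate imbalance_mark s =
  beta * pending s + alpha * mu * (2^-1 * (occupancy s - `|imbalance s|)) - lambda * r.
Proof.
case: s => -[x y] z; rewrite /drift !big_ord_recl big_ord0 /imbalance_mark /model_rate /=.
by field.
Qed.

Lemma drift_occupancy s : 2 * drift 5 rate occupancy_mark s =
  lambda * r + beta * pending s + (alpha - 2) * mu * (2^-1 * (occupancy s - `|imbalance s|)).
Proof.
case: s => -[x y] z; rewrite /drift !big_ord_recl big_ord0 /occupancy_mark /model_rate /=.
by field.
Qed.

Lemma drift_additional s : drift 5 rate additional_mark s = eps * imbalance s.
Proof.
case: s => -[x y] z; rewrite /drift !big_ord_recl big_ord0 /additional_mark /model_rate /=.
rewrite !mulr0 !add0r !addr0 [RHS](_ : _ = eps * (Num.sg (y%:~R : R) * `|y%:~R|)); first ring.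
by rewrite mulr_sg_norm.
Qed.

End model_drifts.

(** * The good event *)

(** [expR x] is the square of [expR (x / 2)], itself at least [x / 2]. Exponential tails become of
    order [1 / r ^+ 2], which leaves order [1 / r] after a sum over order [r] jumps. *)
Lemma expRN_le_sqr {R : realType} (x : R) : 0 < x -> expR (- x) <= 4 / x ^+ 2.
Proof.
move=> x0; rewrite expRN -[leRHS]invrK invf_div lef_pV2 ?posrE ?expR_gt0 ?divr_gt0 ?exprn_gt0//.
have -> : x ^+ 2 / 4 = (x / 2) ^+ 2 by field.
have -> : expR x = expR (x / 2) ^+ 2 by rewrite -expRM_natl; congr expR; field.
rewrite ler_sqr ?nnegrE ?expR_ge0 ?divr_ge0 ?(ltW x0)//.
by have := expR_ge1Dx (x / 2); lra.
Qed.

Lemma lam_setCI {R : realType} (A B : set R) : measurable A -> measurable B ->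
  (lam (~` (A `&` B)) <= lam (~` A) + lam (~` B))%E.
Proof.
by move=> mA mB; rewrite setCI; apply: measureU2; exact: measurableC.
Qed.

Section good_event.
Context {R : realType}.
Variables (lambda beta mu eps alpha : R) (gamma : nat).
Hypotheses (lambda_gt0 : 0 < lambda) (beta_gt0 : 0 < beta) (mu_gt0 : 0 < mu)
  (eps_gt0 : 0 < eps) (alpha_ge0 : 0 <= alpha) (alpha_lt1 : alpha < 1)
  (gamma_gt0 : (0 < gamma)%N).
Local Notation rate r := (model_rate lambda beta mu eps alpha gamma r).
Local Notation tgt r := (model_tgt lambda beta mu eps alpha gamma r).
Local Notation q r := (total_rate 5 (rate r)).
Local Notation noise r c m s w := (noise 5 (rate r) (tgt r) c m s w).
Local Notation T r m s w := (jump_time 5 (rate r) (tgt r) m s w).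
Local Notation path r s t w := (model_path lambda beta mu eps alpha gamma r s t w).

Let rg0 r : 0 < r -> forall s i, 0 <= rate r s i.
Proof. by move=> r0 s i; exact: model_rate_ge0. Qed.

Let qg0 r : 0 < r -> forall s, 0 < q r s.
Proof. by move=> r0 s; exact: total_model_rate_gt0. Qed.

Definition small_noise (r : R) (c : model_state -> nat -> R) s0 (eta : R) N : set R :=
  [set w | forall m, (m <= N)%N -> `|noise r c m s0 w| <= eta * r].

Definition good (r : R) s0 (H eta : R) N : set R :=
  nonexplosive 5 (rate r) (tgt r) s0 `&` ([set w | H < T r N s0 w] `&`
  (small_noise r unit_mark s0 eta N `&` (small_noise r imbalance_mark s0 eta N `&`
  (small_noise r occupancy_mark s0 eta N `&` small_noise r additional_mark s0 eta N)))).

Lemma measurable_small_noise r c s0 eta N : 0 < r -> measurable (small_noise r c s0 eta N).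
Proof.
move=> r0; rewrite /small_noise.
rewrite (_ : mkset _ = \bigcap_(m in [set m | (m <= N)%N]) [set w | `|noise r c m s0 w| <= eta * r]); last first.
  by apply/seteqP; split => w h m; exact: h.
apply: bigcap_measurable; first by exists 0%N.
move=> m _.
apply: measurable_le_set => //.
  apply: measurableT_comp => //.
  by apply: measurable_noise; [exact: model_rate_ge0|exact: total_model_rate_gt0].
Qed.

Lemma measurable_good r s0 H eta N : 0 < r -> measurable (good r s0 H eta N).
Proof.
move=> r0; apply: measurableI.
  by apply: measurable_nonexplosive; [exact: model_rate_ge0|exact: total_model_rate_gt0].
apply: measurableI; last by do 3?[apply: measurableI]; exact: measurable_small_noise.
apply: measurable_lt_set => //.
  by apply: measurable_jump_time; [exact: model_rate_ge0|exact: total_model_rate_gt0].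
Qed.

Definition njumps_max (K r : R) : nat := (Num.truncn (K * r)).+1.

Lemma njumps_max_ge K r : K * r <= (njumps_max K r)%:R.
Proof. exact/ltW/truncnS_gt. Qed.

Lemma njumps_max_le K r : 0 <= K -> 1 <= r -> (njumps_max K r)%:R <= (K + 1) * r.
Proof.
move=> K0 r1; have Kr : 0 <= K * r by rewrite mulr_ge0//; lra.
have : (Num.truncn (K * r))%:R <= K * r by rewrite truncn_le.
by rewrite /njumps_max -natr1; lra.
Qed.

(** For at most [(K + 1) * r] jumps, [th = eta / (8 * (K + 1))] minimises the exponent
    [4 * th ^+ 2 * m - th * eta * r] of the noise tail at its worst [m]; the cap [2^-1] is the range
    of that bound. The quadratic term then costs at most half of the linear one, which leaves
    [- decay * r]. *)
Definition tilt (eta K : R) : R := Num.min 2^-1 (eta / (8 * (K + 1))).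
Definition decay (eta K : R) : R := tilt eta K * eta / 2.

Lemma decay_gt0 eta K : 0 < eta -> 0 <= K -> 0 < decay eta K.
Proof.
move=> e0 K0; rewrite !divr_gt0 ?mulr_gt0// lt_min invr_gt0 ltr0n/=.
by rewrite divr_gt0// mulr_gt0//; lra.
Qed.

Lemma lam_small_noise r c s0 eta K : (forall s i, `|c s i| <= 1) ->
  0 < eta -> 0 <= K -> 1 <= r ->
  (lam (~` small_noise r c s0 eta (njumps_max K r)) <=
    (8 * (K + 2) / decay eta K ^+ 2 / r)%:E)%E.
Proof.
move=> c1 e0 K0 r1; have r0 : 0 < r by lra.
have d0 := decay_gt0 e0 K0.
set N := njumps_max K r; pose th := tilt eta K.
have th0 : 0 < th.
  by rewrite lt_min invr_gt0 ltr0n/= divr_gt0// mulr_gt0//; lra.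
have th2 : th <= 2^-1 by rewrite /th /tilt ge_min lexx.
have the : th * (8 * (K + 1)) <= eta.
  by rewrite -ler_pdivlMr ?mulr_gt0//; [rewrite /th /tilt ge_min lexx orbT|lra].
have NK : N%:R <= (K + 1) * r by exact: njumps_max_le.
have mS m : measurable [set w | eta * r <= `|noise r c m s0 w|].
  apply: measurable_le_set => //.
    apply: measurableT_comp => //.
    by apply: measurable_noise; [exact: model_rate_ge0|exact: total_model_rate_gt0].
apply: (@le_trans _ _ (lam (\big[setU/set0]_(m < N.+1) [set w | eta * r <= `|noise r c m s0 w|]))).
  apply: le_measure; rewrite ?inE.
  - by apply: measurableC; exact: measurable_small_noise.
  - exact: bigsetU_measurable.
  - rewrite -(bigcup_mkord N.+1 (fun m => [set w | eta * r <= `|noise r c m s0 w|])) => w /= /existsNP[m /not_implyP[mN /negP]].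
    by rewrite -ltNge => h; exists m => //=; exact: ltW.
apply: (le_trans (@Boole_inequality _ _ _ lam (fun m => [set w | eta * r <= `|noise r c m s0 w|]) N.+1 (fun m _ => mS m))).
apply: (@le_trans _ _ (\sum_(m < N.+1) (2 * expR (- (decay eta K * r)))%:E)%E).
  apply: lee_sum => m _.
  have th_itv : 0 < th <= 2^-1 by rewrite th0.
  apply: (le_trans (noise_tail _ _ _ c1 _ _ _ th_itv)).
  - exact: model_rate_ge0.
  - exact: total_model_rate_gt0.
  rewrite lee_fin ler_pM2l// ler_expR /decay -/th.
  have mN : m%:R <= (K + 1) * r by apply: le_trans NK; rewrite ler_nat -ltnS.
  have : 4 * th ^+ 2 * m%:R <= th * eta / 2 * r.
    apply: (@le_trans _ _ (4 * th ^+ 2 * ((K + 1) * r))).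
      by rewrite ler_wpM2l// mulr_ge0// sqr_ge0.
    rewrite (_ : 4 * th ^+ 2 * ((K + 1) * r) = (th * r / 2) * (th * (8 * (K + 1)))); last by field.
    rewrite (_ : th * eta / 2 * r = (th * r / 2) * eta); last by field.
    by rewrite ler_wpM2l// divr_ge0// mulr_ge0// ltW.
  lra.
rewrite sumEFin sumr_const card_ord -[X in X%:E](mulr_natl _ N.+1) lee_fin.
have h1 : N.+1%:R <= (K + 2) * r by rewrite -natr1; lra.
have h2 := expRN_le_sqr (mulr_gt0 d0 r0).
apply: (@le_trans _ _ ((K + 2) * r * (2 * (4 / (decay eta K * r) ^+ 2)))).
  by apply: ler_pM; rewrite // ?mulr_ge0 ?expR_ge0// ler_pM2l.
by rewrite le_eqVlt; apply/orP; left; apply/eqP; field; rewrite !gt_eqF.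
Qed.

Local Notation C := (rate_const lambda beta mu eps gamma).

(** In units of [r], [B + 1] bounds the initial size and 2 bounds the exponent [L] of the tail
    estimate. The other factor forces the ratio in that estimate below [1 / (2 * expR (C * H))],
    which beats the growth [expR (C * H)]. *)
Definition njumps_factor (B H : R) : R := (B + 3) * (2 * expR (C * H)).

Lemma njumps_factor_ge0 B H : 0 <= B -> 0 <= njumps_factor B H.
Proof. by move=> B0; apply: mulr_ge0; [lra|apply: mulr_ge0; rewrite ?expR_ge0]. Qed.

Lemma lam_njumps_max r s0 B H : 0 <= B -> 1 <= r -> (state_norm s0)%:R <= B * r ->
  (lam (~` [set w | (H < T r (njumps_max (njumps_factor B H) r) s0 w)%R]) <= (r^-1)%:E)%E.
Proof.
move=> B0 r1 sB; have r0 : 0 < r by lra.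
set K := njumps_factor B H; set N := njumps_max K r.
have K0 : 0 <= K by exact: njumps_factor_ge0.
rewrite (_ : ~` _ = [set w | (T r N s0 w <= H)%R]); last first.
  apply/seteqP; split => w; first by move=> /negP; rewrite -leNgt.
  by rewrite /mkset leNgt => /negP.
(* An exponent of order [r] brings the tail down to [2^-1 ^+ L], at most [1 / r] because
   [r <= L <= 2 ^ L]. *)
pose L := njumps_max 1 r.
have C0 : 0 < C by exact: rate_const_gt0.
apply: (le_trans (jump_time_tail (rg0 r0) (qg0 r0) C0 (size := rate_size gamma r) _ _ _ L N s0 H)).
- by move=> s; exact: rate_size_gt0.
- by move=> s; exact: total_rate_size.
- by move=> s i; exact: rate_size_tgt.
rewrite lee_fin.
have Lr : r <= L%:R by have := njumps_max_ge 1 r; rewrite mul1r.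
have Lr2 : L%:R <= 2 * r by have := njumps_max_le ler01 r1; lra.
pose x := rate_size gamma r s0 + L%:R.
have x0 : 0 < x by rewrite addr_gt0 ?rate_size_gt0//; lra.
have xB : x <= (B + 3) * r.
  have : rate_size gamma r s0 <= (B + 1) * r.
    rewrite /rate_size ler_pdivrMr//.
    have g1 : 1 <= gamma.+2%:R :> R by rewrite ler1n.
    apply: (@le_trans _ _ ((B + 1) * r)); first lra.
    by rewrite ler_peMr// mulr_ge0//; lra.
  by rewrite /x; lra.
have NK : K * r <= N%:R by exact: njumps_max_ge.
have ratio : x / (x + N%:R) <= (2 * expR (C * H))^-1.
  have e0 : 0 < 2 * expR (C * H) by rewrite mulr_gt0 ?expR_gt0.
  have xN : 0 < x + N%:R by rewrite ltr_wpDr.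
  rewrite ler_pdivrMr// mulrC ler_pdivlMr//.
  apply: (@le_trans _ _ (K * r)); last by apply: (le_trans NK); rewrite lerDr ltW.
  have -> : K * r = (B + 3) * r * (2 * expR (C * H)) by rewrite /K /njumps_factor mulrAC.
  by rewrite ler_pM2r.
rewrite -/x.
have -> : expR (C * L%:R * H) = expR (C * H) ^+ L.
  by rewrite -expRM_natl; congr expR; ring.
rewrite -exprMn.
apply: (@le_trans _ _ (2^-1 ^+ L)).
  have xN : 0 <= x / (x + N%:R) by apply: divr_ge0; [exact: ltW|apply: addr_ge0 => //; exact: ltW].
  apply: lerXn2r; rewrite ?nnegrE ?invr_ge0//; first by rewrite mulr_ge0 ?expR_ge0.
  have e0 := expR_gt0 (C * H).
  apply: (@le_trans _ _ (expR (C * H) * (2 * expR (C * H))^-1)); first by rewrite ler_pM2l.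
  by rewrite invfM mulrCA divff ?mulr1// gt_eqF.
rewrite exprVn lef_pV2 ?posrE ?exprn_gt0//; apply: (le_trans Lr).
by rewrite -natrX ler_nat ltnW// ltn_expl.
Qed.

Lemma lam_good r s0 B H eta : 0 <= B -> 0 < eta -> 1 <= r -> (state_norm s0)%:R <= B * r ->
  (lam (~` good r s0 H eta (njumps_max (njumps_factor B H) r)) <=
     ((1 + 4 * (8 * (njumps_factor B H + 2) / decay eta (njumps_factor B H) ^+ 2)) / r)%:E)%E.
Proof.
move=> B0 e0 r1 sB; set K := njumps_factor B H; have r0 : 0 < r by lra.
have K0 : 0 <= K by exact: njumps_factor_ge0.
have mN c : measurable (small_noise r c s0 eta (njumps_max K r)) by exact: measurable_small_noise.
have mG := measurable_good s0 H eta (njumps_max K r) r0.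
have mNE := measurable_nonexplosive (tgt r) (rg0 r0) (qg0 r0) s0.
have mT : measurable [set w | (H < T r (njumps_max K r) s0 w)%R].
  by apply: measurable_lt_set => //; exact: (measurable_jump_time (tgt r) (rg0 r0) (qg0 r0)).
set b := 8 * (K + 2) / _ ^+ 2.
rewrite (_ : (1 + 4 * b) / r = 0 + (r^-1 + (b / r + (b / r + (b / r + b / r))))); last by ring.
rewrite !EFinD.
apply: (le_trans (lam_setCI _ _)) => //; first by do 4?[apply: measurableI].
apply: leeD; first by rewrite /= model_nonexplosive.
apply: (le_trans (lam_setCI _ _)) => //; first by do 3?[apply: measurableI].
apply: leeD; first exact: lam_njumps_max.
apply: (le_trans (lam_setCI _ _)) => //; first by do 2?[apply: measurableI].
apply: leeD; first by apply: lam_small_noise => //; exact: unit_mark_le1.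
apply: (le_trans (lam_setCI _ _)) => //; first by apply: measurableI.
apply: leeD; first by apply: lam_small_noise => //; exact: imbalance_mark_le1.
apply: (le_trans (lam_setCI _ _)) => //.
apply: leeD; first by apply: lam_small_noise => //; exact: occupancy_mark_le1.
by apply: lam_small_noise => //; exact: additional_mark_le1.
Qed.

End good_event.

(** * Scaled estimates on good paths *)

Section good_paths.
Context {R : realType}.
Variables (lambda beta mu eps alpha : R) (gamma : nat).
Hypotheses (lambda_gt0 : 0 < lambda) (beta_gt0 : 0 < beta) (mu_gt0 : 0 < mu)
  (eps_gt0 : 0 < eps) (alpha_ge0 : 0 <= alpha) (alpha_lt1 : alpha < 1)
  (gamma_gt0 : (0 < gamma)%N).
Local Notation rate r := (model_rate lambda beta mu eps alpha gamma r).
Local Notation tgt r := (model_tgt lambda beta mu eps alpha gamma r).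
Local Notation q r := (total_rate 5 (rate r)).
Local Notation path r s t w := (model_path lambda beta mu eps alpha gamma r s t w).
Local Notation good := (good lambda beta mu eps alpha gamma).
Local Notation small_noise := (small_noise lambda beta mu eps alpha gamma).

Lemma model_path0 r s0 w : 0 < r -> path r s0 0 w = s0.
Proof.
move=> r0; rewrite /model_path; case: asboolP => // _.
apply: trajectory_before; first by move=> s; exact: total_model_rate_gt0.
by rewrite lexx hold_gt0// => s; exact: total_model_rate_gt0.
Qed.

Section one_path.
Variables (r : R) (s0 : model_state) (H eta w : R) (N : nat).
Hypotheses (r_gt0 : 0 < r) (good_w : good r s0 H eta N w).

Let rg0 s i : 0 <= rate r s i.
Proof. exact: model_rate_ge0. Qed.

Let qg0 s : 0 < q r s.
Proof. exact: total_model_rate_gt0. Qed.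

Lemma good_njumps t : 0 <= t <= H -> exists m, [/\ (m < N)%N,
  is_njumps 5 (rate r) (tgt r) s0 w t m & path r s0 t w = jump_state 5 (rate r) (tgt r) m s0 w].
Proof.
move=> /andP[t0 tH]; have [ne [HT _]] := good_w.
have [m tm] := nonexplosive_njumps ne t0.
exists m; split => //; last first.
  by rewrite (model_pathE _ ne); exact: (trajectoryE _ qg0 tm).
rewrite ltnNge; apply/negP => Nm; have /andP[h _] := tm.
have := le_trans (jump_time_homo (tgt r) qg0 s0 w Nm) (le_trans h tH).
by rewrite leNgt HT.
Qed.

Lemma state_norm_jump m : (state_norm (jump_state 5 (rate r) (tgt r) m s0 w) <= state_norm s0 + m * gamma.+2)%N.
Proof.
elim: m => [|m IH]; first by rewrite addn0.
rewrite jump_stateS; apply: leq_trans; first exact: state_norm_tgt.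
by rewrite mulSn addnCA addnC leq_add2l.
Qed.

(** Fewer than [N] jumps have occurred, and each adds at most [gamma + 2] to the norm of the
    state. *)
Lemma good_total_rate t B : 0 <= t <= H -> (state_norm s0)%:R <= B ->
  q r (path r s0 t w) <= (lambda + beta + eps + mu) * (B + N%:R * gamma.+2%:R + r).
Proof.
move=> tH sB; have [m [mN _ ->]] := good_njumps tH.
apply: le_trans (total_model_rate_le _ _ lambda_gt0 beta_gt0 mu_gt0 eps_gt0 r_gt0 _) _ => //.
apply: ler_wpM2l; first by rewrite !addr_ge0 ?ltW.
rewrite lerD2r; apply: (@le_trans _ _ ((state_norm s0 + m * gamma.+2)%N%:R)).
  by rewrite ler_nat state_norm_jump.
by rewrite natrD natrM; apply: lerD => //; apply: ler_wpM2r => //; rewrite ler_nat ltnW.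
Qed.

(** The estimate along a path with noise level [eta * r] and minimal rate [lambda * r], divided by
    [r]. *)
Lemma good_drift (c : model_state -> nat -> R) (V : model_state -> R)
    (P : model_state -> Prop) (a hi t u : R) :
  small_noise r c s0 eta N w ->
  (forall s i, P s -> 0 < rate r s i -> (i < 5)%N -> V (tgt r s i) - V s <= a * c s i) ->
  0 <= t -> t <= u -> u <= H ->
  (forall v, t <= v <= u -> P (path r s0 v w) /\ a * drift 5 (rate r) c (path r s0 v w) <= hi * r) ->
  r^-1 * (V (path r s0 u w) - V (path r s0 t w)) <=
    hi * (u - t) + `|hi| * (r^-1 / lambda + 2 * eta / lambda) + 2 * (`|a| * eta).
Proof.
move=> cw Vc t0 tu uH Pw; have [ne [HT [noise1 _]]] := good_w.
have [|m [mN tm ->]] := @good_njumps t; first by rewrite t0 (le_trans tu).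
have [|k [kN uk ->]] := @good_njumps u; first by rewrite uH (le_trans t0).
have Lam_q s : lambda * r <= q r s by exact: total_model_rate_ge.
have := path_drift rg0 qg0 (mulr_gt0 lambda_gt0 r_gt0) Lam_q noise1 cw Vc tm uk kN tu (hi := hi * r).
move=> /(_ _)/wrap[].
  move=> v j /[dup] tvu /Pw; rewrite (model_pathE _ ne) => + vj.
  by rewrite (trajectoryE _ qg0 vj).
set dV := V _ - _ => h.
rewrite -(ler_pM2l r_gt0) mulVKf ?gt_eqF//; apply: (le_trans h).
rewrite normrM (gtr0_norm r_gt0) le_eqVlt; apply/orP; left; apply/eqP.
by field; rewrite !gt_eqF.
Qed.

End one_path.

Section path_sequences.
Variables (r : nat -> R) (s0 : nat -> model_state) (w : nat -> R) (K : nat -> R) (B : R).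
Hypotheses (r_gt0 : forall n, 0 < r n) (r_infty : r @ \oo --> +oo) (K_ge0 : forall i, 0 <= K i)
  (B_ge0 : 0 <= B)
  (s0_le : \forall n \near \oo, (state_norm (s0 n))%:R <= B * r n)
  (good_w : forall i, \forall n \near \oo,
     good (r n) (s0 n) i.+1%:R i.+1%:R^-1 (njumps_max (K i) (r n)) (w n)).
Local Notation S n t := (path (r n) (s0 n) t (w n)).

Let r_ge (x : R) : \forall n \near \oo, x <= r n.
Proof. exact: (cvgryPge _).1. Qed.

Lemma sequence_drift_bound (c : model_state -> nat -> R) (V : model_state -> R)
    (P : nat -> model_state -> Prop) (a : R) (C h : nat -> R -> R) :
  (forall r s0 H eta N w, good r s0 H eta N w -> small_noise r c s0 eta N w) ->
  (\forall n \near \oo, forall s i, P n s -> 0 < rate (r n) s i -> (i < 5)%N ->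
     V (tgt (r n) s i) - V s <= a * c s i) ->
  (forall n t u, C n u - C n t = (r n)^-1 * (V (S n u) - V (S n t))) ->
  (forall n v, 0 <= v -> a * drift 5 (rate (r n)) c (S n v) = h n v * r n) ->
  drift_bound (fun n v => P n (S n v)) C h.
Proof.
move=> good_c Vc CV hc H M d d0.
(* One index sets both horizon and precision: [i + 1] exceeds [H], and noise at level [1 / (i + 1)]
   costs at most [d / 2]. The other half of [d] is met by taking [r] large. *)
pose i := Num.truncn (`|H| + (`|M| * (2 / lambda) + 2 * `|a|) * (2 / d)).
have a0 := normr_ge0 a; have M0 := normr_ge0 M.
have E0 : 0 <= `|M| * (2 / lambda) + 2 * `|a|.
  by apply: addr_ge0; apply: mulr_ge0 => //; apply: divr_ge0 => //; exact: ltW.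
have ED0 : 0 <= (`|M| * (2 / lambda) + 2 * `|a|) * (2 / d).
  by apply: mulr_ge0 => //; apply: divr_ge0 => //; exact: ltW.
have i_ge : `|H| + (`|M| * (2 / lambda) + 2 * `|a|) * (2 / d) <= i.+1%:R.
  exact/ltW/truncnS_gt.
have Hi : H <= i.+1%:R by have := ler_norm H; lra.
have e_i : (`|M| * (2 / lambda) + 2 * `|a|) * i.+1%:R^-1 <= d / 2.
  rewrite ler_pdivrMr//; have := normr_ge0 H => H0.
  rewrite -[d / 2]invrK invf_div -ler_pdivrMl ?invr_gt0 ?divr_gt0// invrK mulrC.
  by apply: le_trans i_ge; rewrite lerDr.
near=> n.
move=> t u hi t0 tu uH hiM Ph.
have r0 := r_gt0 n.
have gw : good (r n) (s0 n) i.+1%:R i.+1%:R^-1 (njumps_max (K i) (r n)) (w n).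
  by near: n; exact: good_w.
have VcN : forall s i, P n s -> 0 < rate (r n) s i -> (i < 5)%N ->
     V (tgt (r n) s i) - V s <= a * c s i by near: n.
have rn : `|M| / lambda * (2 / d) + 1 <= r n by near: n; exact: r_ge.
rewrite CV; apply: (le_trans (good_drift r0 gw (good_c _ _ _ _ _ _ gw) VcN t0 tu (le_trans uH Hi) (hi := hi) _)).
  move=> v tvu; have [h1 h2] := Ph v tvu; split => //.
  rewrite hc; last by case/andP: tvu => tv _; exact: le_trans tv.
  by rewrite ler_pM2r.
rewrite -addrA lerD2l [X in X + _]mulrDr -addrA.
have err1 : `|hi| * ((r n)^-1 / lambda) <= d / 2.
  apply: (@le_trans _ _ (`|M| * ((r n)^-1 / lambda))).
    apply: ler_wpM2r; last by apply: le_trans hiM _; exact: ler_norm.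
    by rewrite divr_ge0// ?invr_ge0 ltW.
  rewrite mulrCA mulrC ler_pdivrMr// -[d / 2]invrK invf_div -ler_pdivrMl ?invr_gt0 ?divr_gt0// invrK.
  by rewrite mulrC; lra.
have err2 : `|hi| * (2 * i.+1%:R^-1 / lambda) + 2 * (`|a| * i.+1%:R^-1) <= d / 2.
  apply: le_trans e_i; rewrite [leRHS]mulrDl; apply: lerD; last by rewrite mulrA.
  rewrite (_ : `|M| * (2 / lambda) * i.+1%:R^-1 = `|M| * (2 * i.+1%:R^-1 / lambda)); last first.
    by rewrite -!mulrA; congr (_ * (_ * _)); rewrite mulrC.
  apply: ler_wpM2r; last by apply: le_trans hiM _; exact: ler_norm.
  by rewrite divr_ge0// ?mulr_ge0 ?invr_ge0// ltW.
by apply: (le_trans (lerD err1 err2)); rewrite -splitr.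
Unshelve. all: by end_near. Qed.

(** [V] and [- V] grow by at most [a] per jump. With the constant mark 1 the drift is the total
    rate, of order [r] on good paths, so after scaling the speed is bounded by [D]. *)
Lemma sequence_lipschitz (V : model_state -> R) (a : R) (C : nat -> R -> R) : 0 <= a ->
  (forall n s i, 0 < rate (r n) s i -> (i < 5)%N -> `|V (tgt (r n) s i) - V s| <= a) ->
  (forall n t u, C n u - C n t = (r n)^-1 * (V (S n u) - V (S n t))) ->
  asymptotically_lipschitz C.
Proof.
move=> a0 Va CV H.
pose i := Num.truncn `|H|.
have Hi : H <= i.+1%:R by apply: (le_trans (ler_norm H)); exact/ltW/truncnS_gt.
pose D := a * ((lambda + beta + eps + mu) * (B + (K i + 1) * gamma.+2%:R + 1)).
have D0 : 0 <= D.
  apply: mulr_ge0 => //; apply: mulr_ge0; first by rewrite !addr_ge0 ?ltW.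
  by rewrite !addr_ge0// mulr_ge0// addr_ge0.
have hD : \forall n \near \oo, forall v, 0 <= v <= H -> a * drift 5 (rate (r n)) unit_mark (S n v) / r n <= D.
  near=> n => v /andP[v0 vH]; have r0 := r_gt0 n.
  have r1 : 1 <= r n by near: n; exact: r_ge.
  have gw : good (r n) (s0 n) i.+1%:R i.+1%:R^-1 (njumps_max (K i) (r n)) (w n).
    by near: n; exact: good_w.
  have sB : (state_norm (s0 n))%:R <= B * r n by near: n.
  rewrite drift_unit ler_pdivrMr// /D -mulrA; apply: ler_wpM2l => //.
  have vi : 0 <= v <= i.+1%:R by rewrite v0 (le_trans vH).
  apply: (le_trans (good_total_rate r0 gw vi sB)); rewrite -mulrA.
  apply: ler_wpM2l; first by rewrite !addr_ge0 ?ltW.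
  rewrite [leRHS](_ : _ = B * r n + (K i + 1) * r n * gamma.+2%:R + r n); last by ring.
  by rewrite lerD2r lerD2l; apply: ler_wpM2r => //; exact: njumps_max_le.
have unit_noise r' s' H' eta N w' : good r' s' H' eta N w' -> small_noise r' unit_mark s' eta N w'.
  by case=> _ [_ []].
pose h n v := a * drift 5 (rate (r n)) unit_mark (S n v) / r n.
have hE n v : 0 <= v -> a * drift 5 (rate (r n)) unit_mark (S n v) = h n v * r n.
  by move=> _; rewrite /h divfK// gt_eqF.
have up : drift_bound (fun n v => True) C h.
  apply: (@sequence_drift_bound unit_mark V (fun _ _ => True) a) => //.
  apply: nearW => n s j _ sj j5; rewrite mulr1; apply: le_trans (Va n s j sj j5); exact: ler_norm.
have down : drift_bound (fun n v => True) (fun n v => - C n v) h.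
  apply: (@sequence_drift_bound unit_mark (fun s => - V s) (fun _ _ => True) a) => //.
    apply: nearW => n s j _ sj j5; rewrite mulr1; apply: le_trans (Va n s j sj j5).
    by rewrite -opprD; rewrite -normrN; exact: ler_norm.
  by move=> n t u; rewrite -opprD CV -opprD mulrN.
exists D => d d0; near=> n => t u t0 tu uH.
have hD' : forall v, t <= v <= u -> True /\ h n v <= D.
  move=> v /andP[tv vu]; split => //.
  have : forall v, 0 <= v <= H -> a * drift 5 (rate (r n)) unit_mark (S n v) / r n <= D by near: n.
  by apply; rewrite (le_trans t0 tv) (le_trans vu uH).
have hu : forall t u hi, 0 <= t -> t <= u -> u <= H -> `|hi| <= D ->
    (forall v, t <= v <= u -> True /\ h n v <= hi) -> C n u - C n t <= hi * (u - t) + d.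
  by near: n; exact: up.
have hl : forall t u hi, 0 <= t -> t <= u -> u <= H -> `|hi| <= D ->
    (forall v, t <= v <= u -> True /\ h n v <= hi) -> - C n u - - C n t <= hi * (u - t) + d.
  by near: n; exact: down.
have DD : `|D| <= D by rewrite ger0_norm.
have := hu t u D t0 tu uH DD hD'; have := hl t u D t0 tu uH DD hD'.
by rewrite ler_norml; lra.
Unshelve. all: by end_near. Qed.

End path_sequences.

End good_paths.

(** * Fluid limits of good paths *)

Section coordinates.
Context {R : realType}.
Variables (lambda beta mu alpha r : R).
Hypotheses (beta_gt0 : 0 < beta) (mu_gt0 : 0 < mu) (r_gt0 : 0 < r).
Implicit Types s : model_state.

Lemma XbarE s : Xbar lambda beta alpha r s = r^-1 * (pending s - lambda * r * (1 - alpha) / beta).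
Proof. by case: s => -[]. Qed.

Lemma YbarE s : Ybar r s = r^-1 * imbalance s.
Proof. by case: s => -[]. Qed.

Lemma WbarE s : Wbar lambda mu r s = r^-1 * (occupancy s - 2 * lambda * r / mu).
Proof. by case: s => -[]. Qed.

Lemma pending_ge0 s : 0 <= pending s :> R.
Proof. by case: s => -[]. Qed.

Lemma Xbar_ge s : - (lambda * (1 - alpha) / beta) <= Xbar lambda beta alpha r s.
Proof.
have -> : - (lambda * (1 - alpha) / beta) = r^-1 * (0 - lambda * r * (1 - alpha) / beta).
  by field; rewrite !gt_eqF.
by rewrite XbarE ler_pM2l ?invr_gt0// lerD2r pending_ge0.
Qed.

Lemma norm_Ybar s : `|Ybar r s| = r^-1 * `|imbalance s|.
Proof. by rewrite YbarE normrM gtr0_norm// invr_gt0. Qed.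

Lemma state_norm_le s : (state_norm s)%:R <= pending s + occupancy s :> R.
Proof.
case: s => -[x y] z; rewrite /= !natrD natr_absz intr_norm.
have : 0 <= z%:R :> R by []. lra.
Qed.

Lemma state_norm_bar s : (state_norm s)%:R <=
  (Xbar lambda beta alpha r s + lambda * (1 - alpha) / beta + (Wbar lambda mu r s + 2 * lambda / mu)) * r.
Proof.
apply: (le_trans (state_norm_le s)); rewrite XbarE WbarE le_eqVlt; apply/orP; left; apply/eqP.
by field; rewrite !gt_eqF.
Qed.

End coordinates.

Section good_sequences.
Context {R : realType}.
Variables (lambda beta mu eps alpha : R) (gamma : nat).
Hypotheses (lambda_gt0 : 0 < lambda) (beta_gt0 : 0 < beta) (mu_gt0 : 0 < mu)
  (eps_gt0 : 0 < eps) (alpha_ge0 : 0 <= alpha) (alpha_lt1 : alpha < 1)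
  (gamma_gt0 : (0 < gamma)%N).
Local Notation path r s t w := (model_path lambda beta mu eps alpha gamma r s t w).
Local Notation good := (good lambda beta mu eps alpha gamma).
Local Notation X := (Xbar lambda beta alpha).
Local Notation Y := Ybar.
Local Notation W := (Wbar lambda mu).

Variables (r : nat -> R) (s0 : nat -> model_state) (x0 y0 w0 : R).
Hypotheses (r_gt0 : forall n, 0 < r n)
  (cvg_x0 : X (r n) (s0 n) @[n --> \oo] --> x0)
  (cvg_w0 : W (r n) (s0 n) @[n --> \oo] --> w0).

(** [|y|] is part of the occupancy, so the coordinates [X] and [W] control the whole state. *)
Lemma state_norm_bound : exists2 B, 0 <= B &
  \forall n \near \oo, (state_norm (s0 n))%:R <= B * r n.
Proof.
exists `|x0 + 1 + lambda * (1 - alpha) / beta + (w0 + 1 + 2 * lambda / mu)| => //.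
near=> n; have r0 := r_gt0 n.
apply: (le_trans (state_norm_bar lambda alpha beta_gt0 mu_gt0 r0 (s0 n))).
rewrite ler_pM2r//; apply: le_trans (ler_norm _); rewrite !lerD//.
- by near: n; apply: (cvgr_le _ cvg_x0); rewrite ltrDl.
- by near: n; apply: (cvgr_le _ cvg_w0); rewrite ltrDl.
Unshelve. all: by end_near. Qed.

Hypotheses (r_infty : r @ \oo --> +oo) (cvg_y0 : Y (r n) (s0 n) @[n --> \oo] --> y0).
Variables (w K : nat -> R).
Hypotheses (K_ge0 : forall i, 0 <= K i)
  (good_w : forall i, \forall n \near \oo,
     good (r n) (s0 n) i.+1%:R i.+1%:R^-1 (njumps_max (K i) (r n)) (w n)).
Local Notation S n t := (path (r n) (s0 n) t (w n)).

Theorem good_fluid_limit : exists psi : nat -> nat, subsequence psi /\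
  exists x y z : R -> R,
    [/\ cvg_uoc (fun n t => X (r (psi n)) (S (psi n) t)) x,
        cvg_uoc (fun n t => Y (r (psi n)) (S (psi n) t)) y,
        cvg_uoc (fun n t => W (r (psi n)) (S (psi n) t)) z,
        [/\ x 0 = x0, y 0 = y0 & z 0 = w0] &
        fluid_trajectory lambda beta mu eps alpha gamma x y z].
Proof.
have [B B0 sB] := state_norm_bound.
have S0 n : S n 0 = s0 n by rewrite model_path0.
pose b := lambda * (1 - alpha) / beta.
have rV n : r n != 0 by rewrite gt_eqF.
have bV : beta != 0 by rewrite gt_eqF.
have mV : mu != 0 by rewrite gt_eqF.
have driftB := sequence_drift_bound lambda_gt0 beta_gt0 mu_gt0 eps_gt0 alpha_ge0 alpha_lt1
  r_gt0 r_infty good_w.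
have lip := sequence_lipschitz lambda_gt0 beta_gt0 mu_gt0 eps_gt0 alpha_ge0 alpha_lt1
  r_gt0 r_infty K_ge0 B0 sB good_w.
have noiseY r' s' H' eta N w' : good r' s' H' eta N w' ->
    small_noise lambda beta mu eps alpha gamma r' imbalance_mark s' eta N w'.
  by case=> _ [_ [_ []]].
have noiseW r' s' H' eta N w' : good r' s' H' eta N w' ->
    small_noise lambda beta mu eps alpha gamma r' occupancy_mark s' eta N w'.
  by case=> _ [_ [_ [_ []]]].
have noiseA r' s' H' eta N w' : good r' s' H' eta N w' ->
    small_noise lambda beta mu eps alpha gamma r' additional_mark s' eta N w'.
  by case=> _ [_ [_ [_ []]]].
apply: (@fluid_limit R lambda beta mu eps alpha gamma beta_gt0 eps_gt0
  (fun n t => X (r n) (S n t)) (fun n t => Y (r n) (S n t)) (fun n t => W (r n) (S n t))).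
- by under eq_fun do rewrite S0.
- by under eq_fun do rewrite S0.
- by under eq_fun do rewrite S0.
- apply: (lip pending gamma%:R) => //; last by move=> n t u; rewrite !XbarE; field; rewrite ?bV ?mV ?rV.
  by move=> n s i _ i5; exact: pending_tgt_le.
- apply: (lip imbalance 1) => //; last by move=> n t u; rewrite !YbarE mulrBr.
  by move=> n s i _ i5; rewrite imbalance_tgt//; exact: imbalance_mark_le1.
- apply: (lip occupancy 2) => //; last by move=> n t u; rewrite !WbarE; field; rewrite ?bV ?mV ?rV.
  move=> n s i si i5; rewrite occupancy_tgt// normrM ger0_norm// ler_piMr//.
  exact: occupancy_mark_le1.
- apply: (driftB imbalance_mark imbalance (fun _ _ => True) 1) => //.
  + by apply: nearW => n s i _ _ i5; rewrite imbalance_tgt// mul1r.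
  + by move=> n t u; rewrite !YbarE mulrBr.
  + move=> n v _; rewrite /fluid_drift norm_Ybar// drift_imbalance XbarE WbarE.
    by field; rewrite ?bV ?mV ?rV.
- apply: (driftB imbalance_mark (fun s => - imbalance s) (fun _ _ => True) (-1)) => //.
  + by apply: nearW => n s i _ _ i5; rewrite -opprD imbalance_tgt// mulN1r.
  + by move=> n t u; rewrite !YbarE; ring.
  + move=> n v _; rewrite /fluid_drift norm_Ybar// drift_imbalance XbarE WbarE.
    by field; rewrite ?bV ?mV ?rV.
- apply: (driftB occupancy_mark occupancy (fun _ _ => True) 2) => //.
  + by apply: nearW => n s i _ si i5; rewrite occupancy_tgt.
  + by move=> n t u; rewrite !WbarE; field; rewrite ?bV ?mV ?rV.
  + move=> n v _; rewrite /fluid_drift norm_Ybar// drift_occupancy XbarE WbarE.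
    by field; rewrite ?bV ?mV ?rV.
- apply: (driftB occupancy_mark (fun s => - occupancy s) (fun _ _ => True) (-2)) => //.
  + by apply: nearW => n s i _ si i5; rewrite -opprD occupancy_tgt// mulNr.
  + by move=> n t u; rewrite !WbarE; field; rewrite ?bV ?mV ?rV.
  + move=> n v _; rewrite /fluid_drift norm_Ybar// mulNr drift_occupancy XbarE WbarE.
    by field; rewrite ?bV ?mV ?rV.
- apply: (driftB additional_mark (fun s => - (pending s + gamma%:R * imbalance s))
    (fun _ _ => True) 1) => //.
  + apply: nearW => n s i _ _ i5; rewrite mul1r.
    exact: pending_imbalance_tgt_ge.
  + by move=> n t u; rewrite !XbarE !YbarE; field; rewrite ?bV ?mV ?rV.
  + by move=> n v _; rewrite drift_additional YbarE; field; rewrite ?bV ?mV ?rV.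
- move=> kappa k0.
  apply: (driftB additional_mark (fun s => pending s + gamma%:R * imbalance s)
    (fun n s => - b + kappa <= X (r n) s) (-1)) => //.
  (* The condition says that at least [kappa * r] invitations are pending, which is more than
     [gamma] for large [r]. *)
  + near=> n => s i Xs _ i5; rewrite mulN1r.
    apply: pending_imbalance_tgt_le => //.
    have r0 := r_gt0 n.
    apply: (@le_trans _ _ (kappa * r n)).
      by rewrite -ler_pdivrMl// mulrC; near: n; exact: (cvgryPge _).1.
    rewrite -ler_pdivlMr// mulrC.
    have -> : (r n)^-1 * pending s = b + X (r n) s by rewrite XbarE /b; field; rewrite ?bV ?mV ?rV.
    by rewrite -lerBlDl addrC.
  + by move=> n t u; rewrite !XbarE !YbarE; field; rewrite ?bV ?mV ?rV.
  + by move=> n v _; rewrite drift_additional YbarE; field; rewrite ?bV ?mV ?rV.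
- by move=> n t _; exact: Xbar_ge.
Unshelve. all: by end_near. Qed.

End good_sequences.

(** * Assembly on one probability space *)

Lemma cvg_subsequence (phi : nat -> nat) : subsequence phi -> phi @ \oo --> \oo.
Proof.
move=> phi_sub A [N _ NA]; exists N => // n /= Nn; apply: NA => /=.
apply: (leq_trans Nn); elim: n {Nn} => // n IH.
exact: leq_ltn_trans IH (phi_sub _ _ (ltnSn n)).
Qed.

Theorem theorem1 (R : realType)
    (lambda beta mu eps alpha : R) (gamma : nat)
    (lambda_gt0 : 0 < lambda) (beta_gt0 : 0 < beta) (mu_gt0 : 0 < mu)
    (eps_gt0 : 0 < eps) (alpha_ge0 : 0 <= alpha) (alpha_lt1 : alpha < 1)
    (gamma_gt0 : (0 < gamma)%N)
    (r : nat -> R) (r_gt0 : forall n, 0 < r n) (r_infty : r @ \oo --> +oo)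
    (s0 : nat -> state) (x0 y0 w0 : R)
    (x0_ge : - (lambda * (1 - alpha) / beta) <= x0)
    (cvg_x0 : Xbar lambda beta alpha (r n) (s0 n) @[n --> \oo] --> x0)
    (cvg_y0 : Ybar (r n) (s0 n) @[n --> \oo] --> y0)
    (cvg_w0 : Wbar lambda mu (r n) (s0 n) @[n --> \oo] --> w0) :
  exists (d : measure_display) (Omega : measurableType d)
    (P : probability Omega R) (S : nat -> R -> Omega -> state),
    (forall n : nat,
       markov_process P (events (lambda * r n) beta mu eps alpha gamma)
         (s0 n) (S n)) /\
    {ae P, forall omega : Omega,
      forall phi : nat -> nat, subsequence phi ->
      exists psi : nat -> nat, subsequence psi /\
      exists x y w : R -> R,
        let k (n : nat) := phi (psi n) in
        [/\ cvg_uoc (fun n t =>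
              Xbar lambda beta alpha (r (k n)) (S (k n) t omega)) x,
            cvg_uoc (fun n t => Ybar (r (k n)) (S (k n) t omega)) y,
            cvg_uoc (fun n t =>
              Wbar lambda mu (r (k n)) (S (k n) t omega)) w,
            [/\ x 0 = x0, y 0 = y0 & w 0 = w0] &
            fluid_trajectory lambda beta mu eps alpha gamma x y w]}.
Proof.
have [B B0 sB] := state_norm_bound beta_gt0 mu_gt0 r_gt0 cvg_x0 cvg_w0.
(* Level [i] asks for good paths up to time [i + 1] with precision [1 / (i + 1)]; [K i] is the
   matching budget of jumps in units of [r]. *)
pose K i := njumps_factor lambda beta mu eps gamma B i.+1%:R.
have K0 i : 0 <= K i by exact: njumps_factor_ge0.
pose G n i := good lambda beta mu eps alpha gamma (r n) (s0 n) i.+1%:R i.+1%:R^-1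
  (njumps_max (K i) (r n)).
have mG n i : measurable (G n i) by exact: measurable_good.
have lamG i (d : R) : 0 < d -> \forall n \near \oo, (lam (~` G n i) <= d%:E)%E.
  move=> d0; set M := 1 + 4 * (8 * (K i + 2) / decay i.+1%:R^-1 (K i) ^+ 2).
  near=> n; have r1 : 1 <= r n by near: n; exact: (cvgryPge _).1.
  have e0 : 0 < (i.+1%:R : R)^-1 by rewrite invr_gt0.
  have sBn : (state_norm (s0 n))%:R <= B * r n by near: n.
  apply: (le_trans (lam_good gamma lambda_gt0 beta_gt0 mu_gt0 eps_gt0 alpha_ge0 alpha_lt1
    i.+1%:R B0 e0 r1 sBn)).
  rewrite lee_fin -/(K i) -/M ler_pdivrMr// mulrC -ler_pdivrMr//.
  by near: n; exact: (cvgryPge _).1.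
have [th [mth lam_th ae_good]] := exists_coupling (fun n i => measurableC (mG n i)) lamG.
exists _, _, lam, (fun n t w => model_path lambda beta mu eps alpha gamma (r n) (s0 n) t (th n w)).
split; first by move=> n; exact: (model_markov_process gamma lambda_gt0 beta_gt0 mu_gt0 eps_gt0
    alpha_ge0 alpha_lt1 (r_gt0 n) (s0 n) (mth n) (lam_th n)).
(* The null set stems from the full sequence, so it does not depend on [phi]. *)
apply: filterS ae_good => w good_w phi phi_sub.
have phi_oo := cvg_subsequence phi_sub.
have sub (u : R ^nat) (l : R) : u @ \oo --> l -> (u \o phi) @ \oo --> l by exact: cvg_comp.
have r_oo : (r \o phi) @ \oo --> +oo by move=> A /r_infty /phi_oo.
have [|psi [psi_sub [x [y [z H]]]]] := @good_fluid_limit R lambda beta mu eps alpha gamma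
  lambda_gt0 beta_gt0 mu_gt0 eps_gt0 alpha_ge0 alpha_lt1 gamma_gt0 (r \o phi) (s0 \o phi)
  x0 y0 w0 (fun n => r_gt0 (phi n)) (sub _ _ cvg_x0) (sub _ _ cvg_w0) r_oo
  (sub _ _ cvg_y0) (fun n => th (phi n) w) K K0.
  by move=> i; have [N _ NP] := phi_oo _ (good_w i); exists N => // n /NP/= /contrapT.
exists psi; split => //; exists x, y, z; exact: H.
Unshelve. all: by end_near. Qed.
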